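(* Let $d\ge 2$ and let $\mu$ be a nonzero positive, bounded Radon measure on $\mathbb{R}^d$ which is Ahlfors regular in dimension $d$. Let $f:\mathbb{R}_+\to\mathbb{R}_+$ be continuous on $[0,+\infty)$, twice continuously differentiable for $z>0$, with $f(0)=0$, $f'(z)>0$ and $f''(z)\le 0$ for all $z>0$, and let $\alpha\in[0,1]$. If either $\alpha<1-\frac1d$, or $$\liminf_{z\to0^+}z^{-\beta}f(z)>0\quad\text{for some }\beta<1-\frac1{d-1},$$ then the weighted irrigation cost of $\mu$ (with respect to $f$ and $\alpha$) is infinite: $\mathcal{I}^{W,\alpha}(\mu)=+\infty$.
   Context: Here $\mathbb{R}_+=[0,+\infty)$. **Ahlfors regularity.** A positive bounded measure $\mu$ on $\mathbb{R}^d$ is Ahlfors regular in dimension $\gamma>0$ if there is a constant $C\ge1$ with $\frac1C r^\gamma\le\mu(B(x,r))\le Cr^\gamma$ for all $x\in\mathrm{supp}(\mu)$ and $r\in[0,1]$, where $B(x,r)$ is the ball of radius $r$ centered at $x$. **Irrigation plans.** Let $\mu$ be a positive Radon measure on $\mathbb{R}^d$ with $\mu(\mathbb{R}^d)=M<\infty$ and let $\Theta=[0,M]$ (with Lebesgue measure $\mathrm{meas}$). An irrigation plan for $\mu$ is a function $\chi:\Theta\times\mathbb{R}_+\to\mathbb{R}^d$, measurable in $\theta$ and continuous in $t$, such that: (i) $\chi(\theta,0)=0$ for all $\theta$; (ii) for a.e. $\theta$ the map $t\mapsto\chi(\theta,t)$ is 1-Lipschitz and constant for $t$ large; $\tau(\theta)$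 denotes the smallest time $\tau$ such that $\chi(\theta,\cdot)$ is constant for $t\ge\tau$; (iii) for each Borel set $V\subseteq\mathbb{R}^d$, $\mu(V)=\mathrm{meas}(\{\theta\in\Theta:\chi(\theta,\tau(\theta))\in V\})$. **Multiplicity.** Two 1-Lipschitz maps $\gamma:[0,t]\to\mathbb{R}^d$, $\tilde\gamma:[0,\tilde t]\to\mathbb{R}^d$ are equivalent, $\gamma\simeq\tilde\gamma$, if their arc-length re-parametrizations coincide. Write $(\theta,t)\sim(\theta',t')$ if $\chi(\theta,\cdot)|_{[0,t]}\simeq\chi(\theta',\cdot)|_{[0,t']}$, and put $m(\theta,t)=\mathrm{meas}(\{\theta'\in\Theta:(\theta',t')\sim(\theta,t)\text{ for some }t'>0\})$. Condition (A2) on $\chi$: for a.e. $\theta\in\Theta$, $m(\theta,t)>0$ for every $0\le t<\tau(\theta)$. **Weights on finitely many branches.** Consider a finite rooted family of branches $\gamma_i:[a_i,b_i]\to\mathbb{R}^d$, $i=1,\dots,N$, parametrized by arc-length and oriented from the root to the tips, with left-continuous non-increasing fluxes $m_i:[a_i,b_i]\to\mathbb{R}_+$. Let $\mathcal{O}(i)$ be the set of indices $j$ of branches that originate at the end node $\gamma_i(b_i)$ of $\gamma_i$. The weights $W_i$ are defined by backward induction (first the branches with $\mathcal{O}(i)=\emptyset$, then those all of whose successors have been treated, and so on): $W_i$ is the solution $\omega$ of $$\omega(t)=\int_t^{b_i} f(\omega(s))\,ds+m_i(t)+\overline\omega_i,\quad t\in(a_i,b_i],\qquad \overline\omega_i=\sum_{j\in\mathcal{O}(i)}W_j(a_j^+)-\sum_{j\in\mathcal{O}(i)}m_j(a_j^+)$$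 (so $\overline\omega_i=0$ if $\mathcal{O}(i)=\emptyset$). **Weight of an irrigation plan.** Let $\chi$ be an irrigation plan satisfying (A2) and $\varepsilon>0$. A path $\gamma:[0,\ell]\to\mathbb{R}^d$ parametrized by arc-length is $\varepsilon$-good if $\mathrm{meas}(\{\theta:\chi(\theta,\cdot)|_{[0,t]}\simeq\gamma\text{ for some }t>0\})\ge\varepsilon$. Order paths by $\gamma\preceq\tilde\gamma$ if $\tilde\gamma$ extends $\gamma$. There are finitely many maximal $\varepsilon$-good paths $\hat\gamma_1,\dots,\hat\gamma_\nu$, $\hat\gamma_i:[0,\hat\ell_i]\to\mathbb{R}^d$, with fluxes $\hat m_i(s)=\mathrm{meas}(\{\theta:\exists t\ge0,\ \chi(\theta,\cdot)|_{[0,t]}\simeq\hat\gamma_i|_{[0,s]}\})$. Let $\tau_{ij}=\max\{t\ge 0:\hat\gamma_i(s)=\hat\gamma_j(s)\ \forall s\in[0,t]\}$. Each $\hat\gamma_i$ is split at the times $\tau_{ij}$ into elementary branches (restrictions to the consecutive subintervals, the last ending at $\hat\ell_i$), with flux the restriction of $\hat m_i$; pieces common to several maximal paths are listed only once. This gives a finite rooted tree of branches (branch $j$ follows branch $i$ when it begins where $i$ ends along a maximal path), on which weights are defined by backward induction from the tips to the root: writing the elementary branches as $\gamma_k:[a_k,b_k]\to\mathbb{R}^d$ with fluxes $m_k$, and $\mathcal{O}(k)$ for the set of indices of the branches that follow branch $k$, the weight $W_k$ is the solution $\omega$ of $\omega(t)=\int_t^{b_k}f(\omega(s))\,ds+m_k(t)+\overline\omega_k$,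 $t\in(a_k,b_k]$, with $\overline\omega_k=\sum_{j\in\mathcal{O}(k)}W_j(a_j^+)-\sum_{j\in\mathcal{O}(k)}m_j(a_j^+)$; let $\hat W_i:[0,\hat\ell_i]\to\mathbb{R}_+$ be the resulting weight along $\hat\gamma_i$. Let $\tau_\varepsilon(\theta)=\max\{t\ge0:m(\theta,t)\ge\varepsilon\}$. Set $W^\varepsilon(\theta,t)=\hat W_i(s)$ if $t\le\tau_\varepsilon(\theta)$ and $\chi(\theta,\cdot)|_{[0,t]}\simeq\hat\gamma_i|_{[0,s]}$, and $W^\varepsilon(\theta,t)=0$ if $t>\tau_\varepsilon(\theta)$. The weight function of $\chi$ is $W(\theta,t)=\sup_{\varepsilon>0}W^\varepsilon(\theta,t)$. **Weighted cost.** For $\alpha\in[0,1]$, $$\mathcal{E}^{W,\alpha}(\chi)=\int_0^M\int_0^{\tau(\theta)}\frac{(W(\theta,t))^\alpha}{m(\theta,t)}\,|\dot\chi(\theta,t)|\,dt\,d\theta,\qquad \mathcal{I}^{W,\alpha}(\mu)=\inf_\chi\mathcal{E}^{W,\alpha}(\chi),$$ the infimum being over all irrigation plans $\chi$ for $\mu$ satisfying (A2) (plans violating (A2) are regarded as having infinite cost; the infimum over the empty set is $+\infty$). *)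

(* Defs.v *)
From HB Require Import structures.
From mathcomp Require Import all_boot all_order all_algebra.
From mathcomp Require Import all_classical all_reals all_analysis.
Set Implicit Arguments.
Unset Strict Implicit.
Unset Printing Implicit Defensive.
Import Order.TTheory GRing.Theory Num.Theory.
Import numFieldNormedType.Exports.

Local Open Scope ring_scope.
Local Open Scope classical_set_scope.

(** * R^d and its Borel measures *)

Section Euclidean.
Context {R : realType} {d : nat}.

(* The library norm on ['rV[R]_d] is the sup norm (same topology). *)
Definition enorm (x : 'rV[R]_d) : R := Num.sqrt (\sum_i x ord0 i ^+ 2).

Definition eball (x : 'rV[R]_d) (r : R) : set 'rV[R]_d :=
  [set y | enorm (y - x) < r].

End Euclidean.

Definition borelR (R : realType) (d : nat) :=
  g_sigma_algebraType (@open 'rV[R]_d).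

(* R with its Lebesgue-measurable (Caratheodory) sets. *)
Definition lebesgueR (R : realType) :=
  caratheodory_type (wlength (@idfun R))^*%mu.

Section Ahlfors.
Context {R : realType} {d : nat}.
Implicit Type mu : {finite_measure set (borelR R d) -> \bar R}.

Definition msupp mu : set 'rV[R]_d :=
  [set x | forall U : set 'rV[R]_d, open U -> U x -> (0 < mu U)%E].

Definition ahlfors_regular mu (gamma : R) : Prop :=
  0 < gamma /\
  exists2 C : R, 1 <= C &
    forall x r, msupp mu x -> 0 <= r <= 1 ->
      ((C^-1 * r `^ gamma)%:E <= mu (eball x r))%E /\
      (mu (eball x r) <= (C * r `^ gamma)%:E)%E.

End Ahlfors.

(** * Arc-length parametrization and equivalence of paths *)

Section Paths.
Context {R : realType} {d : nat}.
Implicit Types (g h : R -> 'rV[R]_d) (s t : R).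

(* Only the values of [g] on [0, +oo[ matter.  All these notions are used for
   1-Lipschitz maps, which are differentiable almost everywhere. *)
Definition lipschitz1 (D : set R) g : Prop :=
  forall s t, D s -> D t -> enorm (g s - g t) <= `|s - t|.

Definition arc_length g t : R :=
  \int[lebesgue_measure]_(s in `[0, t]) enorm (g^`()%classic s).

(* A path [l, c] stands for c : [0, l] -> R^d; well-formed paths vanish outside
   [0, l], so that Leibniz equality is equality of maps on [0, l]. *)
Definition path : Type := (R * (R -> 'rV[R]_d))%type.

Definition mkpath (l : R) g : path := (l, patch (fun=> 0) `[0, l] g).

Definition cut (p : path) s : path := mkpath s p.2.

Definition path_le (p q : path) : Prop := p.1 <= q.1 /\ p = cut q p.1.

(* Arc-length re-parametrization of the restriction of [g] to [0, t]. *)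
Definition arc_path g t : path :=
  mkpath (arc_length g t)
    (fun s => g (inf [set u | 0 <= u /\ s <= arc_length g u])).

Definition equiv_path g t h t' : Prop := arc_path g t = arc_path h t'.

Definition is_arc_length_path (p : path) : Prop :=
  [/\ 0 <= p.1, p = mkpath p.1 p.2, lipschitz1 `[0, p.1] p.2 &
      forall s, 0 <= s <= p.1 -> arc_length p.2 s = s].

End Paths.
Arguments path : clear implicits.

(** * Weights on a finite rooted family of branches *)

Section BranchWeights.
Context {R : realType} {K : choiceType}.
Variables (f : R -> R) (a b : K -> R) (m : K -> R -> R) (O : K -> set K).

(* [W j] is only used for the successors j of k. *)
Definition end_weight (W : K -> R -> R) (k : K) : R :=
  \sum_(j \in O k) lim (W j t @[t --> (a j)^'+])
  - \sum_(j \in O k) lim (m j t @[t --> (a j)^'+]).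

Definition solves_weight_eq (k : K) (wbar : R) (w : R -> R) : Prop :=
  forall t, a k < t <= b k ->
    0 <= w t /\
    ((w t)%:E = (\int[lebesgue_measure]_(s in `[t, b k]) (f (w s))%:E)
                + (m k t)%:E + wbar%:E)%E.

(* [branch_weight k w]: backward induction produces the weight w on the
   branch k; w is meaningful on ]a k, b k] only. *)
Inductive branch_weight : K -> (R -> R) -> Prop :=
  BranchWeight (k : K) (w : R -> R) (W : K -> R -> R) of
    (forall j, O k j -> branch_weight j (W j)) &
    solves_weight_eq k (end_weight W k) w : branch_weight k w.

End BranchWeights.

(** * Irrigation plans *)

Section Irrigation.
Context {R : realType} {d : nat}.
Variables (M : R) (chi : R -> R -> 'rV[R]_d).
Implicit Types (theta t eps : R) (p q : path R d).

Local Notation leb := (@completed_lebesgue_measure R).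

Definition Theta : set R := `[0, M]%classic.

Definition meas (A : set R) : R := fine (leb A).

Definition stop_time theta : R :=
  inf [set u | 0 <= u /\ forall t, u <= t -> chi theta t = chi theta u].

Definition irrigation_plan
    (mu : {finite_measure set (borelR R d) -> \bar R}) : Prop :=
  [/\ forall t, 0 <= t ->
        measurable_fun (Theta : set (lebesgueR R))
          (fun theta : lebesgueR R => chi theta t : borelR R d),
      forall theta, Theta theta ->
        {within `[0, +oo[, continuous (chi theta)} /\ chi theta 0 = 0,
      {ae leb, forall theta, Theta theta ->
        lipschitz1 `[0, +oo[ (chi theta) /\
        exists2 u, 0 <= u & forall t, u <= t -> chi theta t = chi theta u} &
      forall V : set (borelR R d), measurable V ->
        mu V = leb [set theta | Theta theta /\ V (chi theta (stop_time theta))]].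

Definition mult theta t : R :=
  meas [set theta' | Theta theta' /\
    exists2 t', 0 < t' & equiv_path (chi theta') t' (chi theta) t].

Definition condA2 : Prop :=
  {ae leb, forall theta, Theta theta ->
     forall t, 0 <= t < stop_time theta -> 0 < mult theta t}.

(** ** Good paths and the tree of elementary branches *)

Definition good_path eps p : Prop :=
  is_arc_length_path p /\
  eps <= meas [set theta | Theta theta /\
           exists2 t, 0 < t & equiv_path (chi theta) t p.2 p.1].

Definition max_good_path eps : set (path R d) :=
  [set p | good_path eps p /\
           forall q, good_path eps q -> path_le p q -> q = p].

Definition flux p (s : R) : R :=
  meas [set theta | Theta theta /\
    exists2 t, 0 <= t & equiv_path (chi theta) t p.2 s].

Definition split_time p q : R :=
  sup [set t | 0 <= t <= Num.min p.1 q.1 /\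
               forall s, 0 <= s <= t -> p.2 s = q.2 s].

Definition split_times eps p : set R :=
  [set 0; p.1] `|` [set split_time p q | q in max_good_path eps].

(* The elementary branch obtained by restricting a maximal path p to [a, b] is
   encoded as (a, p|[0, b]); recording the history p|[0, b] identifies the
   pieces common to several maximal paths, and only those: maximal paths that
   separate and later meet again yield distinct branches. *)
Definition branch : Type := (R * path R d)%type.

Definition bstart (k : branch) : R := k.1.
Definition bend (k : branch) : R := k.2.1.
Definition bflux (k : branch) : R -> R := flux k.2.

Definition branches eps : set branch :=
  [set k | exists p, [/\ max_good_path eps p,
    split_times eps p (bstart k), split_times eps p (bend k),
    bstart k < bend k /\
      forall c, bstart k < c < bend k -> ~ split_times eps p c &
    k.2 = cut p (bend k)]].

Definition successors eps (k : branch) : set branch :=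
  [set j | [/\ branches eps j, bstart j = bend k & path_le k.2 j.2]].

(** ** Weight function and weighted cost *)

Variable f : R -> R.

(* The weight along the maximal path p.  At s = 0, where the weight equation
   says nothing, the value is 0; it does not contribute to the cost. *)
Definition path_weight eps p (s : R) : R :=
  xget 0 [set x | exists k w,
    [/\ branches eps k, path_le k.2 p, bstart k < s <= bend k,
        branch_weight f bstart bend bflux (successors eps) k w & x = w s]].

(* [tau_eps] is +oo when a mass at least eps ends at the same point along the
   same path as theta. *)
Definition tau_eps eps theta : \bar R :=
  ereal_sup [set t%:E | t in [set t | 0 <= t /\ eps <= mult theta t]].

Definition weight_eps eps theta t : R :=
  if (t%:E <= tau_eps eps theta)%E then
    xget 0 [set x | exists p s,
      [/\ max_good_path eps p, 0 <= s <= p.1,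
          equiv_path (chi theta) t p.2 s & x = path_weight eps p s]]
  else 0.

Definition weight theta t : \bar R :=
  ereal_sup [set (weight_eps eps theta t)%:E | eps in [set eps | 0 < eps]].

Definition weighted_energy (alpha : R) : \bar R :=
  (\int[leb]_(theta in Theta)
    \int[lebesgue_measure]_(t in `[0%R, stop_time theta])
      (weight theta t `^ alpha *
       ((mult theta t)^-1 * enorm ((chi theta)^`()%classic t))%:E))%E.

End Irrigation.

Definition weighted_irrigation_cost (R : realType) (d : nat) (f : R -> R)
    (alpha : R) (mu : {finite_measure set (borelR R d) -> \bar R}) : \bar R :=
  let M := fine (mu setT) in
  ereal_inf [set weighted_energy M chi f alpha |
    chi in [set chi | irrigation_plan M chi mu /\ condA2 M chi]].

(* Main.v *)
Require Import Defs.
From HB Require Import structures.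
From mathcomp Require Import all_boot all_order all_algebra.
From mathcomp Require Import all_classical all_reals all_analysis.
From mathcomp Require Import measurable_realfun.
From mathcomp Require Import ring lra.
Import Order.TTheory GRing.Theory Num.Theory.
Import numFieldNormedType.Exports.
Local Open Scope ring_scope.
Local Open Scope classical_set_scope.
Set Implicit Arguments.
Unset Strict Implicit.
Unset Printing Implicit Defensive.
Local Notation path := Defs.path.
Local Notation cut := Defs.cut.
Local Notation path_le := Defs.path_le.

(** Fix a plan. The mass that ends in a ball of radius [r] is at most of order
    [r ^ d], so that a set of fibres of positive measure contains about [r ^ - d]
    fibres whose endpoints are pairwise [4 * r] apart ([separated_endpoints]).
    Between its last exits from the balls of radius [r] and [r / 2] about its
    endpoint, such a fibre runs a length at least [r / 2] inside the larger ball
    ([exit_length], [tip_near]). Call this stretch its tip. The tips of separated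
    fibres are disjoint, and both cases of the theorem count what they cost.

    Low exponents, [alpha < 1 - 1 / d]. Since the weight is at least the
    multiplicity [m], the cost per unit length along a fibre is at least
    [m ^ (alpha - 1)], and a tip that carries the mass [m] costs at least
    [r / 2 * m ^ alpha] ([energy_ge_exits]). A fibre of bounded cost has
    [m >= const * r ^ p] at every scale, where [p = 1 / (1 - alpha) < d]: it cannot
    get thin too early ([exit_mult_ge]). Hence, at a dyadic scale where [m] does not
    drop by more than a fixed factor along the tip, the tips of a set of fibres of
    measure [g] cost at least [const * g * r ^ (p - d)]. If the cost is finite, the
    measures of the sets of fibres that have such a scale at the [j]-th step are
    summable in [j], while every fibre of bounded cost has infinitely many such
    scales, because otherwise its multiplicity would decay faster than [r ^ p]
    ([slow_scale]). Borel-Cantelli ([leb_limsup_null]) gives a contradiction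
    ([energy_low_exponent]).

    Steep flux functions, [f (y ^ n) >= c * y ^ (n - 1)] near 0 with [n = d - 1].
    The weight [w] and the flux [m] of a branch satisfy [w = m + excess], where the
    excess decreases along the branch at rate [f w]. If [z x = (kappa * x) ^ n] with
    [kappa = c / n], then [z' <= f z], so that a branch of length [x] has an excess at
    least [z x] at its root, however small its flux. To add up the contributions of
    many tips, let the potential of a path be the sum, over the tips that continue
    it, of [z] of the length of the tip still ahead. Going from the tips to the root,
    at most one term of the potential grows at a time, because the tips are disjoint,
    and it grows slower than the excess, because [f] is nondecreasing. So the
    potential is at most the excess ([potential_le_excess]). Finally, a set of fibres
    of positive measure shares an initial path of positive length ([common_trunk]).
    About [r ^ - d] tips grow out of this trunk, each contributes a multiple of
    [r ^ (d - 1)] to its weight, and [r] tends to 0: the weight is infinite on the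
    trunk ([trunk_weight_large]), hence so is the cost ([energy_steep]).

    Two points need care before these computations make sense. The tree and its
    weights have to exist: good paths extend to maximal ones ([good_extends]), there
    are finitely many branches ([finite_branches]), and the weight equation has
    solutions ([weight_eq_exists]). All bounds hold for every solution. Moreover,
    the weight and the cost of a fibre need not be measurable. Integrals of
    nonnegative functions are therefore compared through the simple functions below
    them ([ge0_le_integral_ae]), and the sets of fibres selected by their cost or
    their endpoints are measured by the Lebesgue outer measure. *)

(** * Integrals of nonnegative functions *)

Section IntegralWithoutMeasurability.
Context d (T : measurableType d) (R : realType).
Variable mu : {measure set T -> \bar R}.
Local Open Scope ereal_scope.
Import HBNNSimple.

(** The integral of a nonnegative function is the supremum of the integrals of the simple
    functions below it, measurable or not; such a simple function can be set to 0 on a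
    measurable null set without changing its integral. *)
Lemma ge0_le_integral_ae (D : set T) (F1 F2 : T -> \bar R) :
  (forall x, D x -> 0 <= F1 x) -> (forall x, D x -> 0 <= F2 x) ->
  {ae mu, forall x, D x -> F1 x <= F2 x} ->
  \int[mu]_(x in D) F1 x <= \int[mu]_(x in D) F2 x.
Proof.
move=> F10 F20 [N [mN N0 subN]].
rewrite !ge0_integralE//; apply: ge_ereal_sup => _ [h hF1 <-].
have mNc : measurable (~` N) by exact: measurableC.
pose h' := mul_nnsfun h (indic_nnsfun R mNc).
have h'E x : h' x = (h x * (x \in ~` N)%:R)%R.
  by [].
have -> : sintegral mu h = sintegral mu h'.
  rewrite -!integralT_nnsfun; apply: ge0_ae_eq_integral => //.
  - by apply/measurable_EFinP.
  - by apply/measurable_EFinP.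
  - by move=> x _; rewrite lee_fin.
  - by move=> x _; rewrite lee_fin.
  - exists N; split => // x /= hx; apply: contrapT => Nx; apply: hx => _.
    move: (h'E x); rewrite mem_set// mulr1 => h'x; exact: (congr1 EFin (esym h'x)).
apply: ereal_sup_ubound; exists h' => // x.
move: (h'E x); have [Nx|Nx] := boolP (x \in ~` N); last first.
  rewrite mulr0 => ->; rewrite patchE; case: ifPn => //; rewrite inE => Dx; exact: F20.
rewrite mulr1 => ->; rewrite (le_trans (hF1 x))// !patchE; case: ifPn => // xD.
apply: contrapT => F12; move: Nx; rewrite inE; apply; apply: subN => /= H.
by apply: F12; apply: H; rewrite inE in xD.
Qed.

Lemma ge0_eq_integral_ae (D : set T) (F1 F2 : T -> \bar R) :
  (forall x, D x -> 0 <= F1 x) -> (forall x, D x -> 0 <= F2 x) ->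
  {ae mu, forall x, D x -> F1 x = F2 x} ->
  \int[mu]_(x in D) F1 x = \int[mu]_(x in D) F2 x.
Proof.
move=> F10 F20 F12; apply/eqP; rewrite eq_le; apply/andP; split;
  apply: ge0_le_integral_ae => //; move: F12; apply: filterS => x H Dx;
  by rewrite H.
Qed.

Lemma ge0_subset_integral_ae (A B : set T) (F : T -> \bar R) : A `<=` B ->
  (forall x, B x -> 0 <= F x) ->
  \int[mu]_(x in A) F x <= \int[mu]_(x in B) F x.
Proof.
move=> AB F0; rewrite integral_mkcond [leRHS]integral_mkcond.
have G0 (C : set T) : C `<=` B -> forall x, setT x -> 0 <= (F \_ C) x.
  by move=> CB x _; rewrite patchE; case: ifPn => //; rewrite inE => /CB/F0.
apply: ge0_le_integral_ae; [exact: G0|exact: G0|apply: aeW => x _].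
rewrite !patchE; case: ifPn; first by rewrite inE => /AB xB; rewrite mem_set.
by move=> _; case: ifPn => //; rewrite inE => /F0.
Qed.

End IntegralWithoutMeasurability.

Section StieltjesLipschitz.
Context {R : realType}.
Variables (g : cumulative R R) (K : R).
Hypothesis K0 : 0 <= K.
Hypothesis gK : forall x y, x <= y -> g y - g x <= K * (y - x).
Local Notation nu := (lebesgue_stieltjes_measure g).
Local Notation leb := (@lebesgue_measure R).

Lemma stieltjes_itv (a b : R) : a <= b -> nu `]a, b]%classic = (g b - g a)%:E.
Proof.
move=> ab; rewrite /lebesgue_stieltjes_measure /measure_extension.
rewrite measurable_mu_extE/=; last exact: is_ocitv.
by rewrite wlength_itv_bnd.
Qed.

(** Intervals of small total length have a small total increment of [g]. *)
Lemma stieltjes_null (A : set R) : leb A = 0%E -> nu A = 0%E.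
Proof.
move=> A0; apply/eqP; rewrite eq_le measure_ge0 andbT.
apply/lee_addgt0Pr => e e0; rewrite add0e.
have K1 : 0 < K + 1 by rewrite ltr_wpDl.
have : (leb A < (e / (K + 1))%:E)%E by rewrite A0 lte_fin divr_gt0.
rewrite /lebesgue_measure /lebesgue_stieltjes_measure /measure_extension.
rewrite {1}/mu_ext => /ereal_inf_lt[_ [F [mF AF] <-]] sF.
apply: le_trans (ereal_inf_lbound _) _; first by exists F.
have -> : (e = (K + 1) * (e / (K + 1)))%R by rewrite mulrCA divff ?mulr1// gt_eqF.
rewrite EFinM; apply: le_trans (lee_pmul _ _ (lexx _) (ltW sF)); last first.
- by apply: nneseries_ge0 => n _ _; exact: wlength_ge0.
- by rewrite lee_fin ltW.
rewrite -nneseriesZl//.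
apply: lee_nneseries => [n _ _|n _]; first exact: wlength_ge0.
have [[x y] /= _ <-] := mF n.
have [xy|yx] := leP x y; last first.
  by rewrite set_itv_ge ?wlength0 ?mule0//= -leNgt bnd_simp ltW.
rewrite !wlength_itv_bnd//= -EFinM lee_fin (le_trans (gK xy))//.
by rewrite ler_wpM2r ?subr_ge0// lerDl.
Qed.

End StieltjesLipschitz.

(** * Lipschitz functions of one variable *)

Section LipschitzFTC.
Context {R : realType}.
Local Notation leb := (@lebesgue_measure R).

(** Adding [K * x] makes [psi] nondecreasing. The Stieltjes measure of the sum is
    absolutely continuous, and its Radon-Nikodym density minus [K] is [phi]. *)
Lemma lipschitz_ftc (psi : R -> R) (K a b : R) : 0 <= K -> a < b ->
  (forall x y, `|psi x - psi y| <= K * `|x - y|) ->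
  exists phi : R -> R, [/\ measurable_fun setT phi,
    leb.-integrable `[a, b] (EFin \o phi),
    {ae leb, forall x, a < x < b -> is_derive x 1 psi (phi x)} &
    forall s t, a <= s -> s <= t -> t <= b ->
      (\int[leb]_(x in `[s, t]) (phi x)%:E = (psi t - psi s)%:E)%E].
Proof.
move=> K0 ab psiK.
pose g0 x := psi x + K * x.
have g0nd : {homo g0 : x y / x <= y}.
  move=> x y xy; rewrite /g0; have := psiK x y.
  rewrite ler_norml => /andP[_]; rewrite distrC ger0_norm ?subr_ge0//.
  lra.
have g0K x y : x <= y -> g0 y - g0 x <= (K + K) * (y - x).
  move=> xy; have := psiK y x; rewrite ler_norml => /andP[_].
  rewrite ger0_norm ?subr_ge0// /g0; lra.
have cpsi : continuous psi.
  move=> x; apply/cvgrPdist_le => e e0.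
  have K1 : 0 < K + 1 by rewrite ltr_wpDl.
  near=> y; rewrite (le_trans (psiK _ _))//.
  have : `|x - y| <= e / (K + 1).
    by near: y; apply: (@cvgr_dist_le _ _ _ (nbhs x) _ id x _ (e / (K + 1)));
       [exact: cvg_id|exact: divr_gt0].
  rewrite ler_pdivlMr// => /(le_trans _); apply.
  by rewrite mulrC ler_wpM2l// lerDl.
have cg0 : continuous g0.
  move=> x; apply: cvgD; first exact: cpsi.
  by apply: cvgM; [exact: cvg_cst|exact: cvg_id].
have g0rc : right_continuous g0 by apply/right_continuousW.
pose gc := isCumulative.Build R _ R g0 g0nd g0rc.
pose g : cumulative R R := HB.pack g0 gc.
have gK : forall x y, x <= y -> g y - g x <= (K + K) * (y - x) by [].
have KK : 0 <= K + K by rewrite addr_ge0.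
pose I : set (measurableTypeR R) := `]a, b]%classic.
have mI : measurable I by exact: measurable_itv.
have nuI : (lebesgue_stieltjes_measure g I < +oo)%E.
  by rewrite stieltjes_itv ?ltW// ltry.
pose nu : {finite_measure set (measurableTypeR R) -> \bar R} := mfrestr mI nuI.
have numu : nu `<< leb.
  apply/null_content_dominatesP => A mA A0.
  rewrite /nu /= /mfrestr /mrestr; apply: (stieltjes_null KK gK).
  apply/eqP; rewrite eq_le measure_ge0 andbT -A0.
  by apply: le_measure; rewrite ?inE//; exact: measurableI.
have [f [f0 ffin fint nuf]] := radon_nikodym_sigma_finite numu.
pose h x := fine (f x).
have hE : EFin \o h = f by apply/funext => x /=; rewrite /h fineK.
have inth : leb.-integrable setT (EFin \o h) by rewrite hE.
have mh : measurable_fun setT h.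
  by apply/measurable_EFinP; rewrite hE; case/integrableP: fint.
have Ih s t : a <= s -> s <= t -> t <= b ->
    (\int[leb]_(x in `]s, t]) (h x)%:E = (g0 t - g0 s)%:E)%E.
  move=> as_ st tb.
  rewrite -[RHS](stieltjes_itv g st) -[LHS]/(integral leb _ (EFin \o h)) hE.
  rewrite -nuf//; rewrite /nu /= /mfrestr /mrestr; congr (lebesgue_stieltjes_measure g _).
  rewrite setIidl// /I; apply: subset_itv; rewrite bnd_simp//.
have locint : locally_integrable setT h.
  by apply: open_integrable_locally => //; exact: openT.
have intI (J : set R) : measurable J -> leb.-integrable J (EFin \o h).
  by move=> mJ; apply: (integrableS measurableT).
have := @FTC1 R h (BRight a) (fun y => intI _ (measurable_itv _)) locint.
set F := (fun x : R => _) => /= Fae.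
have FE y : a <= y -> y <= b -> F y = g0 y - g0 a.
  by move=> ay yb; rewrite /F /Rintegral Ih.
have dK (x : R) : is_derive x 1 (fun y => K * y) K.
  by apply: is_derive_eq; rewrite /GRing.scale/= !mulr1.
exists (fun x => h x - K); split.
- by apply: measurable_funB => //; exact: measurable_cst.
- rewrite (_ : EFin \o _ = (EFin \o h) \- (cst K%:E))%E//.
  apply: integrableB => //=; first exact: intI.
  apply/integrableP; split; first exact: measurable_cst.
  rewrite integral_cst//= lebesgue_measure_itv /= lte_fin ab.
  by rewrite -EFinD -EFinM ltry.
- move: Fae; apply: (@filterS _ _ (ae_filter_ringOfSetsType leb)) => x Hx /andP[ax xb].
  have [] := Hx; first by rewrite ?ax.
  move=> dF F'.
  have dg : is_derive x 1 g0 (h x).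
    have : is_derive x 1 F (h x) by apply: DeriveDef; [exact: dF|rewrite -derive1E].
    have dc : is_derive x 1 (cst (g0 a)) 0 by exact: is_derive_cst.
    move=> dF1; have dFc : is_derive x 1 (F \+ cst (g0 a)) (h x).
      by rewrite -[h x]addr0; exact: is_deriveD.
    have nE : {near x, F \+ cst (g0 a) =1 g0}.
      near=> y; rewrite /= FE; first by rewrite subrK.
      + by apply: ltW; near: y; exact: lt_nbhsr.
      + by apply: ltW; near: y; exact: lt_nbhsl.
    exact: near_eq_is_derive nE dFc.
  have := is_deriveB dg (dK x).
  by rewrite (_ : g0 - _ = psi)//; apply/funext => y; rewrite /g0 !fctE addrK.
- move=> s t as_ st tb.
  rewrite -integral_itv_obnd_cbnd; last first.
    apply/measurable_EFinP/measurable_funB; last exact: measurable_cst.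
    exact: measurable_funTS.
  under eq_integral do rewrite EFinB.
  rewrite integralB//=; last 2 first.
  + exact: intI.
  + apply/integrableP; split; first exact: measurable_cst.
    rewrite integral_cst//= lebesgue_measure_itv /= lte_fin.
    by case: ifP => _; rewrite -?EFinD -?EFinM ?mule0 ltry.
  rewrite Ih// integral_cst//= lebesgue_measure_itv /= lte_fin.
  move: st; rewrite le_eqVlt => /orP[/eqP <-|st].
    by rewrite ltxx mule0 !subrr sube0.
  by rewrite st -!(EFinD, EFinN, EFinM); congr EFin; rewrite /g0; lra.
Unshelve. all: by end_near.
Qed.

End LipschitzFTC.

(** * The Euclidean norm *)

Section EuclideanNorm.
Context {R : realType} {d : nat}.
Implicit Types x y z : 'rV[R]_d.

Definition dot x y : R := \sum_i x ord0 i * y ord0 i.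

Lemma enorm_ge0 x : 0 <= enorm x. Proof. exact: sqrtr_ge0. Qed.

Lemma sumsq_ge0 x : 0 <= \sum_i x ord0 i ^+ 2.
Proof. by apply: sumr_ge0 => i _; exact: sqr_ge0. Qed.

Lemma enorm_sqr x : enorm x ^+ 2 = dot x x.
Proof. by rewrite sqr_sqrtr ?sumsq_ge0//; apply: eq_bigr => i _; rewrite expr2. Qed.

Lemma enorm0 : enorm (0 : 'rV[R]_d) = 0.
Proof. by rewrite /enorm big1 ?sqrtr0// => i _; rewrite mxE expr0n. Qed.

Lemma enormN x : enorm (- x) = enorm x.
Proof. by rewrite /enorm; congr Num.sqrt; apply: eq_bigr => i _; rewrite mxE sqrrN. Qed.

Lemma enormC x y : enorm (x - y) = enorm (y - x).
Proof. by rewrite -enormN opprB. Qed.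

Lemma enormZ (a : R) x : enorm (a *: x) = `|a| * enorm x.
Proof.
rewrite /enorm -[`|a|]sqrtr_sqr -sqrtrM ?sqr_ge0//.
congr Num.sqrt.
by rewrite mulr_sumr; apply: eq_bigr => i _; rewrite mxE exprMn.
Qed.

Lemma coord_le_enorm x i : `|x ord0 i| <= enorm x.
Proof.
rewrite -sqrtr_sqr ler_sqrt ?sumsq_ge0// (bigD1 i)//= lerDl.
by apply: sumr_ge0 => j _; exact: sqr_ge0.
Qed.

Lemma enorm_eq0 x : (enorm x == 0) = (x == 0).
Proof.
apply/eqP/eqP => [x0|->]; last exact: enorm0.
apply/rowP => i; rewrite mxE; apply/eqP; rewrite -normr_le0.
by rewrite -x0 coord_le_enorm.
Qed.

Lemma dot_le x y : dot x y <= enorm x * enorm y.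
Proof.
set a := enorm x; set b := enorm y.
have [a0|a0] := eqVneq a 0.
  have -> : x = 0 by apply/eqP; rewrite -enorm_eq0 -/a a0.
  by rewrite /dot big1 ?mulr_ge0 ?enorm_ge0// => i _; rewrite mxE mul0r.
have [b0|b0] := eqVneq b 0.
  have -> : y = 0 by apply/eqP; rewrite -enorm_eq0 -/b b0.
  by rewrite /dot big1 ?mulr_ge0 ?enorm_ge0// => i _; rewrite mxE mulr0.
have a1 : 0 < a by rewrite lt_neqAle eq_sym a0 enorm_ge0.
have b1 : 0 < b by rewrite lt_neqAle eq_sym b0 enorm_ge0.
have : 0 <= \sum_i (x ord0 i * b - y ord0 i * a) ^+ 2.
  by apply: sumr_ge0 => i _; exact: sqr_ge0.
have -> : \sum_i (x ord0 i * b - y ord0 i * a) ^+ 2 =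
    b ^+ 2 * dot x x + a ^+ 2 * dot y y - 2 * a * b * dot x y.
  rewrite /dot !mulr_sumr -big_split/= -sumrB; apply: eq_bigr => i _; ring.
rewrite -!enorm_sqr -/a -/b => H.
have ab : 0 < a * b by rewrite mulr_gt0.
rewrite -(ler_pM2l ab); nra.
Qed.

Lemma enormD x y : enorm (x + y) <= enorm x + enorm y.
Proof.
rewrite -(@ler_pXn2r _ 2) ?nnegrE ?addr_ge0 ?enorm_ge0//.
rewrite sqrrD !enorm_sqr.
have -> : dot (x + y) (x + y) = dot x x + dot x y *+ 2 + dot y y.
  rewrite /dot -sumrMnl -!big_split/=; apply: eq_bigr => i _; rewrite !mxE; ring.
by rewrite lerD2r lerD2l lerMn2r dot_le orbT.
Qed.

Lemma enorm_distD x y z : enorm (x - z) <= enorm (x - y) + enorm (y - z).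
Proof. by rewrite -[x in leLHS](subrK y) -addrA enormD. Qed.

Lemma enorm_continuous : continuous (@enorm R d).
Proof.
have cs : continuous (fun x : 'rV[R]_d => \sum_i x ord0 i ^+ 2).
  apply: (@continuous_big _ _ +%R 0 xpredT); first exact: add_continuous.
  move=> i _ x; apply: (@continuous_comp _ _ _ (fun v : 'rV[R]_d => v ord0 i)
    (fun u : R => u ^+ 2)); [exact: coord_continuous|exact: exprn_continuous].
by move=> x; apply: continuous_comp; [exact: cs|exact: sqrt_continuous].
Qed.

End EuclideanNorm.

(** * The speed of a Lipschitz curve *)

Section DerivativeBound.
Context {R : realType}.

Lemma derivable_right_quotient (V : normedModType R) (g : R -> V) x : derivable g x 1 ->
  h^-1 *: (g (h + x) - g x) @[h --> 0^'+] --> g^`()%classic x.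
Proof.
move=> dg; apply: cvg_dnbhs_at_right.
move: dg; rewrite /derivable.
suff -> : (fun h : R => h^-1 *: ((g \o shift x) (h *: 1) - g x)) =
    (fun h : R => h^-1 *: (g (h + x) - g x)) by [].
by apply/funext => h; rewrite /= [h *: 1]mulr1.
Qed.

(** Stated with right increments only: [psi] bounds the displacement over [[x, x + h]]
    for small positive [h]. *)
Lemma enorm_derive_le d (g : R -> 'rV[R]_d) (psi : R -> R) x :
  derivable g x 1 -> derivable psi x 1 ->
  (\forall h \near 0^'+, enorm (g (h + x) - g x) <= psi (h + x) - psi x) ->
  enorm (g^`()%classic x) <= psi^`()%classic x.
Proof.
move=> /derivable_right_quotient dg /derivable_right_quotient dpsi gpsi.
apply: (ler_cvg_to _ dpsi).
  apply: (@cvg_comp _ _ _ _ (@enorm R d) _ _ _ dg).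
  exact: enorm_continuous.
near=> h; have h0 : 0 < h by near: h; exact: nbhs_right_gt.
have hi : 0 < h^-1 by rewrite invr_gt0.
rewrite /= enormZ (ger0_norm (ltW hi)).
rewrite -[leRHS]/(h^-1 * (psi (h + x) - psi x)) ler_pM2l//; near: h; exact: gpsi.
Unshelve. all: by end_near. Qed.

Definition clamp (T x : R) : R := Num.max 0 (Num.min x T).

Lemma clamp_itv (T x : R) : 0 <= T -> 0 <= clamp T x <= T.
Proof. by move=> T0; rewrite /clamp le_max lexx/= ge_max T0/= ge_min lexx orbT. Qed.

Lemma clampE (T x : R) : 0 <= x <= T -> clamp T x = x.
Proof. by move=> /andP[x0 xT]; rewrite /clamp (min_idPl xT) (max_idPr x0). Qed.

Lemma clamp_lip (T x y : R) : `|clamp T x - clamp T y| <= `|x - y|.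
Proof.
have mx (a b : R) : `|Num.max 0 a - Num.max 0 b| <= `|a - b|.
  have := ler_norm (a - b); have := ler_norm (b - a); rewrite distrC => ? ?.
  by rewrite ler_norml; apply/andP; case: (leP 0 a) => ?; case: (leP 0 b) => ?; split; lra.
have mn (a b : R) : `|Num.min a T - Num.min b T| <= `|a - b|.
  have := ler_norm (a - b); have := ler_norm (b - a); rewrite distrC => ? ?.
  by rewrite ler_norml; apply/andP; case: (leP a T) => ?; case: (leP b T) => ?; split; lra.
exact: le_trans (mx _ _) (mn _ _).
Qed.

End DerivativeBound.

Section Speed.
Context {R : realType} {d : nat}.
Local Notation leb := (@lebesgue_measure R).
Implicit Types (g : R -> 'rV[R]_d) (T : R).

Lemma measurable_enorm_fun (G : R -> 'rV[R]_d) :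
  (forall i, measurable_fun setT (fun x => G x ord0 i)) ->
  measurable_fun setT (fun x => enorm (G x)).
Proof.
move=> mG; apply: (@measurableT_comp _ _ _ _ _ _ (@Num.sqrt R) _
   (fun x => \sum_i G x ord0 i ^+ 2)).
  by apply: continuous_measurable_fun; exact: sqrt_continuous.
apply: measurable_sum => i; exact: measurable_funX.
Qed.

(** A measurable function, defined everywhere, that is the speed of [g] almost everywhere
    on [[0, T]]. *)
Record is_speed (g : R -> 'rV[R]_d) (T : R) (v : R -> R) : Prop := IsSpeed {
  speed_meas : measurable_fun setT v;
  speed_ge0 : forall x, 0 <= v x;
  speed_ae : {ae leb, forall x, 0 < x < T ->
     derivable g x 1 /\ enorm (g^`()%classic x) = v x};
  speed_le1 : {ae leb, forall x, 0 < x < T -> v x <= 1};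
  speed_dist : forall s t, 0 <= s -> s <= t -> t <= T ->
     ((enorm (g t - g s))%:E <= \int[leb]_(x in `[s, t]) (v x)%:E)%E }.

(** The displacement bound holds since the derivative of the scalar product of [g] with the
    displacement [g t - g s] is at most the speed times the length of this displacement. *)
Lemma exists_speed g T : 0 < T -> lipschitz1 `[0, T] g -> exists v, is_speed g T v.
Proof.
move=> T0 gL; pose G x := g (clamp T x).
have GL x y : enorm (G x - G y) <= `|x - y|.
  rewrite /G (le_trans (gL _ _ _ _) (clamp_lip T x y))//= in_itv/=;
  exact: clamp_itv (ltW T0).
pose psi (i : 'I_d) x := G x ord0 i.
have psiL i x y : `|psi i x - psi i y| <= 1 * `|x - y|.
  rewrite mul1r (le_trans _ (GL x y))//.
  by have := coord_le_enorm (G x - G y) i; rewrite !mxE.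
have /choice[phi phiP] := fun i => lipschitz_ftc ler01 T0 (psiL i).
pose F x : 'rV[R]_d := \row_i phi i x.
pose v x := enorm (F x).
have mv : measurable_fun setT v.
  apply: measurable_enorm_fun => i.
  by have [mphi _ _ _] := phiP i; apply: eq_measurable_fun mphi => x _; rewrite mxE.
have near_gG x : 0 < x < T -> {near x, g =1 G}.
  move=> /andP[x0 xT]; near=> y; rewrite /G clampE//; apply/andP; split.
    by apply: ltW; near: y; exact: lt_nbhsr.
  by apply: ltW; near: y; exact: lt_nbhsl.
have vae : {ae leb, forall x, 0 < x < T ->
     derivable g x 1 /\ g^`()%classic x = F x}.
  have : {ae leb, forall x, forall i, 0 < x < T -> is_derive x 1 (psi i) (phi i x)}.
    apply: filter_forall => i.
    by case: (phiP i).
  apply: (@filterS _ _ (ae_filter_ringOfSetsType leb)) => x Hx x0T.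
  have dG : derivable G x 1.
    apply/derivable_mxP => i j; rewrite (ord1 i).
    by have [] := Hx j x0T.
  have dg : derivable g x 1.
    apply: near_eq_derivable dG; near do apply/esym; exact: near_gG.
  split => //; rewrite derive1E (near_eq_derive _ (near_gG x x0T)).
  rewrite (derive_mx dG); apply/matrixP => i j; rewrite !mxE (ord1 i).
  by have [_ <-] := Hx j x0T.
have vle1 : {ae leb, forall x, 0 < x < T -> v x <= 1}.
  move: vae; apply: (@filterS _ _ (ae_filter_ringOfSetsType leb)) => x Hx x0T.
  have [dg gF] := Hx x0T; rewrite /v -gF.
  have := @enorm_derive_le R d g id x dg (@derivable_id _ _ _ _).
  rewrite derive1_id; apply.
  move: (x0T) => /andP[x0 xT].
  near=> h; have h0 : 0 < h by near: h; exact: nbhs_right_gt.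
  rewrite addrK -[leRHS]gtr0_norm// -[X in `|X|](addrK x).
  have hx : h <= T - x by near: h; apply: nbhs_right_ltW; rewrite subr_gt0.
  by apply: gL; rewrite /= in_itv/=; apply/andP; split; lra.
have intv : (\int[leb]_(x in `[0%R, T]) (v x)%:E <= T%:E)%E.
  have -> : T%:E = (\int[leb]_(x in `]0%R, T[) 1%E)%E.
    by rewrite integral_cst//= lebesgue_measure_itv/= lte_fin T0 mul1e -EFinB subr0.
  rewrite integral_itv_bndoo//=; last first.
    by apply: measurable_funTS; exact/measurable_EFinP.
  apply: ge0_le_integral_ae.
  - by move=> x _; rewrite lee_fin enorm_ge0.
  - by move=> x _; rewrite lee_fin.
  - move: vle1; apply: (@filterS _ _ (ae_filter_ringOfSetsType leb)) => x Hx /=.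
    by rewrite in_itv/= lee_fin.
have intv' s t : 0 <= s -> t <= T -> leb.-integrable `[s, t] (EFin \o v).
  move=> s0 tT; apply: (@integrableS _ (measurableTypeR R) R leb `[0, T]%classic) => //.
    by apply: subset_itv; rewrite bnd_simp.
  apply/integrableP; split; first by apply: measurable_funTS; exact/measurable_EFinP.
  under eq_integral do rewrite /= ger0_norm ?enorm_ge0//.
  by rewrite (le_lt_trans intv)// ltry.
exists v; split => //.
- by move=> x; exact: enorm_ge0.
- move: vae; apply: (@filterS _ _ (ae_filter_ringOfSetsType leb)) => x Hx x0T.
  by have [? ->] := Hx x0T.
- move=> s t s0 st tT; set w := g t - g s.
  have [w0|w0] := eqVneq (enorm w) 0.
    by rewrite w0; apply: integral_ge0 => x _; rewrite lee_fin enorm_ge0.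
  have w1 : 0 < enorm w by rewrite lt_neqAle eq_sym w0 enorm_ge0.
  have int_phi i : leb.-integrable `[s, t] (EFin \o phi i).
    have [_ iphi _ _] := phiP i; apply: (@integrableS _ (measurableTypeR R) R leb `[0, T]%classic) => //.
    by apply: subset_itv; rewrite bnd_simp.
  have iZ i : leb.-integrable `[s, t] (fun x => (w ord0 i)%:E * (phi i x)%:E)%E.
    by apply: (@integrableZl _ (measurableTypeR R) R leb) => //; exact: int_phi.
  have e1 : (enorm w ^+ 2)%:E =
      (\int[leb]_(x in `[s, t]) (\sum_i (w ord0 i)%:E * (phi i x)%:E))%E.
    rewrite (integral_sum _ iZ)//=.
    rewrite enorm_sqr /dot -sumEFin; apply: eq_bigr => i _.
    rewrite integralZl//=; last exact: int_phi.
    have [_ _ _ ->//] := phiP i; rewrite -EFinM; congr ((_ * _)%:E).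

    by rewrite /psi /G !clampE ?mxE// ?(le_trans s0 st) ?(le_trans st tT)//= s0.
  have e2 : ((enorm w ^+ 2)%:E <= (enorm w)%:E * \int[leb]_(x in `[s, t]) (v x)%:E)%E.
    rewrite e1 -integralZl//; last exact: intv'.
    apply: le_integral => //.
    + exact: integrable_sum.
    + by apply: (@integrableZl _ (measurableTypeR R) R leb) => //; exact: intv'.
    + move=> x _; rewrite sumEFin -EFinM lee_fin (le_trans _ (dot_le w (F x)))//.
      by rewrite /dot; apply: ler_sum => i _; rewrite [F x _ _]mxE.
  move: e2; rewrite expr2 EFinM lee_pmul2l//; by rewrite ?lte_fin.
Unshelve. all: by end_near. Qed.

End Speed.

(** * Arc length as the integral of the speed *)

Section ArcLength.
Context {R : realType} {d : nat}.
Local Notation leb := (@lebesgue_measure R).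
Implicit Types (g : R -> 'rV[R]_d) (T : R).

Lemma ae_neq (a : R) : {ae leb, forall x, x <> a}.
Proof.
exists [set a]; split; [exact: measurable_set1|exact: lebesgue_measure_set1|].
by move=> x /= /contrapT ->.
Qed.

Section OneSpeed.
Variables (g : R -> 'rV[R]_d) (T : R) (v : R -> R).
Hypothesis gv : is_speed g T v.

Lemma integral_speed_le s t : 0 <= s -> s <= t -> t <= T ->
  (\int[leb]_(x in `[s, t]) (v x)%:E <= (t - s)%:E)%E.
Proof.
move=> s0 st tT.
have -> : (t - s)%:E = (\int[leb]_(x in `[s, t]) 1%E)%E.
  rewrite integral_cst//= lebesgue_measure_itv/= lte_fin mul1e.
  move: st; rewrite le_eqVlt => /orP[/eqP ->|->]; last by rewrite -EFinB.
  by rewrite ltxx subrr.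
apply: ge0_le_integral_ae => [x _|x _|]; [|by rewrite lee_fin|].
  by rewrite lee_fin (speed_ge0 gv).
have := speed_le1 gv; have := @ae_neq 0; have := @ae_neq T.
apply: (@filterS3 _ _ (ae_filter_ringOfSetsType leb)) => x xT x0 Hx /=.
rewrite in_itv/= => /andP[sx xt]; rewrite lee_fin; apply: Hx.
rewrite !lt_neqAle (le_trans s0 sx) (le_trans xt tT) !andbT.
by apply/andP; split; apply/eqP => // /esym.
Qed.

Lemma arc_length_integral t : 0 <= t -> t <= T ->
  (arc_length g t)%:E = (\int[leb]_(x in `[0%R, t]) (v x)%:E)%E.
Proof.
move=> t0 tT; rewrite /arc_length /Rintegral.
have -> : (\int[leb]_(x in `[0%R, t]) (enorm (g^`()%classic x))%:E =
    \int[leb]_(x in `[0%R, t]) (v x)%:E)%E.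
  apply: ge0_eq_integral_ae => [x _|x _|].
  - by rewrite lee_fin enorm_ge0.
  - by rewrite lee_fin (speed_ge0 gv).
  have := speed_ae gv; have := @ae_neq 0; have := @ae_neq T.
  apply: (@filterS3 _ _ (ae_filter_ringOfSetsType leb)) => x xT x0 Hx /=.
  rewrite in_itv/= => /andP[sx xt]; congr EFin.
  apply: (Hx _).2; rewrite !lt_neqAle sx (le_trans xt tT) !andbT.
  by apply/andP; split; apply/eqP => // /esym.
rewrite fineK// ge0_fin_numE; last first.
  by apply: integral_ge0 => x _; rewrite lee_fin (speed_ge0 gv).
by rewrite (le_lt_trans (integral_speed_le _ _ _))// ltry.
Qed.

Lemma arc_length_incr s t : 0 <= s -> s <= t -> t <= T ->
  (arc_length g t - arc_length g s)%:E = (\int[leb]_(x in `[s, t]) (v x)%:E)%E.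
Proof.
move=> s0 st tT; have t0 := le_trans s0 st.
have mv D : measurable_fun D (EFin \o v).
  by apply: measurable_funTS; apply/measurable_EFinP; exact: (speed_meas gv).
rewrite EFinB !arc_length_integral ?(le_trans st)//.
have -> : (`[0, t] = `[0, s] `|` `]s, t] :> set R)%classic.
  by rewrite (@itv_bndbnd_setU _ _ _ (BRight s))// bnd_simp.
rewrite ge0_integral_setU//=; first last.
- apply: lt_disjoint => x y; rewrite /= !in_itv/= => /andP[_ xs] /andP[sy _].
  exact: le_lt_trans sy.
- by move=> x _; rewrite lee_fin (speed_ge0 gv).
- exact: mv.
rewrite integral_itv_obnd_cbnd; last exact: mv.
rewrite addeAC -arc_length_integral// ?(le_trans st)// subee ?add0e//.
Qed.

End OneSpeed.

Lemma arc_length0 g : arc_length g 0 = 0.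
Proof.
rewrite /arc_length /Rintegral set_itv1.
by rewrite integral_set1.
Qed.

Lemma arc_length_bounds g T s t : lipschitz1 `[0, T] g ->
  0 <= s -> s <= t -> t <= T ->
  enorm (g t - g s) <= arc_length g t - arc_length g s <= t - s.
Proof.
move=> gL s0 st tT.
have := le_trans s0 (le_trans st tT); rewrite le_eqVlt => /orP[/eqP T0|T0].
  have -> : s = t by apply/eqP; rewrite eq_le st (le_trans tT)// -T0.
  by rewrite !subrr enorm0 lexx.
have [v vP] := exists_speed T0 gL.
by rewrite -!lee_fin (arc_length_incr vP)// (integral_speed_le vP)// (speed_dist vP).
Qed.

(** The derivative of [psi] dominates the speed of [g] almost everywhere. This minimality
    identifies the arc length without computing derivatives. *)
Lemma arc_length_minimal g T (psi : R -> R) : lipschitz1 `[0, T] g ->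
  (forall s t, 0 <= s -> s <= t -> t <= T ->
     enorm (g t - g s) <= psi t - psi s <= t - s) ->
  forall s t, 0 <= s -> s <= t -> t <= T ->
  arc_length g t - arc_length g s <= psi t - psi s.
Proof.
move=> gL gpsi s t s0 st tT.
have := le_trans s0 (le_trans st tT); rewrite le_eqVlt => /orP[/eqP T0|T0].
  have -> : s = t by apply/eqP; rewrite eq_le st (le_trans tT)// -T0.
  by rewrite !subrr.
have [v vP] := exists_speed T0 gL.
pose Psi x := psi (clamp T x).
have PsiE x : 0 <= x -> x <= T -> Psi x = psi x.
  by move=> x0 xT; rewrite /Psi clampE ?x0.
have PsiL x y : `|Psi x - Psi y| <= 1 * `|x - y|.
  rewrite mul1r (le_trans _ (clamp_lip T x y))// /Psi.
  have /andP[] := clamp_itv x (ltW T0); have /andP[] := clamp_itv y (ltW T0).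
  set a := clamp T x; set b := clamp T y => b0 bT a0 aT.
  have [ab|ba] := leP a b.
    have /andP[h1 h2] := gpsi _ _ a0 ab bT.
    rewrite distrC [leRHS]distrC !ger0_norm ?subr_ge0//.
    by rewrite -subr_ge0 (le_trans _ h1)// enorm_ge0.
  have /andP[h1 h2] := gpsi _ _ b0 (ltW ba) aT.
  rewrite !ger0_norm ?subr_ge0// ?(ltW ba)//.
  by rewrite -subr_ge0 (le_trans _ h1)// enorm_ge0.
have [phi [mphi iphi dphi intphi]] := lipschitz_ftc ler01 T0 PsiL.
have vphi : {ae leb, forall x, s <= x <= t -> v x <= phi x}.
  have H : {ae leb, forall x, 0 < x < T -> v x <= phi x}.
    move: dphi; have := speed_ae vP.
    apply: (@filterS2 _ _ (ae_filter_ringOfSetsType leb)) => x H1 H2 x0T.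
    have [dg <-] := H1 x0T; have [dPsi Psi'] := H2 x0T.
    rewrite -Psi' -derive1E; apply: enorm_derive_le => //.
    move: (x0T) => /andP[x0 xT].
    near=> h; have h0 : 0 < h by near: h; exact: nbhs_right_gt.
    have hx : h <= T - x by near: h; apply: nbhs_right_ltW; rewrite subr_gt0.
    have hxT : h + x <= T by lra.
    have xhx : x <= h + x by lra.
    have /andP[+ _] := gpsi x (h + x) (ltW x0) xhx hxT.
    by rewrite !PsiE//; lra.
  have := H; have := @ae_neq 0; have := @ae_neq T.
  apply: (@filterS3 _ _ (ae_filter_ringOfSetsType leb)) => x xT x0 Hx.
  move=> /andP[sx xt]; apply: Hx; rewrite !lt_neqAle (le_trans xt tT) (le_trans s0 sx) !andbT.
  by apply/andP; split; apply/eqP => // /esym.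
rewrite -lee_fin (arc_length_incr vP)// -!PsiE ?(le_trans st)// ?(le_trans s0)//.
rewrite -intphi//.
have -> : (\int[leb]_(x in `[s, t]) (phi x)%:E =
    \int[leb]_(x in `[s, t]) (Num.max (phi x) 0)%:E)%E.
  apply: ae_eq_integral => //.
  - by apply: measurable_funTS; exact/measurable_EFinP.
  - by apply: measurable_funTS; apply/measurable_EFinP/measurable_maxr.
  - move: vphi; apply: (@filterS _ _ (ae_filter_ringOfSetsType leb)) => x Hx /=.
    rewrite in_itv/= => /Hx vx; rewrite max_l// (le_trans _ vx)//.
    exact: (speed_ge0 vP).
apply: ge0_le_integral_ae.
- by move=> x _; rewrite lee_fin (speed_ge0 vP).
- by move=> x _; rewrite lee_fin le_max lexx orbT.
- move: vphi; apply: (@filterS _ _ (ae_filter_ringOfSetsType leb)) => x Hx /=.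
  by rewrite in_itv/= => /Hx vx; rewrite lee_fin le_max vx.
Unshelve. all: by end_near. Qed.

End ArcLength.

(** * Paths and their arc-length parametrization *)

Section PathAlgebra.
Context {R : realType} {d : nat}.
Implicit Types (g h : R -> 'rV[R]_d) (s t u : R) (p q r : Defs.path R d).

Lemma mkpath_eq l g h : (forall s, 0 <= s <= l -> g s = h s) ->
  mkpath l g = mkpath l h.
Proof.
move=> gh; rewrite /mkpath; congr pair; apply/funext => s.
rewrite /patch; case: ifPn => // /set_mem /=; rewrite in_itv/=; exact: gh.
Qed.

Lemma mkpath2 l g s : 0 <= s <= l -> (mkpath l g).2 s = g s.
Proof. by move=> sl; rewrite /mkpath /= /patch mem_set//= in_itv. Qed.

Lemma cut2 p s t : 0 <= t <= s -> (cut p s).2 t = p.2 t.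
Proof. exact: mkpath2. Qed.

Lemma cut_cut p s t : t <= s -> cut (cut p s) t = cut p t.
Proof.
move=> ts; apply: mkpath_eq => u /andP[u0 ut].
by rewrite cut2// u0 (le_trans ut).
Qed.

Lemma path_le2 p q s : path_le p q -> 0 <= s <= p.1 -> p.2 s = q.2 s.
Proof. by move=> [pq ->] sp; rewrite cut2. Qed.

Lemma path_leT p q r : path_le p q -> path_le q r -> path_le p r.
Proof.
move=> [pq p_] [qr q_]; split; first exact: le_trans qr.
by rewrite {1}p_ q_ cut_cut.
Qed.

Lemma path_le_cutE p q s : s <= p.1 -> path_le p q -> cut p s = cut q s.
Proof. by move=> sp [_ ->]; rewrite cut_cut. Qed.

(** Two prefixes of the same path are comparable. *)
Lemma path_le_common p q r : path_le p r -> path_le q r -> p.1 <= q.1 ->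
  path_le p q.
Proof. by move=> [pr p_] qr pq; split => //; rewrite (path_le_cutE pq qr). Qed.

Lemma cut_eqP p q s : (cut p s = cut q s) <->
  (forall t, 0 <= t <= s -> p.2 t = q.2 t).
Proof.
split=> [pq t ts|]; last exact: mkpath_eq.
by rewrite -(cut2 p ts) pq cut2.
Qed.

Lemma wf_cut p : is_arc_length_path p -> cut p p.1 = p.
Proof. by move=> [_ p_ _ _]; exact: esym p_. Qed.

Lemma path_le_refl p : is_arc_length_path p -> path_le p p.
Proof. by move=> /wf_cut p_; split; rewrite ?p_. Qed.

Lemma path_le_length_eq p q : is_arc_length_path q -> path_le p q ->
  p.1 = q.1 -> p = q.
Proof. by move=> /wf_cut q_ [_ p_] pq; rewrite p_ pq. Qed.

Lemma path_le_anti p q : is_arc_length_path q -> path_le p q -> path_le q p -> p = q.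
Proof.
move=> qa pq qp; apply: path_le_length_eq => //; apply/eqP.
by rewrite eq_le pq.1 qp.1.
Qed.

End PathAlgebra.

Section ArcPath.
Context {R : realType} {d : nat}.
Local Notation path := (Defs.path R d).

Lemma arc_lengthE (p : path) s : is_arc_length_path p -> 0 <= s <= p.1 ->
  arc_length p.2 s = s.
Proof. by move=> [_ _ _]; exact. Qed.

(** The first time at which the arc length reaches [s]. *)
Definition crossing (g : R -> 'rV[R]_d) (s : R) : R :=
  inf [set u | 0 <= u /\ s <= arc_length g u].

Lemma arc_pathE (g : R -> 'rV[R]_d) t :
  arc_path g t = mkpath (arc_length g t) (g \o crossing g).
Proof. by []. Qed.

Section LipschitzCurve.
Variable g : R -> 'rV[R]_d.
Hypothesis gL : lipschitz1 `[0, +oo[ g.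
Local Notation L := (arc_length g).

Lemma lipschitz_restrict T : lipschitz1 `[0, T] g.
Proof.
by move=> s t; rewrite /= !in_itv/= => /andP[s0 _] /andP[t0 _]; apply: gL;
  rewrite /= in_itv/= ?s0 ?t0.
Qed.

Lemma arc_length_dist s t : 0 <= s -> s <= t -> enorm (g t - g s) <= L t - L s.
Proof.
move=> s0 st.
by have /andP[] := arc_length_bounds (@lipschitz_restrict t) s0 st (lexx t).
Qed.

Lemma arc_length_lip s t : 0 <= s -> s <= t -> L t - L s <= t - s.
Proof.
move=> s0 st.
by have /andP[] := arc_length_bounds (@lipschitz_restrict t) s0 st (lexx t).
Qed.

Lemma arc_length_homo s t : 0 <= s -> s <= t -> L s <= L t.
Proof.
by move=> s0 st; rewrite -subr_ge0 (le_trans _ (arc_length_dist s0 st))// enorm_ge0.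
Qed.

Lemma arc_length_ge0 t : 0 <= t -> 0 <= L t.
Proof. by move=> t0; rewrite -(arc_length0 g) arc_length_homo. Qed.

Lemma arc_length_eq_dist s t : 0 <= s -> 0 <= t -> L s = L t -> g s = g t.
Proof.
wlog st : s t / s <= t.
  by move=> H s0 t0 Lst; have [|/ltW] := leP s t => ?; [|symmetry]; apply: H.
move=> s0 t0 Lst; have := arc_length_dist s0 st.
rewrite Lst subrr => gst; apply/esym/eqP; rewrite -subr_eq0 -enorm_eq0.
by rewrite eq_le gst enorm_ge0.
Qed.

Lemma crossing_spec s t : 0 <= s -> 0 <= t -> s <= L t ->
  [/\ 0 <= crossing g s, crossing g s <= t & L (crossing g s) = s].
Proof.
move=> s0 t0 st; rewrite /crossing; set S := [set _ | _].
have St : S t by [].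
have Sinf : has_inf S by split; [exists t|exists 0 => u []].
have lb : lbound S (inf S) by exact: inf_lbound Sinf.2.
have i0 : 0 <= inf S by apply: lb_le_inf => [|u []//]; exists t.
have it : inf S <= t by exact: lb.
split => //; apply/eqP; rewrite eq_le; apply/andP; split; last first.
  apply/ler_addgt0Pr => e e0.
  have [u [u0 su] ui] := inf_adherent e0 Sinf.
  have := arc_length_lip i0 (lb _ (conj u0 su)); lra.
rewrite leNgt; apply/negP => sL.
have [i1|i1] := leP (inf S) 0.
  by move: sL; rewrite (_ : inf S = 0) ?arc_length0 ?ltNge ?s0//; apply/eqP; rewrite eq_le i1.
pose u := Num.max 0 (inf S - (L (inf S) - s)).
have ui : u < inf S by rewrite /u gt_max i1/=; lra.
have u0 : 0 <= u by rewrite /u le_max lexx.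
have : S u.
  split => //; have := arc_length_lip u0 (ltW ui).
  have : inf S - (L (inf S) - s) <= u by rewrite /u le_max lexx orbT.
  lra.
by move=> /lb; rewrite leNgt ui.
Qed.

Lemma arc_path2 t s : 0 <= s <= L t -> (arc_path g t).2 s = g (crossing g s).
Proof. by move=> sL; rewrite arc_pathE mkpath2. Qed.

Lemma arc_path_at u t : 0 <= u -> u <= t -> (arc_path g t).2 (L u) = g u.
Proof.
move=> u0 ut; have t0 := le_trans u0 ut.
rewrite arc_path2; last by rewrite arc_length_ge0// arc_length_homo.
have [c0 cu cL] := crossing_spec (arc_length_ge0 u0) u0 (lexx _).
exact: arc_length_eq_dist.
Qed.

Lemma arc_path_cut t s : 0 <= t -> s <= L t ->
  cut (arc_path g t) s = mkpath s (g \o crossing g).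
Proof.
move=> t0 st; apply: mkpath_eq => u /andP[u0 us].
by rewrite arc_path2// u0 (le_trans us).
Qed.

Lemma arc_path_prefix u t : 0 <= u -> u <= t ->
  arc_path g u = cut (arc_path g t) (L u).
Proof.
move=> u0 ut; rewrite arc_path_cut//; first exact: le_trans ut.
exact: arc_length_homo.
Qed.

Lemma arc_path_path_le u t : 0 <= u -> 0 <= t -> L u <= L t ->
  path_le (arc_path g u) (arc_path g t).
Proof. by move=> u0 t0 ut; split => //=; rewrite arc_path_cut. Qed.

(** The length of the reparametrized curve is at most [s] on [[0, s]] because the curve is
    1-Lipschitz, and at least [s] by minimality of the arc length of [g]. *)
Lemma arc_path_is_arc_length t : 0 <= t -> is_arc_length_path (arc_path g t).
Proof.
move=> t0; set q := arc_path g t; set l := L t.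
have l0 : 0 <= l by exact: arc_length_ge0.
have qL : lipschitz1 `[0, l] q.2.
  move=> a b al bl; have {}al : 0 <= a <= l by [].
  have {}bl : 0 <= b <= l by [].
  rewrite /q !arc_path2//.
  move: al bl => /andP[a0 al] /andP[b0 bl].
  have [ca0 cat caL] := crossing_spec a0 t0 al.
  have [cb0 cbt cbL] := crossing_spec b0 t0 bl.
  rewrite -{2}caL -{2}cbL.
  have [ab|/ltW ba] := leP (crossing g a) (crossing g b).
    rewrite enormC distrC ger0_norm ?subr_ge0 ?arc_length_homo//.
    exact: arc_length_dist.
  rewrite ger0_norm ?subr_ge0 ?arc_length_homo//.
  exact: arc_length_dist.
have Lq s : 0 <= s <= l -> arc_length q.2 s = s.
  move=> /andP[s0 sl]; have [c0 ct cL] := crossing_spec s0 t0 sl.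
  apply/eqP; rewrite eq_le; apply/andP; split.
    have /andP[_] := arc_length_bounds qL (lexx 0) s0 sl.
    by rewrite arc_length0 !subr0.
  have gpsi x y : 0 <= x -> x <= y -> y <= t ->
     enorm (g y - g x) <= arc_length q.2 (L y) - arc_length q.2 (L x) <= y - x.
    move=> x0 xy yt.
    rewrite -(arc_path_at (le_trans x0 xy) yt) -(arc_path_at x0 (le_trans xy yt)).
    have /andP[-> /=] := arc_length_bounds qL (arc_length_ge0 x0)
      (arc_length_homo x0 xy) (arc_length_homo (le_trans x0 xy) yt).
    move=> /le_trans; apply; exact: arc_length_lip.
  have := arc_length_minimal (@lipschitz_restrict t) gpsi (lexx 0) c0 ct.
  by rewrite arc_length0 cL !subr0 arc_length0 subr0.
split => //; rewrite [RHS]arc_path_cut//.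
Qed.

Lemma arc_pathP (q : path) t : is_arc_length_path q -> 0 <= t -> L t = q.1 ->
  (forall u, 0 <= u <= t -> g u = q.2 (L u)) -> arc_path g t = q.
Proof.
move=> [q0 q_ _ _] t0 tq gq; rewrite [RHS]q_ arc_pathE tq.
apply: mkpath_eq => s /andP[s0 sq]; have sL : s <= L t by rewrite tq.
have [c0 ct cL] := crossing_spec s0 t0 sL.
by rewrite /= gq ?cL ?c0.
Qed.

End LipschitzCurve.

Lemma arc_length_path_crossing (p : path) s : is_arc_length_path p ->
  0 <= s <= p.1 -> crossing p.2 s = s.
Proof.
move=> pa sp; rewrite /crossing; set S := [set _ | _].
have /andP[s0 sp1] := sp.
have Ss : S s by split => //; rewrite arc_lengthE.
have lbs : lbound S s.
  move=> u [u0 su]; rewrite leNgt; apply/negP => us.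
  by move: su; rewrite arc_lengthE ?u0 ?(le_trans (ltW us))// leNgt us.
apply/eqP; rewrite eq_le lb_le_inf ?andbT//; last by exists s.
by apply: inf_lbound => //; exists s.
Qed.

Lemma arc_path_of_path (p : path) s : is_arc_length_path p -> 0 <= s <= p.1 ->
  arc_path p.2 s = cut p s.
Proof.
move=> pa sp; rewrite arc_pathE arc_lengthE//; apply: mkpath_eq => u /andP[u0 us].
have /andP[s0 s1] := sp.
by rewrite /= arc_length_path_crossing// u0 (le_trans us).
Qed.

(** The padding with 0 outside of [[0, s]] can change the derivative only at [s]; comparing
    both lengths by minimality avoids any discussion of derivatives. *)
Lemma is_arc_length_cut (p : path) s : is_arc_length_path p -> 0 <= s <= p.1 ->
  is_arc_length_path (cut p s).
Proof.
move=> pa /andP[s0 sp]; have [p0 p_ pL pl] := pa.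
have cL : lipschitz1 `[0, s] (cut p s).2.
  move=> a b a_ b_; have {}a_ : 0 <= a <= s by [].
  have {}b_ : 0 <= b <= s by [].
  rewrite !cut2//.
  move: a_ b_ => /andP[a0 as_] /andP[b0 bs].
  by apply: pL; rewrite /= in_itv/= ?a0 ?b0 (le_trans _ sp).
split => //.
- by rewrite -[RHS]/(cut (cut p s) s) cut_cut.
- move=> u /andP[u0 us]; apply/eqP; rewrite eq_le; apply/andP; split.
    have /andP[_] := arc_length_bounds cL (lexx 0) u0 us.
    by rewrite arc_length0 !subr0.
  have us1 : 0 <= u <= p.1 by rewrite u0 (le_trans us).
  apply: (@le_trans _ _ (arc_length p.2 u)); first by rewrite [leRHS](pl u us1).
  have pL' : lipschitz1 `[0, s] p.2.
    move=> a b; rewrite /= !in_itv/= => /andP[a0 as_] /andP[b0 bs].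
    by apply: pL; rewrite /= in_itv/= ?a0 ?b0 (le_trans _ sp).
  have gpsi x y : 0 <= x -> x <= y -> y <= s -> enorm (p.2 y - p.2 x) <=
      arc_length (cut p s).2 y - arc_length (cut p s).2 x <= y - x.
    move=> x0 xy ys.
    have xs : 0 <= x <= s by rewrite x0 (le_trans xy).
    have y_s : 0 <= y <= s by rewrite (le_trans x0 xy).
    by rewrite -(cut2 p xs) -(cut2 p y_s); exact: arc_length_bounds cL x0 xy ys.
  have aux (a b a' b' : R) : a - b <= a' - b' -> b = 0 -> b' = 0 -> a <= a' by lra.
  exact: aux (arc_length_minimal pL' gpsi (lexx 0) u0 us) (arc_length0 _) (arc_length0 _).
Qed.

End ArcPath.

(** * Arc length as a limit of polygonal lengths *)

Section DyadicLength.
Context {R : realType} {d : nat}.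
Implicit Types (g : R -> 'rV[R]_d) (t : R).

Definition dyadic_step g (n i : nat) : R :=
  enorm (g (i.+1%:R / 2 ^+ n) - g (i%:R / 2 ^+ n)).

(** Unlike the arc length, the dyadic polygonal length is given by finitely many values of
    the curve, so that it depends measurably on the fibre. *)
Definition dyadic_length g (n : nat) t : R :=
  \sum_(0 <= i < Num.truncn (t * 2 ^+ n)) dyadic_step g n i.

Let p2 n : 0 < 2 ^+ n :> R. Proof. exact: exprn_gt0. Qed.

Let dya_ge0 n (i : nat) : 0 <= i%:R / 2 ^+ n :> R.
Proof. by rewrite divr_ge0// ltW. Qed.

Let dya_le n (i j : nat) : (i <= j)%N -> i%:R / 2 ^+ n <= j%:R / 2 ^+ n :> R.
Proof. by move=> ij; rewrite ler_pM2r ?invr_gt0// ler_nat. Qed.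

Let trunc_le n t : 0 <= t -> (Num.truncn (t * 2 ^+ n))%:R / 2 ^+ n <= t.
Proof.
move=> t0; have /andP[h _] := truncn_itv (mulr_ge0 t0 (ltW (p2 n))).
by rewrite ler_pdivrMr.
Qed.

Let trunc_gt n t : 0 <= t -> t < (Num.truncn (t * 2 ^+ n))%:R / 2 ^+ n + (2 ^+ n)^-1.
Proof.
move=> t0; have /andP[_ h] := truncn_itv (mulr_ge0 t0 (ltW (p2 n))).
by rewrite -[X in _ + X]mul1r -mulrDl natr1 ltr_pdivlMr.
Qed.

Section Lipschitz.
Variable g : R -> 'rV[R]_d.
Hypothesis gL : lipschitz1 `[0, +oo[ g.
Local Notation L := (arc_length g).

Let sum_le_arc n N : \sum_(0 <= i < N) dyadic_step g n i <= L (N%:R / 2 ^+ n).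
Proof.
elim: N => [|N IH]; first by rewrite big_geq// mul0r arc_length0.
rewrite big_nat_recr//= (le_trans (lerD IH (arc_length_dist gL _ (dya_le n (leqnSn N)))))//.
by rewrite addrC subrK.
Qed.

Lemma dyadic_length_le n t : 0 <= t -> dyadic_length g n t <= L t.
Proof.
by move=> t0; rewrite (le_trans (sum_le_arc _ _))// arc_length_homo// trunc_le.
Qed.

Let sum_dist n i j : (i <= j)%N ->
  enorm (g (j%:R / 2 ^+ n) - g (i%:R / 2 ^+ n)) <= \sum_(i <= k < j) dyadic_step g n k.
Proof.
move=> /subnK <-; elim: (j - i)%N => [|k IH].
  by rewrite add0n subrr enorm0 big_geq.
rewrite addSn big_nat_recr/= ?leq_addl//.
rewrite (le_trans (enorm_distD _ (g ((k + i)%:R / 2 ^+ n)) _))// addrC.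
by rewrite lerD.
Qed.

Lemma dyadic_length_mono n t : 0 <= t -> dyadic_length g n t <= dyadic_length g n.+1 t.
Proof.
move=> t0; rewrite /dyadic_length; set N := Num.truncn _; set N' := Num.truncn _.
have NN' : (2 * N <= N')%N.
  rewrite /N' truncn_ge_nat; last by rewrite mulr_ge0// ltW.
  have := trunc_le n t0; rewrite ler_pdivrMr// exprS natrM -/N; nra.
have step i : dyadic_step g n i <= dyadic_step g n.+1 (2 * i) + dyadic_step g n.+1 (2 * i).+1.
  have E (k : nat) : (2 * k)%:R / 2 ^+ n.+1 = k%:R / 2 ^+ n :> R.
    by rewrite natrM exprS -mulf_div divff ?mul1r.
  rewrite /dyadic_step -[i%:R / _]E -[i.+1%:R / _]E mulnS !addSn add0n [leRHS]addrC.
  exact: enorm_distD.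
apply: (@le_trans _ _ (\sum_(0 <= i < 2 * N) dyadic_step g n.+1 i)).
  elim: N {NN'} => [|k IH]; first by rewrite !big_geq.
  rewrite big_nat_recr//= mulnS !addSn add0n !big_nat_recr//= -addrA lerD//.
rewrite (big_cat_nat _ NN')//= lerDl sumr_ge0// => i _; exact: enorm_ge0.
Qed.

Lemma dyadic_length_dist n s t : 0 <= s -> s <= t ->
  enorm (g t - g s) - 2 * (2 ^+ n)^-1 <= dyadic_length g n t - dyadic_length g n s.
Proof.
move=> s0 st; have t0 := le_trans s0 st.
rewrite /dyadic_length; set N := Num.truncn (s * _); set N' := Num.truncn _.
have NN' : (N <= N')%N by apply: le_truncn; rewrite ler_pM2r.
rewrite (big_cat_nat _ NN')//= addrAC subrr add0r.
apply: le_trans (sum_dist n NN').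
have near u : 0 <= u -> enorm (g u - g ((Num.truncn (u * 2 ^+ n))%:R / 2 ^+ n)) <= (2 ^+ n)^-1.
  move=> u0; have := trunc_gt n u0; have := trunc_le n u0.
  move: (dya_ge0 n (Num.truncn (u * 2 ^+ n))); set w := _ / _ => w0 wu uw.
  apply: le_trans (gL _ _) _; rewrite /= ?in_itv/= ?w0 ?u0//.
  by rewrite ger0_norm ?subr_ge0//; lra.
have h1 := enorm_distD (g t) (g (N'%:R / 2 ^+ n)) (g s).
have h2 := enorm_distD (g (N'%:R / 2 ^+ n)) (g (N%:R / 2 ^+ n)) (g s).
have h3 := near t t0; have := near s s0; rewrite enormC -/N -/N' => h4.
move: h3; rewrite -/N'; lra.
Qed.

Lemma dyadic_length_lip n s t : 0 <= s -> s <= t ->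
  dyadic_length g n t - dyadic_length g n s <= t - s + (2 ^+ n)^-1.
Proof.
move=> s0 st; have t0 := le_trans s0 st.
have := trunc_le n t0; have := trunc_gt n s0.
rewrite /dyadic_length; set N := Num.truncn (s * _); set N' := Num.truncn _ => h1 h2.
have NN' : (N <= N')%N by apply: le_truncn; rewrite ler_pM2r.
rewrite (big_cat_nat _ NN')//= addrAC subrr add0r.
have : \sum_(N <= i < N') dyadic_step g n i <= \sum_(N <= i < N') (2 ^+ n)^-1.
  apply: ler_sum => i _; apply: le_trans (gL _ _) _; rewrite /= ?in_itv/= ?dya_ge0//.
  rewrite ger0_norm ?subr_ge0 ?dya_le// -mulrBl -natrB// subSnn mul1r.
  by [].
rewrite sumr_const_nat -[leRHS]mulr_natl natrB//; lra.
Qed.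

(** The limit of the polygonal lengths dominates the displacements of [g], so that it is at
    least the arc length by minimality. *)
Lemma dyadic_length_cvg t : 0 <= t -> dyadic_length g n t @[n --> \oo] --> L t.
Proof.
move=> t0.
have ub s : 0 <= s -> cvgn (fun n => dyadic_length g n s).
  move=> s0; apply: nondecreasing_is_cvgn; last first.
    by exists (L s) => _ [n _ <-]; exact: dyadic_length_le.
  by apply/nondecreasing_seqP => n; exact: dyadic_length_mono.
have p0 : ((2 ^+ n)^-1 : R) @[n --> \oo] --> 0.
  have : geometric 1 (2^-1 : R) @ \oo --> 0.
    by apply: cvg_geometric; rewrite ger0_norm ?invr_ge0// invf_lt1// ltr1n.
  rewrite (_ : geometric 1 (2^-1 : R) = fun n => (2 ^+ n)^-1)//.
  by apply/funext => n; rewrite /geometric/= mul1r exprVn.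
pose V s := limn (fun n => dyadic_length g n s).
have VP s : 0 <= s -> dyadic_length g n s @[n --> \oo] --> V s by move=> s0; exact: ub.
suff <- : V t = L t by exact: VP.
apply/eqP; rewrite eq_le; apply/andP; split.
  apply: limr_le; first exact: ub.
  by near=> n; exact: dyadic_length_le.
have gV x y : 0 <= x -> x <= y -> y <= t -> enorm (g y - g x) <= V y - V x <= y - x.
  move=> x0 xy yt; have y0 := le_trans x0 xy.
  have dV : dyadic_length g n y - dyadic_length g n x @[n --> \oo] --> V y - V x.
    by apply: cvgB; exact: VP.
  apply/andP; split.
    have h : enorm (g y - g x) - 2 * (2 ^+ n)^-1 @[n --> \oo] --> enorm (g y - g x) - 2 * 0.
      by apply: cvgB; [exact: cvg_cst|apply: cvgMr].
    rewrite mulr0 subr0 in h; apply: (ler_cvg_to h dV).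
    by near=> n; exact: dyadic_length_dist.
  have h : y - x + (2 ^+ n)^-1 @[n --> \oo] --> y - x + 0.
    by apply: cvgD => //; exact: cvg_cst.
  rewrite addr0 in h; apply: (ler_cvg_to dV h).
  by near=> n; exact: dyadic_length_lip.
have := arc_length_minimal (@lipschitz_restrict _ _ g gL t) gV (lexx 0) t0 (lexx t).
have -> : V 0 = 0.
  rewrite /V; apply/cvg_lim => //.
  rewrite (_ : (fun n => _) = cst 0); first exact: cvg_cst.
  by apply/funext => n; rewrite /dyadic_length mul0r truncn0 big_geq.
by rewrite [X in _ - X <= _](arc_length0 g) 2!subr0.
Unshelve. all: by end_near. Qed.

End Lipschitz.
End DyadicLength.

(** * Measurability of the set of fibres along a path *)

Section BorelRd.
Context {R : realType} {d : nat}.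

Lemma continuous_borel (f : 'rV[R]_d -> R) : continuous f ->
  measurable_fun (setT : set (borelR R d)) f.
Proof.
move=> cf; apply: (measurability _ (RGenOpens.measurableE R)).
move=> _ [_ [a [b ->] <-]]; rewrite setTI; apply: sub_sigma_algebra => /=.
by move/continuousP : cf; apply; exact: interval_open.
Qed.

Lemma open_borel (U : set 'rV[R]_d) : open U -> measurable (U : set (borelR R d)).
Proof. by move=> oU; exact: sub_sigma_algebra. Qed.

End BorelRd.

Section Classes.
Context {R : realType} {d : nat}.
Variables (M : R) (chi : R -> R -> 'rV[R]_d).
Local Notation leb := (@completed_lebesgue_measure R).
Local Notation path := (Defs.path R d).
Implicit Types (theta t : R) (p q : path).

Definition good_fiber theta :=
  [/\ lipschitz1 `[0, +oo[ (chi theta), chi theta 0 = 0 &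
      exists2 u, 0 <= u & forall t, u <= t -> chi theta t = chi theta u].

Definition fibers_along q : set R := [set theta | Theta M theta /\
  exists2 t, 0 < t & arc_path (chi theta) t = q].

(** An irrigation plan whose exceptional fibres are gathered in one measurable null set [N]. *)
Record tame_plan (N : set (lebesgueR R)) : Prop := TamePlan {
  tame_mass : 0 <= M;
  tame_meas : forall t, 0 <= t -> measurable_fun (Theta M : set (lebesgueR R))
    (fun theta : lebesgueR R => chi theta t : borelR R d);
  tame_null : measurable N;
  tame_null0 : leb N = 0%E;
  tame_fiber : forall theta, Theta M theta -> ~ N theta -> good_fiber theta }.

Variable N : set (lebesgueR R).
Hypothesis tN : tame_plan N.
Let chi_meas := tame_meas tN.
Let mN := tame_null tN.
Let N0 := tame_null0 tN.
Let goodN := tame_fiber tN.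

Definition Theta0 : set (lebesgueR R) := Theta M `\` N.

Lemma measurable_Theta : measurable (Theta M : set (lebesgueR R)).
Proof.
apply: sub_caratheodory; exact: measurable_itv.
Qed.

Lemma measurable_Theta0 : measurable Theta0.
Proof. by apply: measurableD => //; exact: measurable_Theta. Qed.

Lemma measurable_coord t i : 0 <= t ->
  measurable_fun Theta0 (fun theta : lebesgueR R => chi theta t ord0 i).
Proof.
move=> t0; apply: (@measurableT_comp _ _ _ _ _ _ (fun x : borelR R d => x ord0 i)).
  by apply: continuous_borel; exact: coord_continuous.
by apply: measurable_funS (chi_meas t0); [exact: measurable_Theta|exact: subDsetl].
Qed.

Lemma measurable_enorm_diff (F G : lebesgueR R -> 'rV[R]_d) D :
  (forall i, measurable_fun D (fun x => F x ord0 i)) ->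
  (forall i, measurable_fun D (fun x => G x ord0 i)) ->
  measurable_fun D (fun x => enorm (F x - G x)).
Proof.
move=> mF mG; apply: (@measurableT_comp _ _ _ _ _ _ (@Num.sqrt R) _
   (fun x => \sum_i (F x - G x) ord0 i ^+ 2)).
  by apply: continuous_measurable_fun; exact: sqrt_continuous.
apply: measurable_sum => i; apply: measurable_funX.
under eq_fun do rewrite !mxE.
exact: measurable_funB.
Qed.

Lemma measurable_arc_length t : 0 <= t ->
  measurable_fun Theta0 (fun theta : lebesgueR R => arc_length (chi theta) t).
Proof.
move=> t0; apply: (@measurable_fun_cvg _ _ _ _
  (fun n (theta : lebesgueR R) => dyadic_length (chi theta) n t)).
  move=> n; apply: measurable_sum => i; apply: measurable_enorm_diff => j;
  by apply: measurable_coord; rewrite divr_ge0.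
move=> theta [Mt Nt]; apply: dyadic_length_cvg => //.
by have [] := goodN Mt Nt.
Qed.

Section OnePath.
Variable q : path.
Hypothesis qa : is_arc_length_path q.

Let q0 : 0 <= q.1. Proof. by case: qa. Qed.

Let qlip s t : 0 <= s <= q.1 -> 0 <= t <= q.1 -> enorm (q.2 s - q.2 t) <= `|s - t|.
Proof. by move=> sq tq; case: qa => _ _ + _; apply. Qed.

Let deviation t theta : R :=
  enorm (chi theta t - q.2 (clamp q.1 (arc_length (chi theta) t))).

Let measurable_deviation t : 0 <= t -> measurable_fun Theta0 (deviation t).
Proof.
move=> t0; apply: measurable_enorm_diff => i; first exact: measurable_coord.
apply: (@measurableT_comp _ _ _ _ _ _ (fun x : R => q.2 (clamp q.1 x) ord0 i : R)
   Theta0 (fun theta : lebesgueR R => arc_length (chi theta) t));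
  last exact: measurable_arc_length.
apply: continuous_measurable_fun => x; apply/cvgrPdist_le => e e0; near=> y.
apply: (@le_trans _ _ `|x - y|); last first.
  by apply: ltW; near: y; exact: (nbhsx_ballx x e e0).
rewrite (le_trans _ (clamp_lip q.1 x y))// (le_trans _ (qlip _ _)) ?clamp_itv//.
by have := coord_le_enorm (q.2 (clamp q.1 x) - q.2 (clamp q.1 y)) i; rewrite !mxE.
Unshelve. all: by end_near. Qed.

(* A fibre follows [q] iff it does so at rational times, until its length passes
   that of [q]. *)
Let rat_time (k n : nat) : R := k%:R / n.+1%:R.

Let follows k n : set (lebesgueR R) :=
  [set theta | arc_length (chi theta) (rat_time k n) <= q.1 ->
               deviation (rat_time k n) theta <= 0].

Let fibers_alongE : fibers_along q `&` Theta0 =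
  \bigcap_k \bigcap_n (Theta0 `&` follows k n) `&`
  (\bigcup_n (Theta0 `&` [set theta | q.1 <= arc_length (chi theta) n%:R]) `&`
  \bigcup_n (Theta0 `&` [set theta | arc_length (chi theta) n.+1%:R^-1 <= q.1])).
Proof.
have rt0 k n : 0 <= rat_time k n by rewrite divr_ge0.
apply/seteqP; split => [theta [[_ [t t0 tq]] T0]|theta [F [[n _ [_ F1]] [m _ [_ F2]]]]].
  have [gL g0 _] := goodN T0.1 T0.2.
  have tq1 : arc_length (chi theta) t = q.1 by rewrite -tq.
  split; last split.
  - move=> k _ n _; split => //= Lu.
    have Lu0 := arc_length_ge0 gL (rt0 k n).
    rewrite /deviation clampE ?Lu0//.
    suff -> : q.2 (arc_length (chi theta) (rat_time k n)) = chi theta (rat_time k n).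
      by rewrite subrr enorm0.
    have [ut|/ltW tu] := leP (rat_time k n) t.
      by rewrite -tq arc_path_at.
    have Ltu : arc_length (chi theta) t = arc_length (chi theta) (rat_time k n).
      by apply/eqP; rewrite eq_le (arc_length_homo gL (ltW t0) tu) tq1 Lu.
    rewrite -Ltu -(arc_length_eq_dist gL (ltW t0) (rt0 k n) Ltu) -tq arc_path_at//.
    exact: ltW.
  - exists (Num.truncn t).+1 => //; split => //=; rewrite -tq1.
    apply: arc_length_homo => //; first exact: ltW.
    by have /andP[_ /ltW] := truncn_itv (ltW t0).
  - have [k kt] : exists k, k.+1%:R^-1 < t.
      exists (Num.truncn t^-1); rewrite invf_plt ?posrE//.
      have ti : 0 <= t^-1 by rewrite invr_ge0 ltW.
      by have /andP[] := truncn_itv ti.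
    exists k => //; split => //=; rewrite -tq1.
    by apply: arc_length_homo => //; exact: ltW.
have T0 : Theta0 theta by have [] := F 0%N I 0%N I.
have [gL g0 _] := goodN T0.1 T0.2; split => //; split; first exact: T0.1.
set L := arc_length (chi theta) in F1 F2 *.
have m0 : (0 : R) < m.+1%:R^-1 by rewrite invr_gt0.
have [t [t0 Lt]] : exists t, 0 < t /\ L t = q.1.
  have [c0 cn cL] := crossing_spec gL q0 (ler0n _ n) F1.
  have [cm|mc] := leP (crossing (chi theta) q.1) m.+1%:R^-1.
    exists m.+1%:R^-1; split => //; apply/eqP; rewrite eq_le F2 -{1}cL.
    exact: arc_length_homo.
  by exists (crossing (chi theta) q.1); split => //; exact: lt_trans mc.
exists t => //; apply: arc_pathP => //; first exact: ltW.
move=> u /andP[u0 ut]; apply/eqP; rewrite -subr_eq0 -enorm_eq0 eq_le enorm_ge0 andbT.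
apply/ler_addgt0Pr => e e0; rewrite add0r.
pose n' := Num.truncn (2 / e); pose k := Num.truncn (u * n'.+1%:R).
have n'0 : (0 : R) < n'.+1%:R by [].
have e2 : n'.+1%:R^-1 < e / 2.
  rewrite -[e / 2]invrK ltf_pV2 ?posrE ?invr_gt0 ?divr_gt0// invf_div.
  by have /andP[] := truncn_itv (ltW (divr_gt0 (ltr0Sn R 1) e0)).
have uk : rat_time k n' <= u.
  rewrite /rat_time ler_pdivrMr//.
  by have /andP[] := truncn_itv (mulr_ge0 u0 (ltW n'0)).
have ku : u <= rat_time k n' + n'.+1%:R^-1.
  rewrite /rat_time -[X in _ + X]mul1r -mulrDl natr1 ler_pdivlMr// ltW//.
  by have /andP[] := truncn_itv (mulr_ge0 u0 (ltW n'0)).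
have Lk : L (rat_time k n') <= q.1.
  by rewrite -Lt; apply: arc_length_homo => //; exact: le_trans ut.
have [_ /(_ Lk)] := F k I n' I.
have Lk0 : 0 <= L (rat_time k n') by exact: arc_length_ge0.
have Lu0 : 0 <= L u by exact: arc_length_ge0.
have Luq : L u <= q.1 by rewrite -Lt; exact: arc_length_homo.
rewrite /deviation clampE ?Lk0// -/L => dev.
have h1 := enorm_distD (chi theta u) (chi theta (rat_time k n')) (q.2 (L u)).
have h2 := enorm_distD (chi theta (rat_time k n')) (q.2 (L (rat_time k n'))) (q.2 (L u)).
have h3 : enorm (chi theta u - chi theta (rat_time k n')) <= u - rat_time k n'.
  by apply: le_trans (arc_length_dist gL _ uk) (arc_length_lip gL _ uk).
have h4 : enorm (q.2 (L (rat_time k n')) - q.2 (L u)) <= u - rat_time k n'.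
  apply: le_trans (qlip _ _) _; rewrite ?Lk0 ?Lu0//.
  by rewrite distrC ger0_norm ?subr_ge0 ?arc_length_homo// arc_length_lip.
have aux (a b c dv f v r i w : R) : a <= b + c -> c <= dv + f -> b <= v - r ->
    f <= v - r -> dv <= 0 -> v <= r + i -> i < w / 2 -> a <= w by lra.
exact: aux h1 h2 h3 h4 dev ku e2.
Qed.

Lemma measurable_fibers_along0 : measurable ((fibers_along q `&` Theta0) : set (lebesgueR R)).
Proof.
have rt0 k n : 0 <= rat_time k n by rewrite divr_ge0.
have mT := measurable_Theta0.
have mL t (Y : set R) : 0 <= t -> measurable Y -> measurable (Theta0 `&`
    (fun theta : lebesgueR R => arc_length (chi theta) t) @^-1` Y).
  by move=> t0 mY; exact: (measurable_arc_length t0 mT mY).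
have mD t (Y : set R) : 0 <= t -> measurable Y -> measurable (Theta0 `&`
    (deviation t : lebesgueR R -> R) @^-1` Y).
  by move=> t0 mY; exact: (measurable_deviation t0 mT mY).
rewrite fibers_alongE; apply: measurableI; last apply: measurableI.
- apply: bigcapT_measurable => k; apply: bigcapT_measurable => n.
  rewrite (_ : follows k n = (fun theta => arc_length (chi theta) (rat_time k n)) @^-1` `]q.1, +oo[
     `|` deviation (rat_time k n) @^-1` `]-oo, 0]).
    rewrite setIUr; apply: measurableU.
      exact: (mL _ `]q.1, +oo[%classic (rt0 k n) (measurable_itv _)).
    exact: (mD _ `]-oo, 0]%classic (rt0 k n) (measurable_itv _)).
  apply/seteqP; split => theta /=; rewrite !in_itv/= ?andbT /follows/=.
    by move=> H; have [/H|] := leP (arc_length (chi theta) (rat_time k n)) q.1; [right|left].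
  by case=> // h1 h2; move: h1; rewrite ltNge h2.
- apply: bigcupT_measurable => n.
  rewrite (_ : [set _ | _] = (fun theta => arc_length (chi theta) n%:R) @^-1` `[q.1, +oo[).
    by apply: mL.
  by apply/seteqP; split => theta /=; rewrite in_itv/= andbT.
- apply: bigcupT_measurable => n.
  rewrite (_ : [set _ | _] = (fun theta => arc_length (chi theta) n.+1%:R^-1) @^-1` `]-oo, q.1]).
    by apply: mL => //; rewrite invr_ge0.
  by apply/seteqP; split => theta /=; rewrite in_itv/=.
Qed.

End OnePath.

End Classes.

(** * The mass of a path *)

Section OuterLebesgue.
Context {R : realType}.
Local Notation leb := (@completed_lebesgue_measure R).

Let outer : {outer_measure set (ocitv_type R) -> \bar R} := ((wlength (@idfun R))^*)%mu.

Lemma leb_le (A B : set R) : A `<=` B -> (leb A <= leb B)%E.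
Proof. exact: (@le_outer_measure _ _ outer A B). Qed.

Lemma leb_ge0 (A : set R) : (0 <= leb A)%E.
Proof. exact: (outer_measure_ge0 outer A). Qed.

Lemma leb0 : leb set0 = 0%E.
Proof. exact: (outer_measure0 outer). Qed.

Lemma lebU (A B : set R) : (leb (A `|` B) <= leb A + leb B)%E.
Proof. exact: (@outer_measureU2 _ _ outer A B). Qed.

Lemma leb_bigcup (F : (set R)^nat) :
  (leb (\bigcup_n F n) <= \sum_(0 <= n <oo) leb (F n))%E.
Proof. exact: (@outer_measure_sigma_subadditive _ _ outer F). Qed.

End OuterLebesgue.

Section FiberMasses.
Context {R : realType} {d : nat}.
Variables (M : R) (chi : R -> R -> 'rV[R]_d) (N : set (lebesgueR R)).
Local Notation leb := (@completed_lebesgue_measure R).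
Local Notation path := (Defs.path R d).
Implicit Types (theta t eps : R) (p q : path).

Hypothesis tN : tame_plan M chi N.
Let M0 := tame_mass tN.
Let mN := tame_null tN.
Let N0 := tame_null0 tN.
Let goodN := tame_fiber tN.

Local Notation Theta0 := (Theta0 M N).
Local Notation fibers := (fibers_along M chi).

Definition fibers0 q : set (lebesgueR R) := fibers q `&` Theta0.

Definition mass q : R := meas (fibers q).

Lemma leb_Theta : leb (Theta M) = M%:E.
Proof.
rewrite -[LHS]/(@lebesgue_measure R `[0, M]%classic) lebesgue_measure_itv/=.
move: M0; rewrite le_eqVlt => /orP[/eqP <-|M1]; first by rewrite lte_fin ltxx.
by rewrite lte_fin M1 oppr0 adde0.
Qed.

Lemma leb_sub_Theta_fin (A : set R) : A `<=` Theta M -> leb A \is a fin_num.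
Proof.
move=> AT; rewrite ge0_fin_numE; last exact: leb_ge0.
by rewrite (le_lt_trans (leb_le AT))// leb_Theta ltry.
Qed.

Lemma fibers_Theta q : fibers q `<=` Theta M. Proof. by move=> t []. Qed.

Lemma massE q : (mass q)%:E = leb (fibers q).
Proof. by rewrite /mass /meas fineK// leb_sub_Theta_fin//; exact: fibers_Theta. Qed.

Lemma leb_off_N (A : set R) : leb A = leb (A `\` N).
Proof.
apply/eqP; rewrite eq_le; apply/andP; split; last by apply: leb_le => x [].
have AE : A `<=` (A `\` N) `|` N.
  by move=> x Ax; have [Nx|Nx] := pselect (N x); [right|left].
by rewrite (le_trans (leb_le AE))// (le_trans (lebU _ _))// N0 adde0.
Qed.

Lemma leb_fibers0 q : leb (fibers0 q) = leb (fibers q).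
Proof.
rewrite [RHS]leb_off_N; congr leb; apply/seteqP; split => [x [qx [_ Nx]]|x [qx Nx]].
  by split.
by split => //; split => //; exact: fibers_Theta qx.
Qed.

Lemma mass_le q : mass q <= M.
Proof. by rewrite -lee_fin massE -leb_Theta leb_le//; exact: fibers_Theta. Qed.

Lemma measurable_fibers0 q : is_arc_length_path q -> measurable (fibers0 q).
Proof.
move=> qa; exact: (measurable_fibers_along0 tN qa).
Qed.

Lemma fibers0P q theta : fibers0 q theta ->
  [/\ good_fiber chi theta, Theta0 theta &
      exists2 t, 0 < t & arc_path (chi theta) t = q].
Proof. by move=> [[_ qt] T0]; split => //; exact: goodN T0.1 T0.2. Qed.

Lemma fibers0_prefix p q : 0 < p.1 -> path_le p q -> fibers0 q `<=` fibers0 p.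
Proof.
move=> p0 [pq pE] theta qt; have [[gL g0 _] T0 [t t0 tq]] := fibers0P qt.
split => //; split; first exact: T0.1.
have pL : p.1 <= arc_length (chi theta) t by move: pq; rewrite -tq.
have [c0 ct cL] := crossing_spec gL (ltW p0) (ltW t0) pL.
exists (crossing (chi theta) p.1).
  rewrite lt_neqAle c0 andbT; apply/eqP => c_0.
  by move: cL; rewrite -c_0 arc_length0 => p_0; move: p0; rewrite -p_0 ltxx.
by rewrite (arc_path_prefix gL c0 ct) cL tq.
Qed.

Lemma mass_prefix p q : 0 < p.1 -> path_le p q -> mass q <= mass p.
Proof.
move=> p0 pq; rewrite -lee_fin !massE -!leb_fibers0.
by apply: leb_le; exact: fibers0_prefix.
Qed.

(** A fibre follows one curve, so that two paths along which it runs are comparable. *)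
Lemma fibers0_common p q theta : fibers0 p theta -> fibers0 q theta ->
  p.1 <= q.1 -> path_le p q.
Proof.
move=> /fibers0P[[gL g0 _] _ [t t0 tp]] /fibers0P[_ _ [t' t'0 t'q]].
by rewrite -tp -t'q => Lt; apply: arc_path_path_le => //; exact: ltW.
Qed.

Lemma fibers0_path q theta : fibers0 q theta -> is_arc_length_path q.
Proof.
by move=> /fibers0P[[gL _ _] _ [t t0 <-]]; apply: arc_path_is_arc_length => //; exact: ltW.
Qed.

Lemma fibers0_origin q theta : fibers0 q theta -> q.2 0 = 0.
Proof.
move=> /fibers0P[[gL g0 _] _ [t t0 <-]].
by rewrite -(arc_length0 (chi theta)) arc_path_at// ltW.
Qed.

Lemma mass_gt0_fiber q : 0 < mass q -> exists theta, fibers0 q theta.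
Proof.
move=> q0; have : (0 < leb (fibers0 q))%E by rewrite leb_fibers0 -massE lte_fin.
apply: contraPP => /forallNP h; have -> : fibers0 q = set0 by apply/seteqP; split.
by rewrite leb0 ltxx.
Qed.

Lemma infinite_seq (T : choiceType) (A : set T) : infinite_set A ->
  forall n, exists s : seq T, [/\ uniq s, size s = n & forall x, x \in s -> A x].
Proof.
move=> Ainf; elim=> [|n [s [us ss sA]]]; first by exists [::].
have [x [Ax xs]] : exists x, A x /\ x \notin s.
  apply: contrapT => H; apply: Ainf; apply: (@sub_finite_set _ _ [set` s]).
    by move=> x Ax; apply: contrapT => /negP xs; apply: H; exists x.
  exact: finite_seq.
exists (x :: s); split => //=; rewrite ?xs ?ss// => y.
by rewrite inE => /orP[/eqP ->|/sA].
Qed.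

(** Incomparable paths are followed by disjoint sets of fibres, each of measure at least
    [eps] in a total of [M]. *)
Lemma finite_antichain eps (A : set path) : 0 < eps ->
  (forall p, A p -> eps <= mass p) ->
  (forall p q, A p -> A q -> path_le p q -> p = q) -> finite_set A.
Proof.
move=> eps0 Aeps Aanti; apply: contrapT => /infinite_seq Ainf.
have [s [us ss sA]] := Ainf (Num.truncn (M / eps)).+1.
pose F (i : 'I_(size s)) := fibers0 (tnth (in_tuple s) i).
have As i : A (tnth (in_tuple s) i) by apply: sA; exact: mem_tnth.
have mF i : measurable (F i).
  have [theta /fibers0_path qa] := mass_gt0_fiber (lt_le_trans eps0 (Aeps _ (As i))).
  exact: measurable_fibers0.
have tF : trivIset setT F.
  move=> i j _ _ [theta [Fi Fj]].
  have e : tnth (in_tuple s) i = tnth (in_tuple s) j.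
    have [ij|/ltW ji] := leP (tnth (in_tuple s) i).1 (tnth (in_tuple s) j).1.
      by apply: Aanti => //; exact: fibers0_common Fi Fj ij.
    by apply/esym/Aanti => //; exact: fibers0_common Fj Fi ji.
  by have /tuple_uniqP inj : uniq (in_tuple s) by []; exact: inj.
have H := measure_bigsetU_ord leb xpredT mF tF.
have : (\sum_(i < size s) leb (F i) <= M%:E)%E.
  rewrite -[leLHS]H -leb_Theta; apply: leb_le.
  by elim/big_ind: _ => // [A' B' hA hB x [/hA|/hB]//|i _ x [/fibers_Theta]].
apply/negP; rewrite -ltNge.
apply: (@lt_le_trans _ _ (\sum_(i < size s) eps%:E)%E); last first.
  by apply: lee_sum => i _; rewrite leb_fibers0 -massE lee_fin Aeps.
rewrite sumEFin sumr_const card_ord ss lte_fin -mulr_natl -ltr_pdivrMr//.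
by have /andP[] := truncn_itv (divr_ge0 M0 (ltW eps0)).
Qed.

End FiberMasses.

(** * Maximal good paths *)

Lemma exists_natSinv_lt (R : realType) (e : R) : 0 < e -> exists n, n.+1%:R^-1 < e.
Proof.
move=> e0; exists (Num.truncn e^-1); rewrite invf_plt ?posrE//.
have ei : 0 <= e^-1 by rewrite invr_ge0 ltW.
by have /andP[] := truncn_itv ei.
Qed.

Section LimitPaths.
Context {R : realType} {d : nat}.
Local Notation path := (Defs.path R d).
Implicit Types (p q : path).

(** A comparison function frozen at time [u] shows, by minimality, that no length is added. *)
Lemma arc_length_settled (g : R -> 'rV[R]_d) (u t : R) :
  lipschitz1 `[0, +oo[ g -> 0 <= u -> (forall t, u <= t -> g t = g u) ->
  u <= t -> arc_length g t = arc_length g u.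
Proof.
move=> gL u0 gu ut; have t0 := le_trans u0 ut.
apply/eqP; rewrite eq_le (arc_length_homo gL u0 ut) andbT.
pose psi x := arc_length g (Num.min x u).
have gm x : g x = g (Num.min x u) by case: (leP x u) => // /ltW /gu.
have gpsi x y : 0 <= x -> x <= y -> y <= t -> enorm (g y - g x) <= psi y - psi x <= y - x.
  move=> x0 xy yt; rewrite (gm x) (gm y).
  have m0 : 0 <= Num.min x u by rewrite le_min x0.
  have mm : Num.min x u <= Num.min y u.
    by rewrite le_min ge_min xy/= ge_min lexx orbT.
  rewrite (arc_length_dist gL m0 mm)/= (le_trans (arc_length_lip gL m0 mm))//.
  by case: (leP x u) => ?; case: (leP y u) => ?; lra.
have := arc_length_minimal (@lipschitz_restrict _ _ g gL t) gpsi u0 ut (lexx t).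
rewrite /psi minxx (min_idPr ut) subrr.
by rewrite subr_le0.
Qed.

Lemma path_lip p s t : is_arc_length_path p -> 0 <= s <= p.1 -> 0 <= t <= p.1 ->
  enorm (p.2 s - p.2 t) <= `|s - t|.
Proof. by move=> [_ _ + _] sp tp; apply. Qed.

(** Continuity at the common end. *)
Lemma path_eq_before p q l : is_arc_length_path p -> is_arc_length_path q ->
  0 < l -> l <= p.1 -> l <= q.1 -> (forall s, 0 <= s < l -> p.2 s = q.2 s) ->
  forall s, 0 <= s <= l -> p.2 s = q.2 s.
Proof.
move=> pa qa l0 lp lq pq s /andP[s0].
rewrite le_eqVlt => /orP[/eqP ->|sl]; last by rewrite pq ?s0.
apply/eqP; rewrite -subr_eq0 -enorm_eq0 eq_le enorm_ge0 andbT.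
apply/ler_addgt0Pr => e e0; rewrite add0r.
pose t := Num.max 0 (l - e / 2).
have t0 : 0 <= t by rewrite le_max lexx.
have tl : t < l by rewrite gt_max l0/=; lra.
have te : l - t <= e / 2.
  have : l - e / 2 <= t by rewrite le_max lexx orbT.
  lra.
have lt0 : 0 <= l - t by rewrite subr_ge0 ltW.
have h1 := enorm_distD (p.2 l) (p.2 t) (q.2 l).
have h2 : enorm (p.2 l - p.2 t) <= l - t.
  rewrite -[leRHS]ger0_norm//; apply: path_lip => //.
    by rewrite (ltW l0).
  by rewrite t0 (le_trans (ltW tl)).
have h3 : enorm (p.2 t - q.2 l) <= l - t.
  rewrite pq ?t0// -[leRHS]ger0_norm// distrC; apply: path_lip => //.
    by rewrite t0 (le_trans (ltW tl)).
  by rewrite (ltW l0).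
have aux (a b c x w : R) : a <= b + c -> b <= x -> c <= x -> x <= w / 2 -> a <= w by lra.
exact: aux h1 h2 h3 te.
Qed.

Lemma path_limit_unique (c : nat -> path) p q : is_arc_length_path p ->
  is_arc_length_path q -> p.1 = q.1 -> 0 < p.1 ->
  (forall n, path_le (c n) p) -> (forall n, path_le (c n) q) ->
  (forall s, s < p.1 -> exists n, s < (c n).1) -> p = q.
Proof.
move=> pa qa pq p0 cp cq sc; rewrite -(wf_cut pa) -(wf_cut qa) -pq.
apply/cut_eqP; apply: path_eq_before => //; first by rewrite pq.
move=> s /andP[s0 sp]; have [n sn] := sc s sp.
by rewrite -(path_le2 (cp n)) ?s0 ?ltW// (path_le2 (cq n))// s0 ltW.
Qed.

End LimitPaths.

Section MaximalPaths.
Context {R : realType} {d : nat}.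
Variables (M : R) (chi : R -> R -> 'rV[R]_d) (N : set (lebesgueR R)).
Local Notation leb := (@completed_lebesgue_measure R).
Local Notation path := (Defs.path R d).
Implicit Types (theta t eps : R) (p q : path).

Hypothesis tN : tame_plan M chi N.

Local Notation Theta0 := (Theta0 M N).
Local Notation fibers := (fibers_along M chi).
Local Notation fibers0 := (fibers0 M chi N).
Local Notation mass := (mass M chi).

Variable eps : R.
Hypothesis eps0 : 0 < eps.

(** The sets of fibres along the paths [c n] decrease, so that their intersection has
    measure at least [eps]. The fibres of the intersection all follow the limit path. *)
Lemma good_limit (c : nat -> path) : 0 < (c 0%N).1 ->
  (forall n, eps <= mass (c n)) -> (forall n, path_le (c n) (c n.+1)) ->
  exists q, [/\ is_arc_length_path q, eps <= mass q & forall n, path_le (c n) q].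
Proof.
move=> c0 ceps cle.
have cmono n m : (n <= m)%N -> path_le (c n) (c m).
  move=> /subnK <-; elim: (m - n)%N => [|k IH].
    rewrite add0n; have [theta /(fibers0_path tN) na] := mass_gt0_fiber tN (lt_le_trans eps0 (ceps n)).
    exact: path_le_refl na.
  by rewrite addSn; apply: path_leT IH _; exact: cle.
have c1 n : 0 < (c n).1 by apply: lt_le_trans c0 (cmono _ _ (leq0n n)).1.
have ca n : is_arc_length_path (c n).
  by have [theta /(fibers0_path tN)] := mass_gt0_fiber tN (lt_le_trans eps0 (ceps n)); exact.
pose G n := fibers0 (c n).
have mG n : measurable (G n) by exact: (measurable_fibers0 tN).
have mI : measurable (\bigcap_n G n) by exact: bigcapT_measurable.
have nG : nonincreasing_seq G.
  by move=> n m nm; apply/subsetPset; apply: (fibers0_prefix tN) => //; exact: cmono.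
have Gfin : (leb (G 0%N) < +oo)%E.
  by rewrite /G (leb_fibers0 tN) -(massE tN) ltry.
have epsI : (eps%:E <= leb (\bigcap_n G n))%E.
  have := nonincreasing_cvg_mu Gfin mG mI nG => cv.
  rewrite -(cvg_lim _ cv)//; apply: lime_ge; first by apply/cvg_ex; exists (leb (\bigcap_n G n)).
  by near=> n; rewrite /= /G (leb_fibers0 tN) -(massE tN) lee_fin.
have [theta It] : exists theta, (\bigcap_n G n) theta.
  apply: contrapT => /forallNP h; move: epsI.
  have -> : \bigcap_n G n = set0 by apply/seteqP; split.
  by rewrite leb0 lee_fin leNgt eps0.
pose l := sup (range (fun n => (c n).1)).
have fiber_limit th : (\bigcap_n G n) th -> exists t, [/\ 0 < t,
    (forall n, (c n).1 <= l), arc_length (chi th) t = l,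
    (forall n, path_le (c n) (arc_path (chi th) t)) &
    is_arc_length_path (arc_path (chi th) t)].
  move=> Ith; have [[gL g0 [u u0 gu]] _ _] := fibers0P tN (Ith 0%N I).
  have cu n : (c n).1 <= arc_length (chi th) u.
    have [_ _ [t t0 <-]] := fibers0P tN (Ith n I).
    have [tu|/ltW ut] := leP t u; first by apply: arc_length_homo => //; exact: ltW.
    by rewrite -(arc_length_settled gL u0 gu ut).
  have hs : has_sup (range (fun n => (c n).1)).
    split; first by exists (c 0%N).1; exists 0%N.
    by exists (arc_length (chi th) u) => _ [n _ <-].
  have cl n : (c n).1 <= l by apply: sup_upper_bound => //; exists n.
  have lu : l <= arc_length (chi th) u.
    by apply: ge_sup; [exact: hs.1|move=> _ [n _ <-]].
  have l0 : 0 < l := lt_le_trans c0 (cl 0%N).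
  have [t0 tu tl] := crossing_spec gL (ltW l0) u0 lu.
  set t := crossing _ _ in t0 tu tl.
  exists t; split => //.
  - rewrite lt_neqAle t0 andbT; apply/eqP => t_0.
    by move: tl; rewrite -t_0 arc_length0 => l_0; move: l0; rewrite -l_0 ltxx.
  - move=> n; have [_ _ [tn tn0 tnc]] := fibers0P tN (Ith n I).
    rewrite -tnc; apply: arc_path_path_le => //; first exact: ltW.
    by rewrite tl -[leLHS]/((arc_path (chi th) tn).1) tnc.
  - exact: arc_path_is_arc_length.
have [t [t0 cl tl ct ta]] := fiber_limit theta It.
exists (arc_path (chi theta) t); split => //.
rewrite -lee_fin (massE tN) (le_trans epsI)//; apply: leb_le => th Ith.
have [t' [t'0 _ t'l ct' t'a]] := fiber_limit th Ith.
split; first by have [[]] := Ith 0%N I.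
exists t'; first exact: t'0.
apply: (path_limit_unique t'a ta _ _ ct' ct).
- by rewrite -[LHS]/(arc_length _ t') -[RHS]/(arc_length _ t) tl t'l.
- by rewrite -[_.1]/(arc_length _ t') t'l (lt_le_trans c0).
- rewrite -[_.1]/(arc_length _ t') t'l => s sl.
  have [|_ [n _ <-] sn] := @sup_gt _ (range (fun n => (c n).1)) s _ sl.
    by exists (c 0%N).1; exists 0%N.
  by exists n.
Unshelve. all: by end_near. Qed.

Lemma good_pathP p : good_path M chi eps p <->
  is_arc_length_path p /\ eps <= mass p.
Proof.
rewrite /good_path /mass /meas /equiv_path.
split => -[pa pm]; split => //; move: pm;
by rewrite (arc_path_of_path pa) ?(wf_cut pa)// lexx andbT; case: pa.
Qed.

(** Zorn. A chain without a longest element is exhausted by an increasing sequence of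
    prefixes of its members; their limit path is good and bounds the chain. *)
Lemma good_extends p : is_arc_length_path p -> 0 < p.1 -> eps <= mass p ->
  exists2 q, max_good_path M chi eps q & path_le p q.
Proof.
move=> pa p0 pm.
pose T := {q : path | is_arc_length_path q /\ eps <= mass q /\ path_le p q}.
pose r (a b : T) := `[< path_le (sval a) (sval b) >].
have Ta (a : T) : is_arc_length_path (sval a) by case: a => ? [].
have Tm (a : T) : eps <= mass (sval a) by case: a => ? [? []].
have Tp (a : T) : path_le p (sval a) by case: a => ? [? []].
have T1 (a : T) : 0 < (sval a).1 := lt_le_trans p0 (Tp a).1.
have Teq (a b : T) : sval a = sval b -> a = b.
  by case: a b => [a Pa] [b Pb] /= ab; subst b; congr exist; exact: Prop_irrelevance.
have [|||A Atot|[q [qa [qm pq]]] qmax] := @Zorn T r.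
- by move=> a; apply/asboolP; exact: path_le_refl.
- by move=> a b c /asboolP ab /asboolP bc; apply/asboolP; exact: path_leT bc.
- by move=> a b /asboolP ab /asboolP ba; apply/Teq; exact: path_le_anti.
- have Acmp a b : A a -> A b -> (sval a).1 <= (sval b).1 -> path_le (sval a) (sval b).
    move=> Aa Ab ab; have [/asboolP//|/asboolP ba] := Atot a b Aa Ab.
    rewrite (_ : sval a = sval b); first exact: path_le_refl.
    by apply/esym/(path_le_length_eq (Ta a) ba)/eqP; rewrite eq_le ab ba.1.
  have [[a0 Aa0]|A0] := pselect (A !=set0); last first.
    exists (exist _ p (conj pa (conj pm (path_le_refl pa)))) => s As.
    by exfalso; apply: A0; exists s.
  have [[a [Aa amax]]|nomax] :=
      pselect (exists a, A a /\ forall b, A b -> (sval b).1 <= (sval a).1).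
    by exists a => b Ab; apply/asboolP; apply: Acmp => //; exact: amax.
  have longer a : A a -> exists b, A b /\ (sval a).1 < (sval b).1.
    move=> Aa; apply: contrapT => H; apply: nomax; exists a; split => // b Ab.
    by rewrite leNgt; apply/negP => ab; apply: H; exists b.
  pose S := [set (sval a).1 | a in A].
  have [bd [bdmono bdlt bdcof]] : exists bd : nat -> R,
      [/\ forall n, bd n <= bd n.+1, forall n, exists b, A b /\ bd n < (sval b).1 &
      forall a, A a -> exists n, (sval a).1 <= bd n].
    have [Sub|Sub] := pselect (has_ubound S); last first.
      exists (fun n => n%:R); split.
      - by move=> n; rewrite ler_nat.
      - move=> n; apply: contrapT => H; apply: Sub; exists n%:R => _ [b Ab <-].
        by rewrite leNgt; apply/negP => nb; apply: H; exists b.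
      - move=> a Aa; exists (Num.truncn (sval a).1).+1.
        by have /andP[_ /ltW] := truncn_itv (ltW (T1 a)).
    have hs : has_sup S by split => //; exists (sval a0).1; exists a0.
    exists (fun n => sup S - n.+1%:R^-1); split.
    - by move=> n; rewrite lerD2l lerN2 lef_pV2 ?posrE// ler_nat.
    - move=> n; have [|_ [b Ab <-] nb] := @sup_gt _ S (sup S - n.+1%:R^-1) hs.1.
        by rewrite gtrBl invr_gt0.
      by exists b.
    - move=> a Aa; have [b [Ab ab]] := longer a Aa.
      have bS : (sval b).1 <= sup S by apply: sup_upper_bound => //; exists b.
      have e0 : 0 < sup S - (sval a).1 by rewrite subr_gt0 (lt_le_trans ab).
      have [n ne] := exists_natSinv_lt e0.
      by exists n; rewrite lerBrDl -lerBrDr ltW.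
  pose ab n := Num.max p.1 (bd n).
  have /choice[f fP] := bdlt.
  have abf n : ab n <= (sval (f n)).1.
    by rewrite ge_max (Tp (f n)).1 ltW//; case: (fP n).
  have pab n : p.1 <= ab n by rewrite le_max lexx.
  have ab0 n : 0 < ab n by exact: lt_le_trans p0 (pab n).
  pose c n := cut (sval (f n)) (ab n).
  have cf n : path_le (c n) (sval (f n)) by split; first exact: abf.
  have cc n m : ab n <= ab m -> path_le (c n) (c m).
    move=> nm; split => //; rewrite /= cut_cut//.
    have [fnm|/ltW fmn] := leP (sval (f n)).1 (sval (f m)).1.
      by apply: path_le_cutE (abf n) _; apply: Acmp => //; [case: (fP n)|case: (fP m)].
    apply/esym; apply: path_le_cutE (le_trans nm (abf m)) _.
    by apply: Acmp => //; [case: (fP m)|case: (fP n)].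
  have cm n : eps <= mass (c n).
    by apply: le_trans (Tm (f n)) _; exact: (mass_prefix tN (ab0 n : 0 < (c n).1) (cf n)).
  have cle n : path_le (c n) (c n.+1).
    by apply: cc; rewrite ge_max pab/= le_max bdmono orbT.
  have [q [qa qm cq]] := good_limit (c := c) (ab0 0%N) cm cle.
  have pq : path_le p q.
    apply: path_leT (cq 0%N); split; first exact: pab.
    by rewrite cut_cut ?pab//; case: (Tp (f 0%N)).
  exists (exist _ q (conj qa (conj qm pq))) => a Aa; apply/asboolP => /=.
  have [n an] := bdcof a Aa.
  have an' : (sval a).1 <= ab n by rewrite le_max an orbT.
  apply: (path_leT _ (cq n)); apply: (path_le_common _ (cf n) an').
  by apply: Acmp => //; [case: (fP n)|exact: le_trans an' (abf n)].
- exists q => //; split; first exact/good_pathP.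
  move=> q' /good_pathP[q'a q'm] qq'.
  have pq' := path_leT pq qq'.
  by have /(congr1 sval)/= := qmax (exist _ q' (conj q'a (conj q'm pq'))) (asboolT qq').
Qed.

End MaximalPaths.

(** * The tree of elementary branches *)

Section FiniteExtrema.
Context {R : realType}.

Lemma finite_set_min (A : set R) : finite_set A -> A !=set0 ->
  exists2 m, A m & forall x, A x -> m <= x.
Proof.
move=> /finite_seqP[s ->] [x0]; rewrite /=.
elim: s x0 => [//|a [|b s] IH] x0 _.
  by exists a; rewrite ?mem_head// => x /=; rewrite inE => /eqP ->.
have [m ms mmin] := IH b (mem_head _ _).
exists (Num.min a m) => [|x /=].
  by case: leP => _ /=; rewrite inE ?eqxx// [_ \in _]ms orbT.
by rewrite inE => /orP[/eqP ->|xs]; rewrite ge_min ?lexx// (mmin x xs) orbT.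
Qed.

Lemma finite_set_max (A : set R) : finite_set A -> A !=set0 ->
  exists2 m, A m & forall x, A x -> x <= m.
Proof.
move=> Afin [x0 Ax0].
have [||m [y Ay <-] mmin] := @finite_set_min [set - x | x in A].
- exact: finite_image.
- by exists (- x0); exists x0.
by exists y => // x Ax; rewrite -lerN2; apply: mmin; exists x.
Qed.

End FiniteExtrema.

Section BranchTree.
Context {R : realType} {d : nat}.
Variables (M : R) (chi : R -> R -> 'rV[R]_d) (N : set (lebesgueR R)).
Local Notation leb := (@completed_lebesgue_measure R).
Local Notation path := (Defs.path R d).
Implicit Types (theta t : R) (p q : path).

Hypothesis tN : tame_plan M chi N.
Variable eps : R.
Hypothesis eps0 : 0 < eps.

Local Notation mass := (mass M chi).
Local Notation maxp := (max_good_path M chi eps).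

Lemma maxp_arc p : maxp p -> is_arc_length_path p.
Proof. by move=> [/good_pathP[]]. Qed.

Lemma maxp_mass p : maxp p -> eps <= mass p.
Proof. by move=> [/good_pathP[]]. Qed.

Lemma maxp_origin p : maxp p -> p.2 0 = 0.
Proof.
move=> /maxp_mass pm.
have [theta] := mass_gt0_fiber tN (lt_le_trans eps0 pm).
exact: fibers0_origin.
Qed.

Lemma maxp_le p q : maxp p -> maxp q -> path_le p q -> p = q.
Proof. by move=> [_ pmax] [qg _] pq; rewrite (pmax q). Qed.

Lemma finite_maxp : finite_set maxp.
Proof.
apply: (finite_antichain tN eps0); first by move=> p; exact: maxp_mass.
by move=> p q; exact: maxp_le.
Qed.

Lemma split_timeC p q : split_time p q = split_time q p.
Proof.
rewrite /split_time; congr sup; apply/seteqP; split => t /= [tm H];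
  by split; [rewrite minC|move=> s /H].
Qed.

Lemma split_timeP p q : maxp p -> maxp q ->
  [/\ 0 <= split_time p q, split_time p q <= p.1, split_time p q <= q.1 &
      forall s, 0 <= s <= split_time p q -> p.2 s = q.2 s].
Proof.
move=> mp mq; have pa := maxp_arc mp; have qa := maxp_arc mq.
rewrite /split_time; set S := [set _ | _].
have p0 : 0 <= p.1 by case: pa.
have q0 : 0 <= q.1 by case: qa.
have S0 : S 0.
  split=> [|s]; first by rewrite lexx le_min p0.
  by move=> s0; rewrite (_ : s = 0) ?maxp_origin//; apply/eqP; rewrite eq_le andbC.
have hs : has_sup S by split; [exists 0|exists (Num.min p.1 q.1) => t [/andP[]]].
have st0 : 0 <= sup S by apply: sup_upper_bound.
have : sup S <= Num.min p.1 q.1 by apply: ge_sup; [exists 0|move=> t [/andP[]]].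
rewrite le_min => /andP[sp sq]; split => //.
move: st0; rewrite le_eqVlt => /orP[/eqP <- s s0|st0].
  by apply: S0.2.
apply: path_eq_before => // s /andP[s0 ss].
have [|t [_ tS] st] := @sup_gt _ S s _ ss; first by exists 0.
by apply: tS; rewrite s0 ltW.
Qed.

Lemma split_time_ge p q t : maxp p -> maxp q -> 0 <= t -> t <= p.1 -> t <= q.1 ->
  (forall s, 0 <= s <= t -> p.2 s = q.2 s) -> t <= split_time p q.
Proof.
move=> mp mq t0 tp tq pq; apply: sup_upper_bound.
  split; first by exists t; split => //; rewrite t0 le_min tp.
  by exists (Num.min p.1 q.1) => u [/andP[]].
by split => //; rewrite t0 le_min tp.
Qed.

Lemma finite_split_times p : finite_set (split_times M chi eps p).
Proof.
rewrite finite_setU; split; first exact: finite_set2.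
by apply: finite_image; exact: finite_maxp.
Qed.

Lemma split_times_itv p t : maxp p -> split_times M chi eps p t -> 0 <= t <= p.1.
Proof.
move=> mp; have [p0 _ _ _] := maxp_arc mp.
move=> [[->|->]|[q mq <-]]; rewrite ?lexx ?p0//.
by have [-> -> _ _] := split_timeP mp mq.
Qed.

Lemma next_split p a : maxp p -> a < p.1 -> exists b,
  [/\ split_times M chi eps p b, a < b &
      forall c, a < c < b -> ~ split_times M chi eps p c].
Proof.
move=> mp ap.
have [||b [bS ab] bmin] := @finite_set_min R (split_times M chi eps p `&` [set x | a < x]).
- exact/finite_setIl/finite_split_times.
- by exists p.1; split => //; left; right.
exists b; split => // c /andP[ac cb] cS.
by have := bmin c (conj cS ac); rewrite leNgt cb.
Qed.

Lemma branch_intro p a b : maxp p -> split_times M chi eps p a ->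
  split_times M chi eps p b -> a < b ->
  (forall c, a < c < b -> ~ split_times M chi eps p c) ->
  branches M chi eps (a, cut p b).
Proof. by move=> mp aS bS ab nS; exists p; split. Qed.

Lemma branch_at p s : maxp p -> 0 < s -> s <= p.1 -> exists k,
  [/\ branches M chi eps k, path_le k.2 p & bstart k < s <= bend k].
Proof.
move=> mp s0 sp.
have [||a [aS as_] amax] := @finite_set_max R (split_times M chi eps p `&` [set x | x < s]).
- exact/finite_setIl/finite_split_times.
- by exists 0; split => //; left; left.
have [b [bS ab nS]] := next_split mp (lt_le_trans as_ sp).
have sb : s <= b.
  by rewrite leNgt; apply/negP => bs; have := amax b (conj bS bs); rewrite leNgt ab.
exists (a, cut p b); split; first exact: branch_intro.
  by split => //=; have /andP[] := split_times_itv mp bS.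
by rewrite as_ sb.
Qed.

Lemma branchP k : branches M chi eps k ->
  [/\ is_arc_length_path k.2, 0 <= bstart k, bstart k < bend k & eps <= mass k.2].
Proof.
move=> [p [mp aS bS [ab nS] kE]].
have /andP[b0 bp] := split_times_itv mp bS; have /andP[a0 _] := split_times_itv mp aS.
split => //.
  by rewrite kE; apply: is_arc_length_cut; [exact: maxp_arc|rewrite b0].
apply: le_trans (maxp_mass mp) _; apply: (mass_prefix tN) => //.
by rewrite -[_.1]/(bend k) (le_lt_trans a0).
Qed.

Lemma finite_branches : finite_set (branches M chi eps).
Proof.
pose F p := [set (ab.1, cut p ab.2) |
  ab in split_times M chi eps p `*` split_times M chi eps p].
apply: (@sub_finite_set _ _ (\bigcup_(p in maxp) F p)).
  move=> k [p [mp aS bS _ kE]]; exists p => //; exists (bstart k, bend k) => //=.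
  by rewrite -kE; case: k {aS bS kE}.
apply: bigcup_finite => [|p mp]; first exact: finite_maxp.
by apply: finite_image; apply: finite_setX; exact: finite_split_times.
Qed.

(** A maximal path that follows an elementary branch beyond its start follows it to its end,
    since it could leave it at a splitting time only. *)
Lemma branch_unsplit k p t : branches M chi eps k -> maxp p -> bstart k < t ->
  t <= bend k -> path_le (cut k.2 t) p -> path_le k.2 p.
Proof.
move=> Bk mp at_ tb kp; have [p' [mp' aS bS [ab nS] kE]] := Bk.
have /andP[b0 bp'] := split_times_itv mp' bS; have /andP[a0 _] := split_times_itv mp' aS.
have t0 : 0 <= t by rewrite ltW// (le_lt_trans a0).
have tp : t <= p.1 by case: kp.
have tst : t <= split_time p' p.
  apply: split_time_ge => //; first exact: le_trans bp'.
  move=> s /andP[s0 st].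
  have st' : 0 <= s <= (cut k.2 t).1 by rewrite /= s0.
  have sb' : 0 <= s <= bend k by rewrite s0 (le_trans st).
  by rewrite -(path_le2 kp st') cut2 ?s0// kE cut2.
have [_ stp' stp agree] := split_timeP mp' mp.
have bst : bend k <= split_time p' p.
  rewrite leNgt; apply/negP => stb; apply: (nS (split_time p' p)).
    by rewrite stb (lt_le_trans at_).
  by right; exists p.
split; first by rewrite -[_.1]/(bend k) (le_trans bst).
rewrite {1}kE; apply/cut_eqP => s /andP[s0 sb].
by apply: agree; rewrite s0 (le_trans sb).
Qed.

(** If a maximal path leaves, at the end of the branch, the one from which the branch is cut,
    then one of these two leaves [p] there as well. *)
Lemma branch_end_split k p : branches M chi eps k -> maxp p -> path_le k.2 p ->
  bend k < p.1 -> split_times M chi eps p (bend k).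
Proof.
move=> Bk mp kp bp; have [p' [mp' aS bS [ab nS] kE]] := Bk.
have /andP[b0 bp'] := split_times_itv mp' bS; have /andP[a0 _] := split_times_itv mp' aS.
have agree s : 0 <= s <= bend k -> p'.2 s = p.2 s.
  by move=> sb; rewrite -(path_le2 kp)// kE cut2.
have bst : bend k <= split_time p' p by apply: split_time_ge => //; exact: ltW.
case: (bS) => [[bk0|bkp']|[p'' mp'' stb]].
- by move: (le_lt_trans a0 ab); rewrite bk0 ltxx.
- have : p' = p.
    apply: maxp_le => //; rewrite -(wf_cut (maxp_arc mp')) -bkp' -kE; exact: kp.
  by move=> pE; move: bp; rewrite bkp' pE ltxx.
have [_ _ s1 agree'] := split_timeP mp' mp''.
have [<-|ne] := eqVneq (split_time p p') (bend k); first by right; exists p'.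
have lt1 : bend k < split_time p' p.
  by rewrite lt_neqAle bst andbT eq_sym split_timeC.
right; exists p'' => //; apply/eqP; rewrite eq_le andbC; apply/andP; split.
  apply: split_time_ge => //; [exact: ltW|by rewrite -stb|].
  by move=> s sb; rewrite -(agree _ sb) agree'// stb.
rewrite leNgt; apply/negP => lt2.
have [_ c1 c2 cag] := split_timeP mp' mp.
have [_ e1 e2 eag] := split_timeP mp mp''.
pose t := Num.min (split_time p' p) (split_time p p'').
have bt : bend k < t by rewrite lt_min lt1.
have : t <= split_time p' p''.
  apply: split_time_ge => //.
  - by rewrite ltW// (le_lt_trans b0).
  - by rewrite ge_min c1.
  - by rewrite ge_min e2 orbT.
  move=> s /andP[s0]; rewrite le_min => /andP[h1 h2].
  by rewrite cag ?s0// eag// s0.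
by rewrite stb leNgt bt.
Qed.

(** A path that continues beyond the end of a branch does so along one of the successors of
    this branch, so that the induction over the tree follows every path. *)
Lemma successor_along k p : branches M chi eps k -> maxp p -> path_le k.2 p ->
  bend k < p.1 -> exists2 j, successors M chi eps k j & path_le j.2 p.
Proof.
move=> Bk mp kp bp; have bS := branch_end_split Bk mp kp bp.
have [c [cS bc nS]] := next_split mp bp.
have /andP[_ cp] := split_times_itv mp cS.
exists (bend k, cut p c) => //; split => //; first exact: branch_intro.
split; first exact: ltW.
by rewrite cut_cut ?(ltW bc)//; case: kp.
Qed.

Lemma branch_fluxE k s : branches M chi eps k -> 0 < s -> s <= bend k ->
  bflux M chi k s = mass (cut k.2 s).
Proof.
move=> Bk s0 sb; have [ka _ _ _] := branchP Bk.
rewrite /bflux /flux /mass /meas; congr (fine (leb _)).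
apply/seteqP; split => theta [Mt] /=.
  move=> [t t0]; rewrite /equiv_path (arc_path_of_path ka) ?(ltW s0)// => tE.
  split => //; exists t => //; rewrite lt_neqAle t0 andbT; apply/eqP => t_0.
  by move: s0; have := congr1 fst tE; rewrite /= -t_0 arc_length0 => <-; rewrite ltxx.
move=> [t t0 tE]; split => //; exists t; first exact: ltW.
by rewrite /equiv_path (arc_path_of_path ka) ?(ltW s0).
Qed.

Lemma branch_flux_mono k s t : branches M chi eps k -> 0 < s -> s <= t ->
  t <= bend k -> bflux M chi k t <= bflux M chi k s.
Proof.
move=> Bk s0 st tb; rewrite !branch_fluxE// ?(lt_le_trans s0)// ?(le_trans st)//.
by apply: (mass_prefix tN) => //; split => //=; rewrite cut_cut.
Qed.

Lemma branch_flux_ge k s : branches M chi eps k -> 0 < s -> s <= bend k ->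
  eps <= bflux M chi k s.
Proof.
move=> Bk s0 sb; rewrite branch_fluxE//; have [_ _ _ km] := branchP Bk.
by rewrite (le_trans km)//; apply: (mass_prefix tN).
Qed.

Lemma branch_flux_le k s : branches M chi eps k -> 0 < s -> s <= bend k ->
  bflux M chi k s <= M.
Proof. by move=> Bk s0 sb; rewrite branch_fluxE//; exact: (mass_le tN). Qed.

End BranchTree.

(** * The weight equation on one branch *)

Section MonotoneMeasurable.
Context {R : realType}.

Lemma nonincreasing_on_measurable (D : set R) (g : R -> R) : is_interval D ->
  (forall x y, D x -> D y -> x <= y -> g y <= g x) -> measurable_fun D g.
Proof.
move=> iD gD; apply: (measurability _ (RGenCInfty.measurableE R)).
move=> _ [_ [r ->] <-]; apply: is_interval_measurable.
move=> x y [Dx gx] [Dy gy] z xzy; have Dz := iD _ _ Dx Dy z xzy.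
split => //; move: gy; rewrite /= !in_itv/= !andbT => /le_trans; apply.
by apply: gD => //; have /andP[] := xzy.
Qed.

End MonotoneMeasurable.

Section WeightEquation.
Context {R : realType}.
Local Notation leb := (@lebesgue_measure R).
Variables (f : R -> R) (A B : R).
Hypothesis A0 : 0 <= A.
Hypothesis B0 : 0 <= B.
Hypothesis f_ge0 : forall z, 0 <= z -> 0 <= f z.
Hypothesis f_mono : forall x y, 0 <= x -> x <= y -> f x <= f y.
Hypothesis f_lin : forall z, 0 <= z -> f z <= A + B * z.

Variables (a b : R) (m : R -> R) (H wbar : R).
Hypothesis ab : a < b.
Hypothesis m_ge0 : forall t, a < t <= b -> 0 <= m t.
Hypothesis m_le : forall t, a < t <= b -> m t <= H.
Hypothesis m_mono : forall s t, a < s -> s <= t -> t <= b -> m t <= m s.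
Hypothesis wbar0 : 0 <= wbar.

Definition weight_eq (w : R -> R) : Prop := forall t, a < t <= b -> 0 <= w t /\
  ((w t)%:E = \int[leb]_(s in `[t, b]) (f (w s))%:E + (m t)%:E + wbar%:E)%E.

Section AnySolution.
Variable w : R -> R.
Hypothesis w_eq : weight_eq w.

Let w0 t : a < t -> t <= b -> 0 <= w t.
Proof. by move=> at_ tb; have [] := @w_eq t; rewrite ?at_. Qed.

Let fw0 t s : a < t -> `[t, b]%classic s -> (0 <= (f (w s))%:E)%E.
Proof.
move=> at_; rewrite /= in_itv/= lee_fin => /andP[ts sb]; apply: f_ge0.
by apply: w0 => //; exact: lt_le_trans ts.
Qed.

(** What the weight adds to the flux. Unlike the weight, it passes through the nodes of the
    tree additively. *)
Definition excess t : R := w t - m t.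

Lemma excessE t : a < t -> t <= b ->
  ((excess t)%:E = \int[leb]_(s in `[t, b]) (f (w s))%:E + wbar%:E)%E.
Proof.
move=> at_ tb; have [_ h] := @w_eq t (introT andP (conj at_ tb)).
have : (\int[leb]_(s in `[t, b]) (f (w s))%:E)%E \is a fin_num.
  rewrite ge0_fin_numE; last by apply: integral_ge0 => s; exact: fw0.
  by rewrite ltey; apply/eqP => hy; move: h; rewrite hy.
move: h; case: (\int[leb]_(s in _) _)%E => // r h _.
by move: h; rewrite -!EFinD => -[h]; congr EFin; rewrite /excess h; lra.
Qed.

Let w_mono s t : a < s -> s <= t -> t <= b -> w t <= w s.
Proof.
move=> as_ st tb; have at_ := lt_le_trans as_ st; have sb := le_trans st tb.
have : (excess t <= excess s)%R.
  rewrite -lee_fin !excessE// leeD2r//; apply: ge0_subset_integral_ae.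
    by apply: subset_itvr; rewrite bnd_simp.
  by move=> x; exact: fw0.
have := m_mono as_ st tb; rewrite /excess; lra.
Qed.

Let mfw s (D : set R) : a < s -> D `<=` `[s, b]%classic -> measurable D ->
  measurable_fun D (fun x => (f (w x))%:E).
Proof.
move=> as_ Ds mD; apply/measurable_EFinP.
apply: (@measurable_funS _ _ _ _ `[s, b]%classic) => //.
apply: nonincreasing_on_measurable; first exact: interval_is_interval.
move=> x y; rewrite /= !in_itv/= => /andP[sx xb] /andP[sy yb] xy.
apply: f_mono; first by apply: w0 => //; exact: lt_le_trans sy.
by apply: w_mono => //; exact: lt_le_trans sx.
Qed.

(** Both bounds come from the monotonicity of [w]. *)
Lemma excess_step s t : a < s -> s <= t -> t <= b ->
  (t - s) * f (w t) <= excess s - excess t <= (t - s) * f (w s).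
Proof.
move=> as_ st tb; have at_ := lt_le_trans as_ st; have sb := le_trans st tb.
have E : ((excess s - excess t)%:E = \int[leb]_(x in `[s, t[) (f (w x))%:E)%E.
  have : ((excess s)%:E = \int[leb]_(x in `[s, t[) (f (w x))%:E + (excess t)%:E)%E.
    rewrite !excessE// addeA; congr (_ + _)%E.
    have -> : (`[s, b] = `[s, t[ `|` `[t, b] :> set R)%classic.
      by rewrite (@itv_bndbnd_setU _ _ _ (BLeft t))// bnd_simp.
    rewrite ge0_integral_setU//=.
    - apply: (mfw as_) => //; last exact: measurableU.
      move=> x [] /=; rewrite !in_itv/= => /andP[h1 h2].
        by rewrite h1 (le_trans (ltW h2)).
      by rewrite h2 (le_trans st).
    - move=> x [] /=; rewrite !in_itv/= => /andP[h1 h2]; apply: (fw0 as_);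
        rewrite /= in_itv/=.
        by rewrite h1 (le_trans (ltW h2)).
      by rewrite h2 (le_trans st).
    - apply: lt_disjoint => x y; rewrite !in_itv/= => /andP[_ xt] /andP[ty _].
      exact: lt_le_trans ty.
  case: (\int[leb]_(x in _) _)%E => //= r.
  by rewrite -EFinD => -[->]; congr EFin; lra.
have cstE (c : R) : ((t - s) * c)%:E = (\int[leb]_(x in `[s, t[) c%:E)%E.
  rewrite integral_cst//= lebesgue_measure_itv/= lte_fin.
  move: st; rewrite le_eqVlt => /orP[/eqP ->|->].
    by rewrite ltxx mule0 subrr mul0r.
  by rewrite -EFinB -EFinM mulrC.
have sub x : `[s, t[%classic x -> s <= x /\ x <= t by rewrite /= in_itv/= => /andP[-> /ltW].
have fwx x : `[s, t[%classic x -> (0 <= (f (w x))%:E)%E.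
  move=> /sub[sx xt]; rewrite lee_fin; apply: f_ge0; apply: w0.
    exact: lt_le_trans sx.
  exact: le_trans tb.
have mst : measurable_fun `[s, t[ (fun x => (f (w x))%:E).
  apply: (mfw as_) => //; apply: subset_itvl; rewrite bnd_simp//.
rewrite -!lee_fin E !cstE; apply/andP; split; apply: ge0_le_integral_ae => //.
- by move=> x _; rewrite lee_fin f_ge0 ?w0.
- apply: aeW => x /sub[sx xt]; rewrite lee_fin; apply: f_mono; first exact: w0.
  by apply: w_mono => //; exact: lt_le_trans sx.
- by move=> x _; rewrite lee_fin f_ge0 ?w0.
- apply: aeW => x /sub[sx xt]; rewrite lee_fin; apply: f_mono.
    by apply: w0; [exact: lt_le_trans sx|exact: le_trans tb].
  by apply: w_mono => //; exact: le_trans tb.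
Qed.

Lemma excess_end : excess b = wbar.
Proof.
by apply: EFin_inj; rewrite excessE// set_itv1 integral_set1 add0e.
Qed.

Lemma excess_mono s t : a < s -> s <= t -> t <= b -> excess t <= excess s.
Proof.
move=> as_ st tb; have at_ := lt_le_trans as_ st.
have /andP[h _] := excess_step as_ st tb.
by rewrite -subr_ge0 (le_trans _ h)// mulr_ge0 ?subr_ge0// f_ge0// w0.
Qed.

Lemma excess_ge t : a < t -> t <= b -> wbar <= excess t.
Proof. by move=> at_ tb; rewrite -excess_end excess_mono. Qed.

(** A step of length at most [1 / (2 * (B + 1))] at most doubles the excess, up to a
    constant; the last step to the left end is of this kind. *)
Lemma excess_bounded : exists K, forall t, a < t -> t <= b -> excess t <= K.
Proof.
have B1 : 0 < 2 * (B + 1) by rewrite mulr_gt0// ltr_wpDl.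
pose h := (2 * (B + 1))^-1; have h0 : 0 < h by rewrite invr_gt0.
pose t0 := Num.min b (a + h).
have at0 : a < t0 by rewrite lt_min ab ltrDl.
have t0b : t0 <= b by rewrite ge_min lexx.
have t0h : t0 <= a + h by rewrite ge_min lexx orbT.
exists (2 * (excess t0 + A * h + H)) => t at_ tb.
have H0 : 0 <= H by apply: le_trans (m_ge0 (_ : a < b <= b)) (m_le _); rewrite ab lexx.
have e0 : 0 <= excess t0 by rewrite (le_trans wbar0)// excess_ge.
have Ah : 0 <= A * h by rewrite mulr_ge0// ltW.
have [tt0|/ltW t0t] := leP t t0; last first.
  by rewrite (le_trans (excess_mono at0 t0t tb))//; lra.
have /andP[_ st] := excess_step at_ tt0 t0b.
have wt : w t = excess t + m t by rewrite /excess subrK.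
have wt0 := w0 at_ tb.
have mt := m_le (_ : a < t <= b); rewrite at_ tb in mt; have {}mt := mt isT.
have th : t0 - t <= h by lra.
have t0t : 0 <= t0 - t by rewrite subr_ge0.
have Bh : B * h <= 2^-1.
  rewrite /h ler_pdivrMr//; lra.
have h1 : (t0 - t) * f (w t) <= h * (A + B * w t).
  by apply: ler_pM => //; [exact: f_ge0|exact: f_lin].
have h2 : B * h * w t <= 2^-1 * w t by rewrite ler_wpM2r.
lra.
Qed.

(** The weights and the fluxes enter the next branch by their right limits, which exist by
    monotonicity and boundedness. *)
Lemma excess_limit : exists l,
  [/\ excess t @[t --> a^'+] --> l, (forall t, a < t -> t <= b -> excess t <= l) &
      wbar <= l].
Proof.
have [K eK] := excess_bounded.
have mono : {in Interval (BRight a) (BRight b) &, nonincreasing_fun excess}.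
  move=> s t; rewrite !in_itv/= => /andP[as_ _] /andP[_ tb] st.
  exact: excess_mono.
have ub : has_ubound (excess @` [set` Interval (BRight a) (BRight b)]).
  by exists K => _ [t + <-]; rewrite /= in_itv/= => /andP[at_ tb]; exact: eK.
have ltb : (BRight a < BRight b)%O by rewrite bnd_simp.
have lim := nonincreasing_at_right_cvgr ltb mono ub.
exists (sup (excess @` [set` Interval (BRight a) (BRight b)])).
have le t : a < t -> t <= b -> excess t <= sup (excess @` [set` Interval (BRight a) (BRight b)]).
  move=> at_ tb; apply: sup_upper_bound.
    by split => //; exists (excess b), b => //; rewrite /= in_itv/= ab lexx.
  by exists t => //; rewrite /= in_itv/= at_ tb.
by split => //; rewrite -excess_end le.
Qed.

End AnySolution.

Lemma flux_limit : cvg (m t @[t --> a^'+]).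
Proof.
apply/cvg_ex; exists (sup (m @` [set` Interval (BRight a) (BRight b)])).
apply: nonincreasing_at_right_cvgr; first by rewrite bnd_simp.
  by move=> s t; rewrite !in_itv/= => /andP[as_ _] /andP[_ tb] st; exact: m_mono.
by exists H => _ [t + <-]; rewrite /= in_itv/= => /andP[at_ tb]; apply: m_le; rewrite at_.
Qed.

Hypothesis f_cont : {within `[0, +oo[, continuous f}.

Let K := H + wbar + A * (b - a).
(** A supersolution: the equation with [f] replaced by [A + B * z]. *)
Let S t := K * expR (B * (b - t)).

Let S_super t : a < t -> t <= b ->
  (\int[leb]_(s in `[t, b]) (A + B * S s)%:E + (H + wbar)%:E <= (S t)%:E)%E.
Proof.
move=> at_; rewrite le_eqVlt => /orP[/eqP ->|tb].
  rewrite set_itv1 integral_set1 add0e lee_fin /S /K subrr mulr0 expR0 mulr1.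
  by rewrite lerDl mulr_ge0// subr_ge0 ltW.
pose F s := A * s - S s.
have dF (s : R) : is_derive s 1 F (A + B * S s).
  rewrite /F /S; apply: is_derive_eq; rewrite /GRing.scale/=; ring.
have cS : continuous (fun s => A + B * S s).
  move=> s; apply: cvgD; first exact: cvg_cst.
  apply: cvgM; first exact: cvg_cst.
  apply: cvgM; first exact: cvg_cst.
  apply: (@continuous_comp _ _ _ (fun s => B * (b - s)) expR); last exact: continuous_expR.
  apply: cvgM; first exact: cvg_cst.
  by apply: cvgB; [exact: cvg_cst|exact: cvg_id].
have cF : continuous F.
  by move=> s; apply/differentiable_continuous/derivable1_diffP; have [] := dF s.
rewrite (@continuous_FTC2 _ (fun s => A + B * S s) F)//.
- rewrite -EFinB -EFinD lee_fin /F /S /K subrr mulr0 expR0 mulr1.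
  have : A * (b - t) <= A * (b - a) by rewrite ler_wpM2l// lerD2l lerN2 ltW.
  lra.
- exact: continuous_subspaceT.
- split; first by move=> s _; have [] := dF s.
  + exact: cvg_at_right_filter (cF t).
  + exact: cvg_at_left_filter (cF b).
- by move=> s _; rewrite derive1E; have [_ ->] := dF s.
Qed.

Fixpoint iterate (n : nat) : R -> R := match n with
  | 0%N => fun=> 0
  | n'.+1 => fun t =>
      fine (\int[leb]_(s in `[t, b]) (f (iterate n' s))%:E) + m t + wbar
  end.

Let H0 : 0 <= H.
Proof. by apply: le_trans (m_ge0 (_ : a < b <= b)) (m_le _); rewrite ab lexx. Qed.

Let S0 t : 0 <= S t.
Proof.
by rewrite /S mulr_ge0// ?expR_ge0// /K !addr_ge0// mulr_ge0// subr_ge0 ltW.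
Qed.

Let bounded_profile (w : R -> R) : Prop :=
  (forall t, a < t -> t <= b -> 0 <= w t <= S t) /\
  (forall s t, a < s -> s <= t -> t <= b -> w t <= w s).

Let profile_integral (w : R -> R) t : bounded_profile w -> a < t -> t <= b ->
  (0 <= \int[leb]_(s in `[t, b]) (f (w s))%:E)%E /\
  (\int[leb]_(s in `[t, b]) (f (w s))%:E + (H + wbar)%:E <= (S t)%:E)%E.
Proof.
move=> [wb _] at_ tb.
have wt s : `[t, b]%classic s -> 0 <= w s <= S s.
  by rewrite /= in_itv/= => /andP[ts sb]; apply: wb => //; exact: lt_le_trans ts.
have fw s : `[t, b]%classic s -> (0 <= (f (w s))%:E)%E.
  by move=> /wt/andP[ws _]; rewrite lee_fin f_ge0.
split; first exact: integral_ge0.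
apply: le_trans (S_super at_ tb); rewrite leeD2r//; apply: ge0_le_integral_ae => //.
  by move=> s _; rewrite lee_fin addr_ge0// mulr_ge0.
apply: aeW => s /wt/andP[ws sS]; rewrite lee_fin (le_trans (f_lin ws))//.
by rewrite lerD2l ler_wpM2l.
Qed.

Let iterateE n t : bounded_profile (iterate n) -> a < t -> t <= b ->
  ((iterate n.+1 t)%:E =
    \int[leb]_(s in `[t, b]) (f (iterate n s))%:E + (m t)%:E + wbar%:E)%E.
Proof.
move=> bn at_ tb; have [i0 iS] := profile_integral bn at_ tb.
have ifin : (\int[leb]_(s in `[t, b]) (f (iterate n s))%:E)%E \is a fin_num.
  rewrite ge0_fin_numE// ltey; apply/eqP => ii; move: iS; rewrite ii.
  by rewrite addye// leye_eq.
by rewrite -[in RHS](fineK ifin) -!EFinD.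
Qed.

Let iterate_profile n : bounded_profile (iterate n).
Proof.
elim: n => [|n IH]; first by split => [t|//]; rewrite /= lexx S0.
have [_ IHm] := IH; split => [t at_ tb|s t as_ st tb].
  have [i0 iS] := profile_integral IH at_ tb; have tab : a < t <= b by rewrite at_.
  apply/andP; split; rewrite -lee_fin (iterateE IH)//.
    by rewrite -addeA; apply: adde_ge0 => //; rewrite -EFinD lee_fin addr_ge0// m_ge0.
  by apply: le_trans iS; rewrite -addeA leeD2l// -EFinD lee_fin lerD2r m_le.
have at_ := lt_le_trans as_ st; have sb := le_trans st tb.
have aux (x y : \bar R) (r q : R) : (x <= y)%E -> r <= q -> (x + r%:E <= y + q%:E)%E.
  by move=> xy rq; apply: leeD.
rewrite -lee_fin !(iterateE IH)// -[leLHS]addeA -[leRHS]addeA -!EFinD; apply: aux; last by rewrite lerD2r m_mono.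
apply: ge0_subset_integral_ae; first by apply: subset_itvr; rewrite bnd_simp.
move=> x; rewrite /= in_itv/= => /andP[sx xb]; rewrite lee_fin f_ge0//.
by have /andP[] := IH.1 x (lt_le_trans as_ sx) xb.
Qed.

Let iterate_incr n t : a < t -> t <= b -> iterate n t <= iterate n.+1 t.
Proof.
elim: n t => [|n IH] t at_ tb.
  by have /andP[] := (iterate_profile 1).1 t at_ tb.
have it0 k x : `[t, b]%classic x -> 0 <= iterate k x.
  rewrite /= in_itv/= => /andP[tx xb].
  by have /andP[] := (iterate_profile k).1 x (lt_le_trans at_ tx) xb.
rewrite -lee_fin [leLHS](iterateE (iterate_profile n))//.
rewrite [leRHS](iterateE (iterate_profile n.+1))// leeD2r// leeD2r//.
apply: ge0_le_integral_ae => [x tx|x tx|]; [by rewrite lee_fin f_ge0// it0..|].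
apply: aeW => x tx; rewrite lee_fin f_mono ?it0//.
by move: tx; rewrite /= in_itv/= => /andP[tx xb]; apply: IH => //; exact: lt_le_trans tx.
Qed.

Let f_seq (u : nat -> R) (y : R) : (forall n, 0 <= u n) -> 0 <= y ->
  u n @[n --> \oo] --> y -> f (u n) @[n --> \oo] --> f y.
Proof.
move=> u0 y0 uy; have := @f_cont y; rewrite /continuous_at.
have yD : `[0, +oo[%classic y by rewrite /= in_itv/= y0.
rewrite [X in X -> _](_ : _ = (f @ within `[0, +oo[%classic (nbhs y) --> f y)); last first.
  by rewrite (nbhs_subspace_in yD).
move=> fy.
apply: (@cvg_comp _ _ _ u f _ _ _ _ fy) => P wP.
have H1 : \forall n \near \oo, `[0, +oo[%classic (u n) -> P (u n) := uy _ wP.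
apply: (@filterS _ \oo _ _ _ _ H1) => n; apply.
by rewrite /= in_itv/= andbT; exact: u0.
Qed.

(** Picard iteration from 0 stays below the supersolution [S] and increases to a solution. *)
Lemma weight_eq_exists : exists w, weight_eq w.
Proof.
pose w t := limn (fun n => iterate n t).
have cw t : a < t -> t <= b -> iterate n t @[n --> \oo] --> w t.
  move=> at_ tb; apply: nondecreasing_is_cvgn.
    by apply/nondecreasing_seqP => n; exact: iterate_incr.
  exists (S t) => _ [n _ <-].
  by have /andP[] := (iterate_profile n).1 t at_ tb.
have it0 n t : a < t -> t <= b -> 0 <= iterate n t.
  by move=> at_ tb; have /andP[] := (iterate_profile n).1 t at_ tb.
have w0 t : a < t -> t <= b -> 0 <= w t.
  move=> at_ tb; apply: limr_ge; first by apply/cvg_ex; exists (w t); exact: cw.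
  by near=> n; exact: it0.
exists w => t /andP[at_ tb]; split; first exact: w0.
have tbP x : `[t, b]%classic x -> a < x /\ x <= b.
  by rewrite /= in_itv/= => /andP[tx ->]; split => //; exact: lt_le_trans tx.
have cv : (\int[leb]_(s in `[t, b]) (f (iterate n s))%:E @[n --> \oo] -->
           \int[leb]_(s in `[t, b]) (f (w s))%:E)%E.
  have -> : (\int[leb]_(s in `[t, b]) (f (w s))%:E =
      \int[leb]_(s in `[t, b]) limn (fun n => (f (iterate n s))%:E))%E.
    apply: eq_integral => x /set_mem/tbP[ax xb]; apply/esym/cvg_lim => //.
    apply: cvg_EFin; first by near=> n.
    by apply: f_seq; [move=> n; exact: it0|exact: w0|exact: cw].
  apply: cvg_monotone_convergence => //.
  - move=> n; apply/measurable_EFinP; apply: nonincreasing_on_measurable.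
      exact: interval_is_interval.
    move=> x y /tbP[ax xb] /tbP[ay yb] xy; apply: f_mono; first exact: it0.
    exact: (iterate_profile n).2.
  - by move=> n x /tbP[ax xb]; rewrite lee_fin f_ge0// it0.
  - move=> x /tbP[ax xb]; apply/nondecreasing_seqP => n.
    by rewrite lee_fin f_mono ?it0// iterate_incr.
have l1 : ((iterate n.+1 t)%:E @[n --> \oo] --> (w t)%:E)%E.
  apply: cvg_EFin; first by near=> n.
  by have := cw t at_ tb; rewrite -(cvg_shiftS (fun n => iterate n t)).
have l2 : ((iterate n.+1 t)%:E @[n --> \oo] -->
    \int[leb]_(s in `[t, b]) (f (w s))%:E + (m t)%:E + wbar%:E)%E.
  rewrite -addeA; under eq_fun do rewrite (iterateE (iterate_profile _))// -addeA.
  apply: cvgeD => //; last exact: cvg_cst.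
  by apply: fin_num_adde_defl; rewrite -EFinD.
exact: (cvg_unique _ l1 l2).
Unshelve. all: by end_near. Qed.

End WeightEquation.

(** * Weights on the tree *)

Section TreeWeights.
Context {R : realType} {d : nat}.
Variables (M : R) (chi : R -> R -> 'rV[R]_d) (N : set (lebesgueR R)).
Local Notation leb := (@completed_lebesgue_measure R).
Local Notation path := (Defs.path R d).
Local Notation branch := (@Defs.branch R d).
Implicit Types (theta t : R) (p q : path) (k j : branch).

Hypothesis tN : tame_plan M chi N.
Variables (f : R -> R) (A B : R).
Hypothesis A0 : 0 <= A.
Hypothesis B0 : 0 <= B.
Hypothesis f_ge0 : forall z, 0 <= z -> 0 <= f z.
Hypothesis f_mono : forall x y, 0 <= x -> x <= y -> f x <= f y.
Hypothesis f_lin : forall z, 0 <= z -> f z <= A + B * z.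
Hypothesis f_cont : {within `[0, +oo[, continuous f}.
Variable eps : R.
Hypothesis eps0 : 0 < eps.

Local Notation mass := (mass M chi).
Local Notation Br := (branches M chi eps).
Local Notation succ := (successors M chi eps).
Local Notation fl := (bflux M chi).
Local Notation bw := (branch_weight f (@bstart R d) (@bend R d) fl succ).
Local Notation weq k := (weight_eq f (bstart k) (bend k) (fl k)).
Local Notation exc k w := (excess (fl k) w).

Section OneBranch.
Variable k : branch.
Hypothesis Bk : Br k.

Lemma bstart_ge0 : 0 <= bstart k. Proof. by case: (branchP tN eps0 Bk). Qed.

Lemma bstart_lt_bend : bstart k < bend k. Proof. by case: (branchP tN eps0 Bk). Qed.

Let pos t : bstart k < t -> 0 < t. Proof. exact: le_lt_trans bstart_ge0. Qed.

Lemma fl_ge t : bstart k < t -> t <= bend k -> eps <= fl k t.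
Proof. by move=> at_ tb; apply: (branch_flux_ge tN eps0) => //; exact: pos. Qed.

Lemma fl_ge0 t : bstart k < t <= bend k -> 0 <= fl k t.
Proof. by move=> /andP[at_ tb]; rewrite (le_trans (ltW eps0))// fl_ge. Qed.

Lemma fl_le t : bstart k < t <= bend k -> fl k t <= M.
Proof. by move=> /andP[at_ tb]; apply: (branch_flux_le tN eps0 Bk) => //; exact: pos. Qed.

Lemma fl_mono s t : bstart k < s -> s <= t -> t <= bend k -> fl k t <= fl k s.
Proof. by move=> as_ st tb; apply: (branch_flux_mono tN eps0 Bk) => //; exact: pos. Qed.

Lemma branch_eq_exists wbar : 0 <= wbar -> exists w, weq k wbar w.
Proof.
move=> wb; exact: (weight_eq_exists A0 B0 f_ge0 f_mono f_lin bstart_lt_bend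
  fl_ge0 fl_le fl_mono wb f_cont).
Qed.

Variables (wbar : R) (w : R -> R).
Hypothesis wbar0 : 0 <= wbar.
Hypothesis kw : weq k wbar w.

Lemma branch_excess_step s t : bstart k < s -> s <= t -> t <= bend k ->
  (t - s) * f (w t) <= exc k w s - exc k w t.
Proof.
move=> as_ st tb.
have := excess_step f_ge0 f_mono fl_mono kw as_ st tb.
by move=> /andP[].
Qed.

Lemma branch_excess_end : exc k w (bend k) = wbar.
Proof. exact: (excess_end f_ge0 bstart_lt_bend kw). Qed.

Lemma branch_excess_ge t : bstart k < t -> t <= bend k -> wbar <= exc k w t.
Proof. exact: (excess_ge f_ge0 f_mono bstart_lt_bend fl_mono kw). Qed.

Lemma branch_excess_limit : exists l,
  [/\ exc k w t @[t --> (bstart k)^'+] --> l,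
      (forall t, bstart k < t -> t <= bend k -> exc k w t <= l) & wbar <= l].
Proof.
exact: (excess_limit A0 B0 f_ge0 f_mono f_lin bstart_lt_bend fl_ge0 fl_le fl_mono wbar0 kw).
Qed.

Lemma branch_flux_cvg : cvg (fl k t @[t --> (bstart k)^'+]).
Proof. exact: (flux_limit bstart_lt_bend fl_le fl_mono). Qed.

Lemma branch_weight_ge t : bstart k < t -> t <= bend k -> fl k t <= w t.
Proof.
move=> at_ tb; have := branch_excess_ge at_ tb; rewrite /excess.
move: wbar0; lra.
Qed.

End OneBranch.

Lemma succ_branch k j : succ k j -> Br j. Proof. by case. Qed.

Lemma finite_succ k : finite_set (succ k).
Proof. by apply: sub_finite_set (finite_branches tN eps0) => j []. Qed.

(** The terminal datum of a branch is the sum of the initial excesses of its successors;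
    in particular it is nonnegative. *)
Lemma end_weight_excess k (W : branch -> R -> R) (wb l : branch -> R) :
  (forall j, succ k j -> 0 <= wb j /\ weq j (wb j) (W j)) ->
  (forall j, succ k j -> exc j (W j) t @[t --> (bstart j)^'+] --> l j) ->
  end_weight (@bstart R d) fl succ W k = \sum_(j \in succ k) l j.
Proof.
move=> HW Hl; rewrite /end_weight !fsbig_finite//=; [|exact: finite_succ..].
rewrite -sumrB; apply: eq_big_seq => j.
rewrite in_fset_set ?inE; last exact: finite_succ.
move=> Sj; have Bj := succ_branch Sj.
have cm := branch_flux_cvg Bj.
have cW : W j t @[t --> (bstart j)^'+] --> l j + lim (fl j t @[t --> (bstart j)^'+]).
  rewrite (_ : W j = fun t => exc j (W j) t + fl j t).
    by apply: cvgD => //; exact: Hl.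
  by apply/funext => t; rewrite /excess subrK.
by rewrite (cvg_lim _ cW)// addrK.
Qed.

Lemma fsum_ge0 (T : choiceType) (D : set T) (F : T -> R) : finite_set D ->
  (forall x, D x -> 0 <= F x) -> 0 <= \sum_(x \in D) F x.
Proof.
move=> Df F0; rewrite fsbig_finite//= big_seq; apply: sumr_ge0 => x.
by rewrite in_fset_set// inE; exact: F0.
Qed.

Lemma branch_weight_solves k w : bw k w -> Br k -> exists2 wbar, 0 <= wbar & weq k wbar w.
Proof.
elim => {}k {}w W _ IH sol Bk.
have /choice[wb wbP] : forall j, exists x, succ k j -> 0 <= x /\ weq j x (W j).
  move=> j; have [Sj|nS] := pselect (succ k j); last by exists 0.
  by have [x x0 jx] := IH j Sj (succ_branch Sj); exists x.
have /choice[l lP] : forall j, exists x, succ k j ->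
    exc j (W j) t @[t --> (bstart j)^'+] --> x /\ 0 <= x.
  move=> j; have [Sj|nS] := pselect (succ k j); last by exists 0.
  have [wb0 jw] := wbP j Sj.
  have [x [cx _ wx]] := branch_excess_limit (succ_branch Sj) wb0 jw.
  by exists x => _; split => //; exact: le_trans wx.
exists (end_weight (@bstart R d) fl succ W k) => //.
rewrite (end_weight_excess wbP (fun j Sj => (lP j Sj).1)).
by apply: fsum_ge0; [exact: finite_succ|move=> j /lP[]].
Qed.

(** Successors end later. A branch without weight that ends last among all such branches
    would have successors with weights. *)
Lemma branch_weight_exists k : Br k -> exists w, bw k w.
Proof.
move=> Bk; apply: contrapT => nw.
pose bad := [set j | Br j /\ ~ exists w, bw j w].
have [||_ [j [Bj nj] <-] jmax] := @finite_set_max R [set bend j | j in bad].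
- apply: finite_image; apply: sub_finite_set (finite_branches tN eps0).
  by move=> j [].
- by exists (bend k), k.
apply: nj.
have good i : succ j i -> exists w, bw i w.
  move=> Si; apply: contrapT => ni; have Bi := succ_branch Si.
  have : bend i <= bend j by apply: jmax; exists i.
  have [_ ij _] := Si; have := bstart_lt_bend Bi; rewrite ij => h.
  by rewrite leNgt h.
have /choice[W WP] : forall i, exists w, succ j i -> bw i w.
  move=> i; have [Si|nS] := pselect (succ j i); last by exists (fun=> 0).
  by have [w iw] := good i Si; exists w.
have /choice[wb wbP] : forall i, exists x, succ j i -> 0 <= x /\ weq i x (W i).
  move=> i; have [Si|nS] := pselect (succ j i); last by exists 0.
  by have [x x0 ix] := branch_weight_solves (WP i Si) (succ_branch Si); exists x.
have /choice[l lP] : forall i, exists x, succ j i ->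
    exc i (W i) t @[t --> (bstart i)^'+] --> x /\ 0 <= x.
  move=> i; have [Si|nS] := pselect (succ j i); last by exists 0.
  have [wb0 iw] := wbP i Si.
  have [x [cx _ wx]] := branch_excess_limit (succ_branch Si) wb0 iw.
  by exists x => _; split => //; exact: le_trans wx.
have ew0 : 0 <= end_weight (@bstart R d) fl succ W j.
  rewrite (end_weight_excess wbP (fun i Si => (lP i Si).1)).
  by apply: fsum_ge0; [exact: finite_succ|move=> i /lP[]].
have [w wsol] := branch_eq_exists Bj ew0.
by exists w; apply: (BranchWeight WP).
Qed.

Lemma path_weight_spec p s : max_good_path M chi eps p -> 0 < s -> s <= p.1 ->
  exists k w, [/\ Br k, path_le k.2 p, bstart k < s <= bend k, bw k w &
    path_weight M chi f eps p s = w s].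
Proof.
move=> mp s0 sp; rewrite /path_weight; set X := [set _ | _].
have [k [Bk kp ks]] := branch_at tN eps0 mp s0 sp.
have [w kw] := branch_weight_exists Bk.
have [k' [w' [h1 h2 h3 h4 h5]]] : X (xget 0 X) by apply: (@xgetPex _ 0 X); exists (w s), k, w.
by exists k', w'.
Qed.

(** At a point of a fibre with mass at least [eps], the weight at level [eps] is the value of
    an actual solution on the branch that contains this point. *)
Lemma weight_eps_spec theta t (q := arc_path (chi theta) t) :
  Theta0 M N theta -> 0 <= t -> 0 < q.1 -> eps <= mass q ->
  exists k w, [/\ Br k, bstart k < q.1 <= bend k, cut k.2 q.1 = q, bw k w &
    weight_eps M chi f eps theta t = w q.1].
Proof.
move=> Tt t0 q0 qm; have [gL g0 _] := tame_fiber tN Tt.1 Tt.2.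
have qa : is_arc_length_path q by exact: arc_path_is_arc_length.
rewrite /weight_eps ifT; last first.
  by apply: ereal_sup_ubound; exists t.
set X := [set _ | _].
have [p mp qp] := good_extends tN eps0 qa q0 qm.
have pa := maxp_arc mp.
have [p' [s [mp' /andP[s0 sp] tp' ->]]] : X (xget 0 X).
  apply: (@xgetPex _ 0 X); exists (path_weight M chi f eps p q.1), p, q.1; split => //.
    by rewrite (ltW q0); case: qp.
  rewrite /equiv_path (arc_path_of_path pa); last by rewrite (ltW q0); case: qp.
  by case: qp => _ <-.
have pa' := maxp_arc mp'.
have qE : q = cut p' s.
  by move: tp'; rewrite /equiv_path (arc_path_of_path pa') ?s0.
have sE : s = q.1 by rewrite qE.
have sp' : q.1 <= p'.1 by rewrite -sE.
have [k [w [Bk kp ks kw wE]]] := path_weight_spec mp' q0 sp'.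
have kq : cut k.2 q.1 = q.
  have h : q.1 <= k.2.1 by have /andP[] := ks.
  by rewrite (path_le_cutE h kp) -sE -qE.
by exists k, w; split; [exact: Bk|exact: ks|exact: kq|exact: kw|rewrite sE; exact: wE].
Qed.

End TreeWeights.

(** * A lower bound for the weight by the potential of tips *)

Section Comparison.
Context {R : realType} {d : nat}.
Variables (M : R) (chi : R -> R -> 'rV[R]_d) (N : set (lebesgueR R)).
Local Notation path := (Defs.path R d).
Local Notation branch := (@Defs.branch R d).
Implicit Types (s t : R) (p q : path) (k j : branch).

Hypothesis tN : tame_plan M chi N.
Variables (f : R -> R) (A B : R).
Hypothesis A0 : 0 <= A.
Hypothesis B0 : 0 <= B.
Hypothesis f_ge0 : forall z, 0 <= z -> 0 <= f z.
Hypothesis f_mono : forall x y, 0 <= x -> x <= y -> f x <= f y.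
Hypothesis f_lin : forall z, 0 <= z -> f z <= A + B * z.
Variable eps : R.
Hypothesis eps0 : 0 < eps.

Local Notation mass := (mass M chi).
Local Notation Br := (branches M chi eps).
Local Notation succ := (successors M chi eps).
Local Notation fl := (bflux M chi).
Local Notation bw := (branch_weight f (@bstart R d) (@bend R d) fl succ).
Local Notation weq k := (weight_eq f (bstart k) (bend k) (fl k)).
Local Notation exc k w := (excess (fl k) w).

Variables (n : nat) (Q : 'I_n -> path) (x : 'I_n -> 'rV[R]_d) (r c : R) (z : R -> R).
Hypothesis Qa : forall i, is_arc_length_path (Q i).
Hypothesis Qm : forall i, eps <= mass (Q i).
Hypothesis Q0 : forall i, 0 < (Q i).1.
Hypothesis c0 : 0 < c.
Hypothesis r0 : 0 < r.
Hypothesis Qx : forall i t, 0 <= t -> (Q i).1 - c <= t -> t <= (Q i).1 ->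
  enorm ((Q i).2 t - x i) <= r.
Hypothesis xsep : forall i i' : 'I_n, i != i' -> 4 * r <= enorm (x i - x i').
Hypothesis z0 : z 0 = 0.
Hypothesis z_mono : forall s t, 0 <= s -> s <= t -> z s <= z t.
Hypothesis z_cont : continuous z.
Variable d0 : R.
Hypothesis d00 : 0 < d0.
Hypothesis z_step : forall y h, 0 <= y -> y <= c -> 0 <= h -> h <= d0 ->
  z (y + h) <= z y + h * f (eps + z y).

(** The length of the [i]-th tip, of total length [c] at the end of [Q i], that lies ahead of
    the path [q]. *)
Definition overlap i q : R :=
  if `[< path_le q (Q i) >] then Num.min ((Q i).1 - q.1) c else 0.

Definition potential q : R := \sum_i z (overlap i q).

Lemma overlap_ge0 i q : 0 <= overlap i q.
Proof.
rewrite /overlap; case: ifPn => // /asboolP[qQ _].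
by rewrite le_min subr_ge0 qQ ltW.
Qed.

Lemma overlap_le i q : overlap i q <= c.
Proof. by rewrite /overlap; case: ifPn => _; rewrite ?ge_min ?lexx ?orbT// ltW. Qed.

Lemma zov_ge0 i q : 0 <= z (overlap i q).
Proof. by rewrite -z0 z_mono// overlap_ge0. Qed.

Lemma potential_ge0 q : 0 <= potential q.
Proof. by apply: sumr_ge0 => i _; exact: zov_ge0. Qed.

(** Going back along a branch, the part of a tip still ahead can grow only while the branch
    runs close to [x i]; otherwise the tip is complete already, or the path [Q i] does not
    follow the branch. *)
Lemma overlap_step k s t i : Br k -> bstart k < s -> s <= t -> t <= bend k ->
  overlap i (cut k.2 s) <= overlap i (cut k.2 t) \/
  overlap i (cut k.2 s) <= overlap i (cut k.2 t) + (t - s) /\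
    enorm (k.2.2 t - x i) <= r + (t - s).
Proof.
move=> Bk as_ st tb.
have [ka a0 _ _] := branchP tN eps0 Bk.
have s0 : 0 <= s by rewrite ltW// (le_lt_trans a0).
have t0 : 0 <= t := le_trans s0 st.
have [/asboolP sQ|sQ] := boolP `[< path_le (cut k.2 s) (Q i) >]; last first.
  by left; rewrite {1}/overlap (negbTE sQ) overlap_ge0.
have [p mp Qp] := good_extends tN eps0 (Qa i) (Q0 i) (Qm i).
have kp : path_le k.2 p.
  by apply: (branch_unsplit tN eps0 Bk mp as_ (le_trans st tb)); exact: path_leT Qp.
have tp : path_le (cut k.2 t) p by apply: path_leT kp; split.
have sQ1 : s <= (Q i).1 by case: sQ.
rewrite {1 3}/overlap asboolT//=.
have [tQ|Qt] := leP t (Q i).1.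
  have tQ' : path_le (cut k.2 t) (Q i) by exact: path_le_common tp Qp tQ.
  rewrite /overlap asboolT//=.
  have [cQ|Qc] := leP c ((Q i).1 - t); first by left; rewrite ge_min lexx orbT.
  right; split; first by rewrite ge_min; apply/orP; left; lra.
  have -> : k.2.2 t = (Q i).2 t.
    by rewrite -(path_le2 tQ') ?cut2 ?t0 ?lexx//= t0 lexx.
  have Qct : (Q i).1 - c <= t by lra.
  have := Qx t0 Qct tQ; lra.
right; split.
  rewrite {1}/overlap asboolF ?add0r; last first.
    by move=> [/=]; rewrite leNgt Qt.
  by rewrite ge_min; apply/orP; left; lra.
have Q1 := ltW (Q0 i).
have Q1k : 0 <= (Q i).1 <= k.2.1 by rewrite Q1 (le_trans (ltW Qt)).
have kQ : k.2.2 (Q i).1 = (Q i).2 (Q i).1.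
  by rewrite (path_le2 kp Q1k) (path_le2 Qp)// Q1 lexx.
have h1 := enorm_distD (k.2.2 t) (k.2.2 (Q i).1) (x i).
have h2 : enorm (k.2.2 t - k.2.2 (Q i).1) <= t - (Q i).1.
  have tk : 0 <= t <= k.2.1 by rewrite t0.
  have := path_lip ka tk Q1k; rewrite ger0_norm ?subr_ge0//; exact: ltW.
have Qc : (Q i).1 - c <= (Q i).1 by rewrite gerBl ltW.
have h3 := Qx Q1 Qc (lexx _).
rewrite kQ in h1 h2; lra.
Qed.

(** The points [x i] are so far apart that at most one overlap grows. *)
Lemma potential_step k s t : Br k -> bstart k < s -> s <= t -> t <= bend k ->
  t - s < r -> t - s <= d0 ->
  potential (cut k.2 s) <= potential (cut k.2 t) + (t - s) * f (eps + potential (cut k.2 t)).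
Proof.
move=> Bk as_ st tb tsr tsd.
have ts0 : 0 <= t - s by rewrite subr_ge0.
have P0 := potential_ge0 (cut k.2 t).
have fP : 0 <= (t - s) * f (eps + potential (cut k.2 t)).
  by rewrite mulr_ge0// f_ge0// addr_ge0// ltW.
have [H|] := pselect (forall i, overlap i (cut k.2 s) <= overlap i (cut k.2 t)).
  rewrite (@le_trans _ _ (potential (cut k.2 t)))// ?lerDl//.
  by apply: ler_sum => i _; rewrite z_mono ?overlap_ge0.
move=> /existsNP[i0 /negP Hi0].
have [Hi|[ov_i near_i]] := overlap_step i0 Bk as_ st tb; first by rewrite Hi in Hi0.
have others i : i != i0 -> overlap i (cut k.2 s) <= overlap i (cut k.2 t).
  move=> ii0; have [//|[_ near_j]] := overlap_step i Bk as_ st tb.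
  have := xsep ii0; have := enorm_distD (x i) (k.2.2 t) (x i0).
  rewrite (enormC (x i) (k.2.2 t)); lra.
have pE q : potential q = z (overlap i0 q) + \sum_(i < n | i != i0) z (overlap i q).
  by rewrite /potential (bigD1 i0).
rewrite [leLHS]pE [X in _ <= X + _]pE [leRHS]addrAC lerD//; last first.
  by apply: ler_sum => i ii0; rewrite z_mono ?overlap_ge0 ?others.
rewrite (le_trans (z_mono (overlap_ge0 _ _) ov_i))//.
rewrite (le_trans (z_step (overlap_ge0 _ _) (overlap_le _ _) ts0 tsd))// lerD2l ler_wpM2l//.
apply: f_mono; first by rewrite addr_ge0 ?zov_ge0// ltW.
rewrite lerD2l pE lerDl sumr_ge0// => i _; exact: zov_ge0.
Qed.

(** Each path [Q i] that continues beyond the branch follows exactly one chosen successor, so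
    that the terms of the potential are distributed among the successors. *)
Lemma potential_end k (l : branch -> R) : Br k ->
  (forall j, succ k j -> forall t, bstart j < t -> t <= bend j ->
     potential (cut j.2 t) <= l j) ->
  potential k.2 <= \sum_(j \in succ k) l j.
Proof.
move=> Bk Hl; have [ka a0 ab _] := branchP tN eps0 Bk.
have l0 j : succ k j -> 0 <= l j.
  move=> Sj; have [_ _ abj _] := branchP tN eps0 (succ_branch Sj).
  by apply: le_trans (Hl j Sj _ abj (lexx _)); exact: potential_ge0.
pose P i := `[< path_le k.2 (Q i) /\ bend k < (Q i).1 >].
have /choice[J JP] : forall i, exists j, P i -> succ k j /\
    forall t, bstart j < t -> t <= bend j -> t <= (Q i).1 -> path_le (cut j.2 t) (Q i).
  move=> i; have [/asboolP[kQ bQ]|nP] := boolP (P i); last by exists k.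
  have [p mp Qp] := good_extends tN eps0 (Qa i) (Q0 i) (Qm i).
  have [j Sj jp] := successor_along tN eps0 Bk mp (path_leT kQ Qp) (lt_le_trans bQ Qp.1).
  exists j => _; split => // t _ tb tQ.
  have jtp : path_le (cut j.2 t) p by apply: path_leT jp; split.
  exact: path_le_common jtp Qp tQ.
rewrite fsbig_finite; last exact: (finite_succ tN eps0).
set S := (X in \sum_(_ <- X) _); rewrite /=.
have SP j : (j \in S) = `[< succ k j >].
  by rewrite in_fset_set; [apply/idP/asboolP; rewrite inE|exact: (finite_succ tN eps0)].
have -> : potential k.2 = \sum_(i | P i) z (overlap i k.2).
  rewrite /potential big_mkcond [RHS]big_mkcond/=; apply: eq_bigr => i _.
  case: ifPn => // /asboolPn nP; rewrite /overlap.
  case: ifPn => // /asboolP kQ; rewrite (_ : (Q i).1 - k.2.1 = 0); last first.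
    apply/eqP; rewrite subr_eq0 eq_le kQ.1 andbT leNgt; apply/negP => bQ.
    by apply: nP.
  by rewrite min_l ?z0// ltW.
have -> : \sum_(i | P i) z (overlap i k.2) =
    \sum_(i | P i) \sum_(j <- S) (if J i == j then z (overlap i k.2) else 0).
  apply: eq_bigr => i /JP[Si _].
  rewrite -big_mkcond/= (big_rem (J i))/= ?SP ?asboolT// eqxx big1_seq ?addr0//.
  by move=> j /andP[/eqP <-]; rewrite mem_rem_uniqF// /S finmap.fset_uniq.
rewrite exchange_big/= big_seq [leRHS]big_seq; apply: ler_sum => j.
rewrite SP => /asboolP Sj; have [Bj jb _] := Sj.
have [_ _ abj _] := branchP tN eps0 Bj.
pose h t := \sum_(i | P i) (if J i == j then z (Num.min ((Q i).1 - t) c) else 0).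
have -> : \sum_(i | P i) (if J i == j then z (overlap i k.2) else 0) = h (bstart j).
  apply: eq_bigr => i Pi; case: ifP => // _; rewrite /overlap.
  by have /asboolP[kQ _] := Pi; rewrite asboolT// jb.
have ch : continuous h.
  have add_cont : continuous (fun y : R * R => y.1 + y.2) by exact: add_continuous.
  apply: (continuous_big add_cont).
  move=> i Pi t; case: (J i == j); last exact: cvg_cst.
  apply: (@continuous_comp _ _ _ (fun t => Num.min ((Q i).1 - t) c) z); last exact: z_cont.
  apply: (@continuous_min _ _ (fun t => (Q i).1 - t) (cst c)); last exact: cvg_cst.
  by apply: cvgB; [exact: cvg_cst|exact: cvg_id].
have hlim : h t @[t --> (bstart j)^'+] --> h (bstart j) by apply: cvg_at_right_filter; exact: ch.
apply: (ler_cvg_to hlim (cvg_cst (l j))).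
have nQ : \forall t \near (bstart j)^'+, forall i, P i -> t <= (Q i).1.
  apply: filter_forall => i; have [/asboolP[_ bQ]|_] := boolP (P i); last exact: nearW.
  by near=> t => _; near: t; apply: nbhs_right_le; rewrite jb.
near=> t; have at_ : bstart j < t by near: t; exact: nbhs_right_gt.
have tb : t <= bend j by near: t; exact: nbhs_right_le.
have tQ : forall i, P i -> t <= (Q i).1 by near: t.
apply: le_trans (Hl j Sj t at_ tb); rewrite /h /potential big_mkcond/=.
apply: ler_sum => i _; case: ifPn => [Pi|_]; last exact: zov_ge0.
case: ifPn => [/eqP Jj|_]; last exact: zov_ge0.
have [_ jQ] := JP i Pi; rewrite Jj in jQ.
by rewrite /overlap asboolT//; exact: jQ at_ tb (tQ i Pi).
Unshelve. all: by end_near. Qed.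

(** Backward induction over the tree, and on each branch over short steps of equal length
    from its end: on a step, the potential grows by at most the length of the step times [f]
    of the weight, and the excess by at least that ([potential_step], [branch_excess_step]). *)
Lemma potential_le_excess k w : bw k w -> Br k -> forall t, bstart k < t ->
  t <= bend k -> potential (cut k.2 t) <= exc k w t.
Proof.
elim => {}k {}w W WP IH sol Bk.
have [ka a0 ab _] := branchP tN eps0 Bk.
have /choice[wb wbP] : forall j, exists y, succ k j -> 0 <= y /\ weq j y (W j).
  move=> j; have [Sj|nS] := pselect (succ k j); last by exists 0.
  have [y y0 jy] := branch_weight_solves tN A0 B0 f_ge0 f_mono f_lin eps0 (WP j Sj) (succ_branch Sj).
  by exists y.
have /choice[l lP] : forall j, exists y, succ k j ->
    exc j (W j) t @[t --> (bstart j)^'+] --> y /\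
    forall t, bstart j < t -> t <= bend j -> exc j (W j) t <= y.
  move=> j; have [Sj|nS] := pselect (succ k j); last by exists 0.
  have [wb0 jw] := wbP j Sj.
  have [y [cy ly _]] := branch_excess_limit tN A0 B0 f_ge0 f_mono f_lin eps0 (succ_branch Sj) wb0 jw.
  by exists y.
have ewE := end_weight_excess tN eps0 wbP (fun j Sj => (lP j Sj).1).
have endP : potential k.2 <= end_weight (@bstart R d) fl succ W k.
  rewrite ewE; apply: potential_end => // j Sj t at_ tb.
  apply: le_trans (IH j Sj (succ_branch Sj) t at_ tb) _.
  exact: (lP j Sj).2.
have ew0 : 0 <= end_weight (@bstart R d) fl succ W k.
  exact: le_trans (potential_ge0 _) endP.
move=> t at_ tb.
have m0 : 0 < Num.min r d0 by rewrite lt_min r0.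
have T0 : 0 <= bend k - t by rewrite subr_ge0.
have [m mP] : exists m, (bend k - t) / m.+1%:R < Num.min r d0.
  have T1 : 0 < bend k - t + 1 by rewrite ltr_wpDl.
  have [m ml] := exists_natSinv_lt (divr_gt0 m0 T1).
  exists m; rewrite ltr_pdivlMr// in ml; apply: le_lt_trans ml.
  by rewrite mulrC ler_pM2l ?invr_gt0// lerDl.
set h := _ / _ in mP; have h0 : 0 <= h by rewrite /h divr_ge0.
have [hr hd] : h < r /\ h < d0 by move: mP; rewrite lt_min => /andP[].
have hT (i : nat) : (i <= m.+1)%N -> t <= bend k - i%:R * h.
  move=> im; have : i%:R * h <= m.+1%:R * h by rewrite ler_wpM2r// ler_nat.
  have -> : m.+1%:R * h = bend k - t by rewrite /h mulrC divfK// pnatr_eq0.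
  lra.
suff H i : (i <= m.+1)%N -> potential (cut k.2 (bend k - i%:R * h)) <= exc k w (bend k - i%:R * h).
  have := H m.+1 (leqnn _).
  by rewrite (_ : bend k - m.+1%:R * h = t)// /h mulrC divfK ?pnatr_eq0//; lra.
elim: i => [_|i IHi im].
  rewrite mul0r subr0 (branch_excess_end tN f_ge0 eps0 Bk sol).
  by rewrite (wf_cut ka).
have {}IHi := IHi (ltnW im).
have := hT _ im; have := hT _ (ltnW im).
have -> : bend k - i.+1%:R * h = bend k - i%:R * h - h by rewrite -natr1; lra.
move: IHi; set v := bend k - i%:R * h => IHi tv tvh.
have av : bstart k < v - h by exact: lt_le_trans tvh.
have vh : v - h <= v by lra.
have vb : v <= bend k by rewrite /v gerBl mulr_ge0.
have vE : v - (v - h) = h by lra.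
have P0 := potential_ge0 (cut k.2 v).
have := potential_step Bk av vh vb; rewrite vE => /(_ hr (ltW hd)) st.
have := branch_excess_step tN f_ge0 f_mono eps0 Bk sol av vh vb; rewrite vE => ex.
have wv : eps + potential (cut k.2 v) <= w v.
  have e := fl_ge tN eps0 Bk (lt_le_trans av vh) vb.
  by apply: le_trans (lerD e IHi) _; rewrite /excess addrC subrK.
have : h * f (eps + potential (cut k.2 v)) <= h * f (w v).
  apply: ler_wpM2l; first exact: h0.
  by apply: f_mono wv; apply: addr_ge0 P0; exact: ltW.
move=> hf; apply: (le_trans st); apply: (le_trans (lerD IHi hf)).
by rewrite -lerBrDl.
Qed.

End Comparison.

(** * Endpoints and last exits of fibres *)

Section NullSets.
Context {R : realType} {d : nat}.
Local Notation leb := (@completed_lebesgue_measure R).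

Lemma null_cover (A : set R) : leb A = 0%E ->
  exists B : set (lebesgueR R), [/\ measurable B, leb B = 0%E & A `<=` B].
Proof.
move=> A0; have /negligible_outer_measure[B [mB B0 AB]] : ((wlength (@idfun R))^*)%mu A = 0%E.
  exact: A0.
by exists B; split => //; exact: sub_caratheodory.
Qed.

(** Each point off the support lies in a null ball with rational centre and radius, and there
    are countably many such balls. *)
Lemma null_off_support (mu : {finite_measure set (borelR R d) -> \bar R}) :
  exists V : set (borelR R d),
    [/\ measurable V, mu V = 0%E & forall x, ~ msupp mu x -> V x].
Proof.
pose b (i : 'rV[rat]_d * nat) : set 'rV[R]_d :=
  interior (ball (map_mx ratr i.1 : 'rV[R]_d) i.2.+1%:R^-1).
have ob i : open (b i) by exact: open_interior.
pose F n : set (borelR R d) := if unpickle n is Some i then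
  (if mu (b i) == 0%E then b i else set0) else set0.
have oF n : open (F n).
  rewrite /F; case: (unpickle n) => [i|]; last exact: open0.
  by case: ifP => _; [exact: ob|exact: open0].
have F0 n : mu (F n) = 0%E.
  rewrite /F; case: (unpickle n) => [i|]; last exact: measure0.
  by case: ifP => [/eqP//|_]; exact: measure0.
exists (\bigcup_n F n); split.
- by apply: open_borel; apply: bigcup_open => n _; exact: oF.
- apply/negligibleP; first by apply: open_borel; apply: bigcup_open => n _; exact: oF.
  apply: negligible_bigcup => n; apply/negligibleP; last exact: F0.
  by apply: open_borel; exact: oF.
move=> x /existsNP[U /not_implyP[oU /not_implyP[Ux U0]]].
have {}U0 : mu U = 0%E.
  by apply/eqP; rewrite eq_le measure_ge0 andbT leNgt; apply/negP.
have /nbhs_ballP[e /= e0 eU] : nbhs x U by exact: open_nbhs_nbhs.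
have [n ne] := exists_natSinv_lt (divr_gt0 e0 (ltr0n R 2)).
have [h hE] : exists h : R, h = n.+1%:R^-1 by eexists.
have n0 : 0 < h by rewrite hE invr_gt0.
rewrite -hE in ne.
have /choice[q qP] : forall j : 'I_d, exists q : rat,
    x ord0 j - h / 2 < ratr q < x ord0 j + h / 2.
  move=> j; have := @rat_in_itvoo R (x ord0 j - h / 2) (x ord0 j + h / 2).
  case; first lra.
  by move=> q; rewrite in_itv/= => hq; exists q.
pose Q : 'rV[rat]_d := \row_j q j.
have xQ : forall j, `|x ord0 j - (map_mx ratr Q : 'rV[R]_d) ord0 j| < h / 2.
  by move=> j; rewrite !mxE ltr_norml; have /andP[h1 h2] := qP j; apply/andP; split; lra.
exists (pickle (Q, n)) => //; rewrite /F pickleK.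
have bU : b (Q, n) `<=` U.
  move=> y /interior_subset /= Qy; apply: eU; split => // i j; have {Qy} := Qy.2 i j.
  rewrite -hE.
  have := xQ j; rewrite (ord1 i) /ball/= => h1 h2.
  have := ler_normD (x ord0 j - (map_mx ratr Q : 'rV[R]_d) ord0 j)
    ((map_mx ratr Q : 'rV[R]_d) ord0 j - y ord0 j).
  rewrite addrA subrK; lra.
have -> : mu (b (Q, n)) == 0%E.
  rewrite eq_le measure_ge0 andbT -U0; apply: le_measure => //; rewrite inE;
  exact: open_borel.
apply/nbhs_ballP; exists (h / 2) => /=; first by rewrite divr_gt0.
move=> y xy; split => [|i j]; rewrite -hE//; have := xy.2 i j; rewrite (ord1 i) /ball/= => h1; have h2 := xQ j.
have := ler_normD ((map_mx ratr Q : 'rV[R]_d) ord0 j - x ord0 j) (x ord0 j - y ord0 j).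
rewrite addrA subrK; rewrite distrC in h2; lra.
Qed.

End NullSets.

Section StopTimes.
Context {R : realType} {d : nat}.
Variable chi : R -> R -> 'rV[R]_d.
Implicit Types theta t r : R.

Definition endpoint theta := chi theta (stop_time chi theta).

Lemma good_lip theta s t : good_fiber chi theta -> 0 <= s -> s <= t ->
  enorm (chi theta t - chi theta s) <= t - s.
Proof.
move=> [gL _ _] s0 st; have := gL t s; rewrite /= !in_itv/= !andbT ger0_norm ?subr_ge0//.
by apply => //; exact: le_trans st.
Qed.

Lemma stop_timeP theta : good_fiber chi theta ->
  0 <= stop_time chi theta /\ forall t, stop_time chi theta <= t -> chi theta t = endpoint theta.
Proof.
move=> gt; have [gL g0 [u u0 uP]] := gt; rewrite /endpoint /stop_time; set S := [set _ | _].
have Su : S u by [].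
have S0 : lbound S 0 by move=> v [].
have Si : has_inf S by split; [exists u|exists 0].
have s0 : 0 <= inf S by apply: lb_le_inf => //; exists u.
have S_end v : S v -> chi theta v = chi theta u.
  move=> [v0 vP]; have [uv|/ltW vu] := leP u v; first exact: uP.
  by rewrite (vP u).
have after t : inf S < t -> chi theta t = chi theta u.
  rewrite -subr_gt0 => /inf_adherent /(_ Si)[v Sv]; rewrite addrC subrK => vt.
  by rewrite (Sv.2 t (ltW vt)) S_end.
suff e : chi theta (inf S) = chi theta u.
  split => // t; rewrite e le_eqVlt => /orP[/eqP <-//|]; exact: after.
apply/eqP; rewrite -subr_eq0 -enorm_eq0 eq_le enorm_ge0 andbT.
apply/ler_addgt0Pr => e e0; rewrite add0r.
have se : inf S < inf S + e by rewrite ltrDl.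
rewrite enormC -(after _ se) (le_trans (good_lip gt s0 (ltW se)))//.
by rewrite addrAC subrr add0r.
Qed.

Definition exit_time theta r : R :=
  sup [set t | 0 <= t /\ r <= enorm (chi theta t - endpoint theta)].

Lemma exit_timeP theta r : good_fiber chi theta -> 0 < r -> r <= enorm (endpoint theta) ->
  [/\ 0 <= exit_time theta r, exit_time theta r < stop_time chi theta,
      enorm (chi theta (exit_time theta r) - endpoint theta) = r &
      forall t, exit_time theta r <= t -> enorm (chi theta t - endpoint theta) <= r].
Proof.
move=> gt r0 rX; have [s0 sP] := stop_timeP gt; have [gL g0 _] := gt.
rewrite /exit_time; set S := [set _ | _].
have S0 : S 0 by split => //; rewrite g0 sub0r enormN.
have Sub : ubound S (stop_time chi theta).
  move=> t [t0 rt]; rewrite leNgt; apply/negP => /ltW /sP e.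
  by move: rt; rewrite e subrr enorm0 leNgt r0.
have Sh : has_sup S by split; [exists 0|exists (stop_time chi theta)].
have e0 : 0 <= sup S by apply: ub_le_sup => //; case: Sh.
have es : sup S <= stop_time chi theta by apply: ge_sup => //; exists 0.
have re : r <= enorm (chi theta (sup S) - endpoint theta).
  apply/ler_addgt0Pr => e e_gt0.
  have [t [t0 rt] te] := sup_adherent e_gt0 Sh.
  have tS : t <= sup S by apply: ub_le_sup => //; case: Sh.
  apply: (le_trans rt); have := enorm_distD (chi theta t) (chi theta (sup S)) (endpoint theta).
  have := good_lip gt t0 tS; rewrite (enormC (chi theta t) (chi theta (sup S))); lra.
have after t : sup S < t -> enorm (chi theta t - endpoint theta) < r.
  move=> St; rewrite ltNge; apply/negP => rt.
  have : t <= sup S.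
    by apply: ub_le_sup; [case: Sh|split => //; exact: le_trans (ltW St)].
  by rewrite leNgt St.
have er : enorm (chi theta (sup S) - endpoint theta) = r.
  apply/eqP; rewrite eq_le re andbT; apply/ler_addgt0Pr => e e_gt0.
  have Se : sup S < sup S + e by rewrite ltrDl.
  have := enorm_distD (chi theta (sup S)) (chi theta (sup S + e)) (endpoint theta).
  have := good_lip gt e0 (ltW Se); have := after _ Se.
  rewrite (enormC (chi theta (sup S)) (chi theta (sup S + e))); lra.
split => //.
- rewrite lt_neqAle es andbT; apply/eqP => e; move: er.
  by rewrite e /endpoint subrr enorm0 => r_; move: r0; rewrite -r_ ltxx.
- by move=> t; rewrite le_eqVlt => /orP[/eqP <-|/after/ltW//]; rewrite er.
Qed.

End StopTimes.

(** * Separated endpoints *)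

Section Endpoints.
Context {R : realType} {d : nat}.
Variables (mu : {finite_measure set (borelR R d) -> \bar R}).
Variables (M : R) (chi : R -> R -> 'rV[R]_d).
Local Notation leb := (@completed_lebesgue_measure R).
Implicit Types theta t r : R.

Hypothesis endpoint_law : forall V : set (borelR R d), measurable V ->
  mu V = leb [set theta | Theta M theta /\ V (endpoint chi theta)].

Lemma measurable_eball (x : 'rV[R]_d) r : measurable (eball x r : set (borelR R d)).
Proof.
have ct : continuous (fun y : 'rV[R]_d => enorm (y - x)).
  have cs : continuous (fun y : 'rV[R]_d => \sum_i (y - x) ord0 i ^+ 2).
    apply: (@continuous_big _ _ +%R 0 xpredT); first exact: add_continuous.
    move=> i _ y; apply: (@continuous_comp _ _ _ (fun v : 'rV[R]_d => (v - x) ord0 i)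
      (fun u : R => u ^+ 2)); last exact: exprn_continuous.
    rewrite (_ : (fun v : 'rV[R]_d => _) = fun v => v ord0 i - x ord0 i); last first.
      by apply/funext => v; rewrite !mxE.
    have h := @coord_continuous R 1 d ord0 i y; exact: (cvgB h (cvg_cst _)).
  move=> y; apply: (@continuous_comp _ _ _ (fun y : 'rV[R]_d => \sum_i (y - x) ord0 i ^+ 2)
    (@Num.sqrt R)); [exact: cs|exact: sqrt_continuous].
apply: open_borel; apply: (@open_comp _ _ (fun y : 'rV[R]_d => enorm (y - x)) [set u | u < r]).
  by move=> y _; exact: ct.
exact: open_lt.
Qed.

Variables (D : nat) (C : R).
Hypothesis D_gt0 : (0 < D)%N.
Hypothesis C_gt0 : 0 < C.
Hypothesis upper_regular : forall x r, msupp mu x -> 0 <= r <= 1 ->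
  (mu (eball x r) <= (C * r ^+ D)%:E)%E.

Lemma endpoint_off_support :
  leb [set theta | Theta M theta /\ ~ msupp mu (endpoint chi theta)] = 0%E.
Proof.
have [V [mV V0 suppV]] := null_off_support mu.
apply/eqP; rewrite eq_le leb_ge0 andbT -V0 (endpoint_law mV).
by apply: leb_le => theta [Tt /suppV].
Qed.

(** The measure has no atom at the origin, because small balls have small mass. *)
Lemma endpoint_not_origin :
  leb [set theta | Theta M theta /\ endpoint chi theta = 0] = 0%E.
Proof.
have [s0|ns0] := pselect (msupp mu 0); last first.
  apply/eqP; rewrite eq_le leb_ge0 andbT -endpoint_off_support.
  by apply: leb_le => theta [Tt e0]; split => //; rewrite e0.
apply/eqP; rewrite eq_le leb_ge0 andbT; apply/lee_addgt0Pr => e e0; rewrite add0e.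
pose r := Num.min 1 (e / C).
have r0 : 0 < r by rewrite lt_min ltr01 divr_gt0.
have r1 : r <= 1 by rewrite ge_min lexx.
have re : C * r ^+ D <= e.
  rewrite -ler_pdivlMl//; apply: (@le_trans _ _ r); last by rewrite ge_min mulrC lexx orbT.
  by rewrite -(prednK D_gt0) exprS ger_pMr// exprn_ile1// ltW.
have r01 : 0 <= r <= 1 by rewrite ltW.
have re' : (mu (eball 0 r) <= e%:E)%E by rewrite (le_trans (upper_regular s0 r01))// lee_fin.
apply: le_trans re'.
rewrite endpoint_law; last exact: measurable_eball.
by apply: leb_le => theta [Tt e0']; split => //; rewrite /eball/= e0' subrr enorm0.
Qed.

Lemma leb_bigsetU_le n (F : nat -> set R) (b : R) :
  (forall k, (k < n)%N -> (leb (F k) <= b%:E)%E) ->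
  (leb (\big[setU/set0]_(k < n) F k) <= (n%:R * b)%:E)%E.
Proof.
elim: n => [_|n IH Fb]; first by rewrite big_ord0 leb0 mul0r.
rewrite big_ord_recr/= (le_trans (lebU _ _))// -natr1 mulrDl mul1r EFinD.
by apply: leeD; [apply: IH => k kn; apply: Fb; exact: ltnW|exact: Fb].
Qed.

(** If no further endpoint is far from the previous ones, the balls of radius [4 * r] about
    the latter cover [G]; otherwise the family grows, and a large family is enough as well. *)
Lemma separated_endpoints (G : set R) (g r : R) :
  (forall theta, G theta -> Theta M theta /\ msupp mu (endpoint chi theta)) ->
  0 < g -> (g%:E <= leb G)%E -> 0 < r -> 4 * r <= 1 ->
  exists n (th : 'I_n -> R), [/\ forall i, G (th i),
    forall i j, i != j -> 4 * r <= enorm (endpoint chi (th i) - endpoint chi (th j)) &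
    g <= n%:R * (C * (4 * r) ^+ D)].
Proof.
move=> GT g0 gG r0 r1; set b := C * _.
have b0 : 0 < b by rewrite mulr_gt0// exprn_gt0// mulr_gt0.
pose X := endpoint chi.
pose sep n (th : nat -> R) := (forall k, (k < n)%N -> G (th k)) /\
  (forall k l, (k < n)%N -> (l < n)%N -> k != l -> 4 * r <= enorm (X (th k) - X (th l))).
suff [n [th [[thG ths] gn]]] : exists n th, sep n th /\ g <= n%:R * b.
  exists n, (fun i : 'I_n => th i); split => //; first by move=> i; exact: thG.
  by move=> i j ij; apply: ths.
apply: contrapT => H.
have [n [th [thG gn]]] : exists n th, sep n th /\ g <= n%:R * b.
  have grow n : exists th, sep n th.
    elim: n => [|n [th [thG ths]]]; first by exists (fun=> 0); split.
    have [[theta [Gt far]]|near_all] := pselect (exists theta, G theta /\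
        forall k, (k < n)%N -> 4 * r <= enorm (X theta - X (th k))).
      exists (fun k => if k == n then theta else th k); split.
        move=> k; rewrite ltnS leq_eqVlt; case: eqP => //= _; exact: thG.
      move=> k l; rewrite !ltnS (leq_eqVlt k) (leq_eqVlt l).
      have [->|_] := eqVneq k n; have [->|_] := eqVneq l n; rewrite ?orTb ?orFb => kn ln kl.
      - by move: kl.
      - exact: far ln.
      - by rewrite enormC; exact: far kn.
      - exact: ths kn ln kl.
    exfalso; apply: H; exists n, th; split => //.
    rewrite -lee_fin (le_trans gG)//.
    pose F k := [set theta | Theta M theta /\ eball (X (th k)) (4 * r) (X theta)].
    have GF : G `<=` \big[setU/set0]_(k < n) F k.
      move=> theta Gt; rewrite -bigcup_mkord; apply: contrapT => nU; apply: near_all.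
      exists theta; split => // k kn; rewrite leNgt; apply/negP => lt.
      by apply: nU; exists k => //; split; [exact: (GT _ Gt).1|].
    apply: (le_trans (leb_le GF)); apply: leb_bigsetU_le.
    move=> k kn; rewrite -endpoint_law; last exact: measurable_eball.
    apply: upper_regular; first exact: (GT _ (thG k kn)).2.
    by rewrite r1 andbT mulr_ge0// ltW.
  have [th sth] := grow (Num.truncn (g / b)).+1.
  exists (Num.truncn (g / b)).+1, th; split => //.
  rewrite -ler_pdivrMr//; have /andP[_ h] := truncn_itv (divr_ge0 (ltW g0) (ltW b0)).
  exact: ltW.
by apply: H; exists n, th.
Qed.

End Endpoints.

Section Cover.
Context {R : realType} {d : nat}.
Variables (mu : {finite_measure set (borelR R d) -> \bar R}).
Variables (M : R) (chi : R -> R -> 'rV[R]_d).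
Local Notation leb := (@completed_lebesgue_measure R).

(** All the exceptional sets, including the fibres that end off the support or at the origin,
    are gathered in one null set. *)
Lemma tame_cover (D : nat) (C : R) : (0 < D)%N -> 0 < C -> 0 <= M ->
  (forall x r, msupp mu x -> 0 <= r <= 1 -> (mu (eball x r) <= (C * r ^+ D)%:E)%E) ->
  irrigation_plan M chi mu -> condA2 M chi ->
  exists N : set (lebesgueR R), tame_plan M chi N /\
    forall theta, Theta0 M N theta -> [/\
      forall t, 0 <= t < stop_time chi theta -> 0 < mult M chi theta t,
      msupp mu (endpoint chi theta) & endpoint chi theta != 0].
Proof.
move=> D0 C0 M0 reg [mchi start [N1 [mN1 N10 sub1]] law] [N2 [mN2 N20 sub2]].
have law' (V : set (borelR R d)) : measurable V ->
  mu V = leb [set theta | Theta M theta /\ V (endpoint chi theta)] by exact: law.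
have [N3 [mN3 N30 sub3]] := null_cover (endpoint_off_support law').
have [N4 [mN4 N40 sub4]] := null_cover (endpoint_not_origin law' D0 C0 reg).
pose N : set (lebesgueR R) := (N1 `|` N2) `|` (N3 `|` N4).
have off theta : Theta M theta -> ~ N theta ->
    [/\ ~ N1 theta, ~ N2 theta, ~ N3 theta & ~ N4 theta].
  by move=> _ nN; split => h; apply: nN; [left; left|left; right|right; left|right; right].
have null (A B : set R) : leb A = 0%E -> leb B = 0%E -> leb (A `|` B) = 0%E.
  move=> A0 B0; apply/eqP; rewrite eq_le leb_ge0 andbT.
  by rewrite (le_trans (lebU _ _))// A0 B0 adde0.
exists N; split.
  apply: TamePlan; [exact: M0|exact: mchi|by do 2 apply: measurableU| |].
  - by apply: (null _ _ (null _ _ N10 N20) (null _ _ N30 N40)).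
  - move=> theta Tt nN; have [n1 _ _ _] := off _ Tt nN; have [_ g0] := start _ Tt.
    have [gL gu] : lipschitz1 `[0, +oo[ (chi theta) /\
        exists2 u, 0 <= u & forall t, u <= t -> chi theta t = chi theta u.
      by apply: contrapT => h; apply: n1; apply: sub1 => /= H; apply: h; exact: H.
    by split.
move=> theta [Tt nN]; have [_ n2 n3 n4] := off _ Tt nN; split.
- by apply: contrapT => h; apply: n2; apply: sub2 => /= H; apply: h; exact: H.
- by apply: contrapT => h; apply: n3; apply: sub3.
- by apply/negP => /eqP h; apply: n4; apply: sub4.
Qed.

End Cover.

(** * Lower bounds for the cost of a plan *)

Section StepLowerBound.
Context dd (T : measurableType dd) (R : realType).
Variable mu : {measure set T -> \bar R}.
Local Open Scope ereal_scope.

(** A lower bound by a measurable step function times [v] makes the integral of a possibly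
    nonmeasurable function accessible. *)
Lemma sum_integral_le n (P : pred 'I_n) (D : set T) (A : 'I_n -> set T)
    (c : 'I_n -> R) (v : T -> R) (F : T -> \bar R) :
  measurable D -> (forall i, P i -> measurable (A i)) -> (forall i, P i -> A i `<=` D) ->
  (forall i, P i -> 0 <= c i)%R -> measurable_fun setT v -> (forall x, 0 <= v x)%R ->
  (forall x, D x -> 0 <= F x) ->
  {ae mu, forall x, D x -> ((\sum_(i | P i && (x \in A i)) c i) * v x)%:E <= F x} ->
  \sum_(i | P i) ((c i)%:E * \int[mu]_(x in A i) (v x)%:E) <= \int[mu]_(x in D) F x.
Proof.
move=> mD mA AD c0 mv v0 F0 H.
pose g i x : \bar R := (if P i then c i * v x * \1_(A i) x else 0)%:E.
have g0 i x : 0 <= g i x.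
  rewrite /g lee_fin; case: ifPn => // Pi.
  by apply: mulr_ge0; [apply: mulr_ge0; [exact: c0|exact: v0]|rewrite indicE].
have mg i : measurable_fun D (g i).
  apply/measurable_EFinP; rewrite /g; have [Pi|_] := boolP (P i); last exact: measurable_cst.
  apply: measurable_funM; last exact: measurable_indic (mA _ Pi).
  by apply: measurable_funM; [exact: measurable_cst|exact: measurable_funTS].
have -> : \sum_(i | P i) ((c i)%:E * \int[mu]_(x in A i) (v x)%:E) =
    \sum_i \int[mu]_(x in D) g i x.
  rewrite big_mkcond/=; apply: eq_bigr => i _; case: ifPn => Pi; last first.
    by rewrite /g (negbTE Pi) integral0.
  have <- : \int[mu]_(x in A i) ((c i)%:E * (v x)%:E) = (c i)%:E * \int[mu]_(x in A i) (v x)%:E.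
    by apply: ge0_integralZl_EFin; first [exact: mA | exact: c0
      | by move=> x _; rewrite lee_fin | by apply/measurable_EFinP; exact: measurable_funTS].
  rewrite -[in LHS](setIidr (AD _ Pi)) integral_mkcondr; apply: eq_integral => x _.
  rewrite /g Pi patchE indicE; case: (x \in A i); first by rewrite mulr1 EFinM.
  by rewrite mulr0.
rewrite -ge0_integral_sum//; apply: ge0_le_integral_ae => //.
  by move=> x _; apply: sume_ge0 => i _; exact: g0.
move: H; apply: filterS => x H Dx; apply: le_trans (H Dx).
rewrite /g sumEFin lee_fin mulr_suml [leRHS]big_mkcond/=; apply: ler_sum => i _.
by case: (P i) => //=; rewrite indicE; case: (x \in A i); rewrite ?mulr1 ?mulr0.
Qed.

End StepLowerBound.

Section FiberSegments.
Context {R : realType} {d : nat}.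
Variables (M : R) (chi : R -> R -> 'rV[R]_d) (N : set (lebesgueR R)).
Local Notation path := (Defs.path R d).
Implicit Types (theta t : R) (q : path).

Hypothesis tN : tame_plan M chi N.

Lemma fiber_segment theta q (l l' : R) : fibers0 M chi N q theta ->
  0 <= l -> l <= l' -> l' <= q.1 -> exists a b,
  [/\ 0 <= a <= b, b <= stop_time chi theta, arc_length (chi theta) a = l,
      arc_length (chi theta) b = l' &
      forall t, a <= t <= b ->
        [/\ l <= arc_length (chi theta) t <= l',
            arc_path (chi theta) t = cut q (arc_length (chi theta) t) &
            chi theta t = q.2 (arc_length (chi theta) t)]].
Proof.
move=> qt l0 ll lq; have [gt _ [t0 t00 t0q]] := fibers0P tN qt.
have [s0 sP] := stop_timeP gt; have [gL _ _] := gt.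
have Lt0 : arc_length (chi theta) t0 = q.1 by rewrite -t0q.
have qs : q.1 <= arc_length (chi theta) (stop_time chi theta).
  have [ts|st] := leP t0 (stop_time chi theta).
    by have h := arc_length_homo gL (ltW t00) ts; rewrite -Lt0.
  by rewrite -Lt0 (arc_length_settled gL s0 sP (ltW st)).
have l'0 := le_trans l0 ll.
have [_ bs _] := crossing_spec gL l'0 s0 (le_trans lq qs).
have lt0 : l' <= arc_length (chi theta) t0 by rewrite Lt0.
have [b0 bt bL] := crossing_spec gL l'0 (ltW t00) lt0.
have lb : l <= arc_length (chi theta) (crossing (chi theta) l') by rewrite bL.
have [a0 ab aL] := crossing_spec gL l0 b0 lb.
exists (crossing (chi theta) l), (crossing (chi theta) l').
split; [by rewrite a0|exact: bs|exact: aL|exact: bL|move=> t /andP[at_ tb]].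
have t_0 := le_trans a0 at_; have tt0 := le_trans tb bt.
have h1 := arc_length_homo gL a0 at_; have h2 := arc_length_homo gL t_0 tb.
rewrite aL in h1; rewrite bL in h2.
split; first by rewrite h1.
  by rewrite (arc_path_prefix gL t_0 tt0) t0q.
by rewrite -t0q (arc_path_at gL t_0 tt0).
Qed.

End FiberSegments.

Section Energy.
Context {R : realType} {d : nat}.
Variables (M : R) (chi : R -> R -> 'rV[R]_d) (N : set (lebesgueR R)).
Local Notation leb := (@completed_lebesgue_measure R).
Local Notation path := (Defs.path R d).
Implicit Types (theta t : R) (p q : path).

Hypothesis tN : tame_plan M chi N.
Variables (f : R -> R) (A B : R).
Hypothesis A0 : 0 <= A.
Hypothesis B0 : 0 <= B.
Hypothesis f_ge0 : forall z, 0 <= z -> 0 <= f z.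
Hypothesis f_mono : forall x y, 0 <= x -> x <= y -> f x <= f y.
Hypothesis f_lin : forall z, 0 <= z -> f z <= A + B * z.
Hypothesis f_cont : {within `[0, +oo[, continuous f}.
Variable alpha : R.

Local Notation mass := (mass M chi).
Local Notation W := (weight M chi f).

(** Already at the level [eps] equal to the multiplicity, since the excess is nonnegative. *)
Lemma weight_ge_mult theta t : Theta0 M N theta -> 0 <= t ->
  0 < arc_length (chi theta) t -> 0 < mult M chi theta t ->
  ((mult M chi theta t)%:E <= W theta t)%E.
Proof.
move=> Tt t0 L0 m0; set q := arc_path (chi theta) t.
have [k [w [Bk kq qE kw wE]]] := weight_eps_spec tN A0 B0 f_ge0 f_mono f_lin f_cont m0
  Tt t0 L0 (lexx _).
have /andP[ak kb] := kq.
have [wbar wbar0 sol] := branch_weight_solves tN A0 B0 f_ge0 f_mono f_lin m0 kw Bk.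
apply: (@le_trans _ _ (w q.1)%:E); last first.
  by apply: ereal_sup_ubound; exists (mult M chi theta t) => //; rewrite wE.
rewrite lee_fin (le_trans _ (branch_weight_ge tN f_ge0 f_mono m0 Bk wbar0 sol ak kb))//.
by rewrite (branch_fluxE tN m0 Bk L0 kb) qE.
Qed.

Definition fiber_energy theta : \bar R :=
  (\int[lebesgue_measure]_(t in `[0%R, stop_time chi theta])
      (W theta t `^ alpha *
       ((mult M chi theta t)^-1 * enorm ((chi theta)^`()%classic t))%:E))%E.

Lemma mult_ge0 theta t : 0 <= mult M chi theta t.
Proof. by rewrite /mult /meas fine_ge0//; exact: leb_ge0. Qed.

Let integrand_ge0 theta t : (0 <= W theta t `^ alpha *
       ((mult M chi theta t)^-1 * enorm ((chi theta)^`()%classic t))%:E)%E.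
Proof.
apply: mule_ge0; first exact: poweR_ge0.
by rewrite lee_fin mulr_ge0 ?enorm_ge0// invr_ge0 mult_ge0.
Qed.

Lemma fiber_energy_ge0 theta : (0 <= fiber_energy theta)%E.
Proof. by apply: integral_ge0 => t _; exact: integrand_ge0. Qed.

(** The time intervals are disjoint, so that the bounds on the cost density over each of them
    add up. *)
Lemma fiber_energy_ge theta n (P : pred 'I_n) (a b c : 'I_n -> R) :
  Theta0 M N theta ->
  (forall i, P i -> [/\ 0 <= a i <= b i, b i <= stop_time chi theta & 0 <= c i]) ->
  (forall i j t, P i -> P j -> a i <= t <= b i -> a j <= t <= b j -> i = j) ->
  (forall i t, P i -> a i <= t <= b i ->
     ((c i)%:E <= W theta t `^ alpha * ((mult M chi theta t)^-1)%:E)%E) ->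
  ((\sum_(i | P i) c i * (arc_length (chi theta) (b i) - arc_length (chi theta) (a i)))%:E
    <= fiber_energy theta)%E.
Proof.
move=> Tt Hab disj Hc; have gt := tame_fiber tN Tt.1 Tt.2; have [gL _ _] := gt.
have [s0 _] := stop_timeP gt; set T := stop_time chi theta in Hab s0 *.
move: (s0); rewrite le_eqVlt => /orP[/eqP T0|T0].
  rewrite big1 ?fiber_energy_ge0// => i Pi; have [/andP[a0 ab] bT _] := Hab i Pi.
  have -> : b i = a i by apply/eqP; rewrite eq_le ab andbT (le_trans bT)// -T0.
  by rewrite subrr mulr0.
have [v vP] := exists_speed T0 (lipschitz_restrict gL (T := T)).
rewrite -sumEFin.
have -> : (\sum_(i | P i) (c i * (arc_length (chi theta) (b i) -
      arc_length (chi theta) (a i)))%:E =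
    \sum_(i | P i) ((c i)%:E * \int[lebesgue_measure]_(x in `[a i, b i]) (v x)%:E))%E.
  apply: eq_bigr => i Pi; have [/andP[a0 ab] bT _] := Hab i Pi.
  by rewrite EFinM (arc_length_incr vP a0 ab bT).
apply: sum_integral_le => //.
- move=> i Pi x; have [/andP[a0 ab] bT _] := Hab i Pi; rewrite /= !in_itv/=.
  by move=> /andP[ax xb]; rewrite (le_trans a0 ax) (le_trans xb bT).
- by move=> i /Hab[].
- exact: (speed_meas vP).
- exact: (speed_ge0 vP).
have := speed_ae vP; have := @ae_neq R 0; have := @ae_neq R T.
apply: (@filterS3 _ _ (ae_filter_ringOfSetsType lebesgue_measure)) => x xT x0 sp /=.
rewrite in_itv/= => /andP[x_ge0 x_leT].
have spx : enorm ((chi theta)^`()%classic x) = v x.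
  apply: (sp _).2; rewrite !lt_neqAle x_ge0 x_leT !andbT.
  by apply/andP; split; apply/eqP => // /esym.
have [[i /andP[Pi xi]]|none] := pselect (exists i, P i && (x \in `[a i, b i])); last first.
  rewrite big_pred0 ?mul0r; first exact: integrand_ge0.
  by move=> i; apply: negbTE; apply/negP => h; apply: none; exists i.
have -> : \sum_(j < n | P j && (x \in `[a j, b j])) c j = c i.
  rewrite (bigD1 i)/=; last by rewrite Pi xi.
  rewrite big1 ?addr0// => j /andP[/andP[Pj xj] /eqP ji]; exfalso; apply: ji.
  move: xi xj; rewrite !inE/= !in_itv/= => xi xj; exact: (disj _ _ x Pj Pi xj xi).
rewrite spx EFinM EFinM muleA; apply: lee_wpmul2r; first by rewrite lee_fin (speed_ge0 vP).
by apply: Hc Pi _; move: xi; rewrite inE/= in_itv.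
Qed.

Lemma energy_ge n (Q : 'I_n -> path) (c : 'I_n -> R) :
  (forall i, is_arc_length_path (Q i)) -> (forall i, 0 <= c i) ->
  (forall theta, Theta0 M N theta ->
     ((\sum_(i | theta \in fibers0 M chi N (Q i)) c i)%:E <= fiber_energy theta)%E) ->
  ((\sum_i mass (Q i) * c i)%:E <= weighted_energy M chi f alpha)%E.
Proof.
move=> Qa c0 H; rewrite -sumEFin.
have -> : (\sum_(i < n) (mass (Q i) * c i)%:E =
    \sum_(i < n | xpredT i) ((c i)%:E * \int[leb]_(x in fibers0 M chi N (Q i)) (cst 1%R x)%:E))%E.
  apply: eq_bigr => i _.
  have -> : (\int[leb]_(x in fibers0 M chi N (Q i)) (cst 1%R x)%:E = leb (fibers0 M chi N (Q i)))%E.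
    have mQ := measurable_fibers0 tN (Qa i).
    by have := @integral_cst _ _ _ leb _ mQ 1%E; rewrite mul1e.
  by rewrite (leb_fibers0 tN) -(massE tN) -EFinM mulrC.
apply: sum_integral_le => //.
- exact: measurable_Theta.
- by move=> i _; exact: measurable_fibers0.
- by move=> i _ t [_ []].
- by move=> t _; exact: fiber_energy_ge0.
exists N; split; [exact: (tame_null tN)|exact: (tame_null0 tN)|].
move=> t /= /not_implyP[Tt nH]; apply: contrapT => Nt; apply: nH.
by rewrite mulr1; exact: H.
Qed.

End Energy.

(** * The cost of disjoint tips *)

Section Tips.
Context {R : realType} {d : nat}.
Variables (M : R) (chi : R -> R -> 'rV[R]_d) (N : set (lebesgueR R)).
Local Notation leb := (@completed_lebesgue_measure R).
Local Notation path := (Defs.path R d).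
Implicit Types (theta t r : R) (p q : path).

Hypothesis tN : tame_plan M chi N.
Hypothesis mult_gt0 : forall theta t, Theta0 M N theta ->
  0 <= t < stop_time chi theta -> 0 < mult M chi theta t.

Local Notation mass := (mass M chi).
Local Notation X := (endpoint chi).
Local Notation exit := (exit_time chi).

Definition tip theta r : path := arc_path (chi theta) (exit theta (r / 2)).

(** A curve that moves from distance [r] to distance [r / 2] of a point covers at least
    [r / 2]; the curve starts at the origin, which gives the bound on the first length. *)
Lemma exit_length theta r : Theta0 M N theta -> 0 < r -> r < enorm (X theta) ->
  [/\ 0 <= exit theta r, exit theta r <= exit theta (r / 2),
      exit theta (r / 2) < stop_time chi theta,
      enorm (X theta) - r <= arc_length (chi theta) (exit theta r) &
      arc_length (chi theta) (exit theta r) + r / 2 <=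
        arc_length (chi theta) (exit theta (r / 2))].
Proof.
move=> Tt r0 rX; have gt := tame_fiber tN Tt.1 Tt.2; have [gL g0 _] := gt.
have h0 : 0 < r / 2 by rewrite divr_gt0.
have hX : r / 2 <= enorm (X theta) by lra.
have [t0 ts tr ta] := exit_timeP gt r0 (ltW rX).
have [s0 ss sr sa] := exit_timeP gt h0 hX.
have st : exit theta r <= exit theta (r / 2).
  by rewrite leNgt; apply/negP => /ltW /sa; rewrite tr; lra.
split => //.
  have := arc_length_dist gL (lexx 0) t0; rewrite arc_length0 subr0 g0 subr0.
  have := enorm_distD (X theta) (chi theta (exit theta r)) 0; rewrite !subr0.
  by rewrite (enormC (X theta)) tr; lra.
have := arc_length_dist gL t0 st.
have := enorm_distD (chi theta (exit theta r)) (chi theta (exit theta (r / 2))) (X theta).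
rewrite tr sr (enormC (chi theta (exit theta r))).
move: (enorm _) (arc_length _ _) (arc_length _ _) => u v w; lra.
Qed.

Lemma tip_path theta r : Theta0 M N theta -> 0 < r -> r < enorm (X theta) ->
  is_arc_length_path (tip theta r).
Proof.
move=> Tt r0 rX; have gt := tame_fiber tN Tt.1 Tt.2; have [gL g0 _] := gt.
have [t0 tt _ _ _] := exit_length Tt r0 rX.
by apply: arc_path_is_arc_length => //; exact: le_trans tt.
Qed.

Lemma tip_mass theta r : Theta0 M N theta -> 0 < r -> r < enorm (X theta) ->
  0 < mass (tip theta r).
Proof.
move=> Tt r0 rX; have [t0 tt ts _ _] := exit_length Tt r0 rX.
by apply: (mult_gt0 Tt); rewrite ts andbT; exact: le_trans tt.
Qed.

Lemma tip_length theta r : Theta0 M N theta -> 0 < r -> r < enorm (X theta) ->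
  enorm (X theta) - r / 2 <= (tip theta r).1.
Proof.
move=> Tt r0 rX; have [_ _ _ l1 l2] := exit_length Tt r0 rX.
apply: le_trans l2; move: l1; move: (arc_length _ _) => u; lra.
Qed.

Lemma tip_near theta r l : Theta0 M N theta -> 0 < r -> r < enorm (X theta) ->
  0 <= l -> (tip theta r).1 - r / 2 <= l -> l <= (tip theta r).1 ->
  enorm ((tip theta r).2 l - X theta) <= r.
Proof.
move=> Tt r0 rX l0 ll lq; have gt := tame_fiber tN Tt.1 Tt.2; have [gL g0 _] := gt.
have [t0 tt ts _ Ltt] := exit_length Tt r0 rX.
have [_ _ _ near] := exit_timeP gt r0 (ltW rX).
have [c0 ct cL] := crossing_spec gL l0 (le_trans t0 tt) lq.
have -> : (tip theta r).2 l = chi theta (crossing (chi theta) l).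
  by rewrite /tip -[in LHS]cL (arc_path_at gL c0 ct).
have [tc|/ltW ct'] := leP (exit theta r) (crossing (chi theta) l); first exact: near.
have Lc := arc_length_homo gL c0 ct'.
have e : arc_length (chi theta) (crossing (chi theta) l) = arc_length (chi theta) (exit theta r).
  apply/eqP; rewrite eq_le Lc cL (le_trans _ ll)// lerBrDr; exact: Ltt.
by rewrite (arc_length_eq_dist gL c0 t0 e); exact: near.
Qed.

Lemma tip_stem_mass theta r : Theta0 M N theta -> 0 < r -> r < enorm (X theta) ->
  mass (cut (tip theta r) ((tip theta r).1 - r / 2)) <= mult M chi theta (exit theta r).
Proof.
move=> Tt r0 rX; have gt := tame_fiber tN Tt.1 Tt.2; have [gL g0 _] := gt.
have [t0 tt ts Lt Ltt] := exit_length Tt r0 rX.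
apply: (mass_prefix tN); first by apply: lt_le_trans Lt; rewrite subr_gt0.
have L1 : arc_length (chi theta) (exit theta r) <= (tip theta r).1 - r / 2.
  by rewrite lerBrDr.
have h := arc_path_prefix gL t0 tt.
by split; [exact: L1|rewrite cut_cut; [exact: h|exact: L1]].
Qed.

Variables (f : R -> R) (A B : R).
Hypothesis A0 : 0 <= A.
Hypothesis B0 : 0 <= B.
Hypothesis f_ge0 : forall z, 0 <= z -> 0 <= f z.
Hypothesis f_mono : forall x y, 0 <= x -> x <= y -> f x <= f y.
Hypothesis f_lin : forall z, 0 <= z -> f z <= A + B * z.
Hypothesis f_cont : {within `[0, +oo[, continuous f}.
Variable alpha : R.
Hypothesis alpha01 : 0 <= alpha <= 1.
Local Notation W := (weight M chi f).

Lemma cost_density_ge theta t (y m : R) : 0 <= y -> 0 < mult M chi theta t ->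
  mult M chi theta t <= m -> (y%:E <= W theta t)%E ->
  ((y `^ alpha / m)%:E <= W theta t `^ alpha * ((mult M chi theta t)^-1)%:E)%E.
Proof.
move=> y0 m0 mm yW; rewrite EFinM; apply: lee_pmul.
- by rewrite lee_fin powR_ge0.
- by rewrite lee_fin invr_ge0 (le_trans (ltW m0)).
- rewrite -poweR_EFin; apply: gt0_ler_poweR => //; first by case/andP: alpha01.
  + by rewrite in_itv/= lee_fin y0 leey.
  + by rewrite in_itv/= leey andbT (le_trans _ yW).
- by rewrite lee_fin lef_pV2 ?posrE// (lt_le_trans m0).
Qed.

Lemma mult_density_ge theta t m : Theta0 M N theta -> 0 <= t ->
  0 < arc_length (chi theta) t -> 0 < mult M chi theta t -> mult M chi theta t <= m ->
  ((m `^ (alpha - 1))%:E <= W theta t `^ alpha * ((mult M chi theta t)^-1)%:E)%E.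
Proof.
move=> Tt t0 L0 mu0 mm.
have wm := weight_ge_mult tN A0 B0 f_ge0 f_mono f_lin f_cont Tt t0 L0 mu0.
apply: le_trans (cost_density_ge (ltW mu0) mu0 (lexx _) wm).
have /andP[a0 a1] := alpha01; have m0 := lt_le_trans mu0 mm.
rewrite lee_fin (le_trans (_ : _ <= mult M chi theta t `^ (alpha - 1)))//.
  rewrite -(opprB 1) !powRN lef_pV2 ?posrE ?powR_gt0//.
  have u0 := ltW mu0; have v0 := ltW m0.
  by apply: ge0_ler_powR; rewrite ?nnegrE ?subr_ge0.
rewrite powRB; first by rewrite (powRr1 (ltW mu0)).
by rewrite (gt_eqF mu0) implybT.
Qed.

Lemma energy_ge_exits n (th : 'I_n -> R) r : 0 < r ->
  (forall i, Theta0 M N (th i)) -> (forall i, r < enorm (X (th i))) ->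
  (forall i j, i != j -> 4 * r <= enorm (X (th i) - X (th j))) ->
  ((\sum_i mult M chi (th i) (exit (th i) (r / 2)) *
      (mult M chi (th i) (exit (th i) r) `^ (alpha - 1) * (r / 2)))%:E
    <= weighted_energy M chi f alpha)%E.
Proof.
move=> r0 Tth rX sep.
pose Q i := tip (th i) r; pose c i := mult M chi (th i) (exit (th i) r) `^ (alpha - 1).
have r20 : 0 < r / 2 by rewrite divr_gt0.
apply: (energy_ge tN (Q := Q) (c := fun i => c i * (r / 2))).
- by move=> i; exact: tip_path.
- by move=> i; apply: mulr_ge0; [exact: powR_ge0|exact: ltW].
move=> theta Tt; pose P i := theta \in fibers0 M chi N (Q i).
have Ql i : r / 2 < (Q i).1.
  by have := tip_length (Tth i) r0 (rX i); have := rX i; rewrite -/(Q i); lra.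
have /choice[ab abP] : forall i, exists ab : R * R, P i ->
  [/\ 0 <= ab.1 <= ab.2, ab.2 <= stop_time chi theta,
      arc_length (chi theta) ab.1 = (Q i).1 - r / 2, arc_length (chi theta) ab.2 = (Q i).1 &
      forall t, ab.1 <= t <= ab.2 ->
        [/\ (Q i).1 - r / 2 <= arc_length (chi theta) t <= (Q i).1,
            arc_path (chi theta) t = cut (Q i) (arc_length (chi theta) t) &
            chi theta t = (Q i).2 (arc_length (chi theta) t)]].
  move=> i; have [Pi|_] := boolP (P i); last by exists (0, 0).
  have l0 : 0 <= (Q i).1 - r / 2 by rewrite subr_ge0 ltW.
  have ll : (Q i).1 - r / 2 <= (Q i).1 by rewrite gerBl ltW.
  have [a [b H]] := fiber_segment tN (set_mem Pi) l0 ll (lexx _).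
  by exists (a, b) => _.
have -> : \sum_(i | P i) c i * (r / 2) = \sum_(i | P i) c i *
    (arc_length (chi theta) (ab i).2 - arc_length (chi theta) (ab i).1).
  apply: eq_bigr => i Pi; have [_ _ -> -> _] := abP i Pi.
  by congr (_ * _); rewrite subKr.
apply: (fiber_energy_ge tN (P := P) (a := fun i => (ab i).1) (b := fun i => (ab i).2) (c := c) Tt).
- by move=> i Pi; have [h1 h2 _ _ _] := abP i Pi; split => //; exact: powR_ge0.
- move=> i j t Pi Pj ti tj; apply/eqP; apply: contrapT => /negP ij.
  have [_ _ _ _ /(_ _ ti)[/andP[i1 i2] _ iE]] := abP i Pi.
  have [_ _ _ _ /(_ _ tj)[/andP[j1 j2] _ jE]] := abP j Pj.
  have [/andP[ai0 _] _ _ _ _] := abP i Pi; have /andP[ait _] := ti.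
  have Lt0 : 0 <= arc_length (chi theta) t.
    by apply: le_trans i1; rewrite subr_ge0; exact: ltW (Ql i).
  have ni := tip_near (Tth i) r0 (rX i) Lt0 i1 i2.
  have nj := tip_near (Tth j) r0 (rX j) Lt0 j1 j2.
  rewrite -/(Q i) -iE in ni; rewrite -/(Q j) -jE in nj.
  have := le_trans (sep i j ij) (enorm_distD (X (th i)) (chi theta t) (X (th j))).
  rewrite (enormC (X (th i)) (chi theta t)) leNgt => /negP; apply.
  apply: le_lt_trans (lerD ni nj) _; have -> : r + r = 2 * r by rewrite mulr_natl.
  by rewrite (ltr_pM2r r0) ltr_nat.
move=> i t Pi ti; have [/andP[a0 ab0] bs _ _ /(_ _ ti)[/andP[i1 i2] pE _]] := abP i Pi.
have /andP[ait tbi] := ti.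
have L0 : 0 < arc_length (chi theta) t by apply: lt_le_trans i1; rewrite subr_gt0; exact: Ql.
have mE : mult M chi theta t = mass (cut (Q i) (arc_length (chi theta) t)).
  by rewrite -pE.
apply: (mult_density_ge Tt (le_trans a0 ait) L0).
  rewrite mE; apply: (lt_le_trans (tip_mass (Tth i) r0 (rX i))).
  have tQ : path_le (cut (Q i) (arc_length (chi theta) t)) (Q i).
    by split; [exact: i2|exact: erefl].
  by apply: (mass_prefix tN _ tQ); exact: L0.
rewrite mE; apply: le_trans (tip_stem_mass (Tth i) r0 (rX i)).
have s0 : 0 < (cut (Q i) ((Q i).1 - r / 2)).1 by rewrite /= subr_gt0; exact: Ql.
apply: (mass_prefix tN s0).
by split; [exact: i1|rewrite cut_cut; [exact: erefl|exact: i1]].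
Qed.

End Tips.

(** * Low exponents *)

Section ScaleEstimates.
Context {R : realType}.
Implicit Types m r K L e g : R.

(** A bound on the cost of a stretch of length [r / 2] bounds the multiplicity from below,
    because the cost per unit length blows up as the multiplicity vanishes. *)
Lemma mass_from_cost alpha m r K : alpha < 1 -> 0 < m -> 0 < r -> 0 < K ->
  m `^ (alpha - 1) * (r / 2) <= K -> (r / (2 * K)) `^ (1 - alpha)^-1 <= m.
Proof.
move=> a1 m0 r0 K0 H; have a10 : 0 < 1 - alpha by rewrite subr_gt0.
have mp := powR_gt0 (1 - alpha) m0.
have h : r / (2 * K) <= m `^ (1 - alpha).
  rewrite ler_pdivrMr ?mulr_gt0//.
  move: H; rewrite -(opprB 1) powRN mulrC ler_pdivrMr// ler_pdivrMr// => H.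
  by have -> : m `^ (1 - alpha) * (2 * K) = K * m `^ (1 - alpha) * 2 by ring.
have -> : m = (m `^ (1 - alpha)) `^ (1 - alpha)^-1.
  by rewrite -powRrM mulfV ?gt_eqF// powRr1// ltW.
apply: ge0_ler_powR; rewrite ?nnegrE ?invr_ge0 ?(ltW a10) ?(ltW mp)//.
by rewrite divr_ge0 ?mulr_ge0 ?(ltW r0) ?(ltW K0).
Qed.

Lemma branch_cost_ge alpha m m' r K1 L : 0 <= alpha -> 0 < m -> 0 < r -> 0 < K1 ->
  0 <= L -> L <= m -> m <= K1 * m' ->
  L `^ alpha * (r / 2) / K1 <= m' * (m `^ (alpha - 1) * (r / 2)).
Proof.
move=> a0 m0 r0 K0 L0 Lm mm.
have e : m * m `^ (alpha - 1) = m `^ alpha.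
  have h : alpha = 1 + (alpha - 1) by rewrite addrC subrK.
  have c : (1 + (alpha - 1) == 0) ==> (m != 0) by rewrite (gt_eqF m0) implybT.
  by rewrite [in RHS]h (powRD c) (powRr1 (ltW m0)).
have h1 : L `^ alpha <= m `^ alpha.
  by apply: ge0_ler_powR; rewrite ?nnegrE ?(ltW m0).
rewrite ler_pdivrMr//.
have -> : m' * (m `^ (alpha - 1) * (r / 2)) * K1 = K1 * m' * m `^ (alpha - 1) * (r / 2) by ring.
apply: ler_wpM2r; first by rewrite divr_ge0 ?(ltW r0).
apply: (le_trans h1); rewrite -e.
by apply: ler_wpM2r mm; exact: powR_ge0.
Qed.

Lemma branch_cost_scale (u v r k : R) : k != 0 ->
  u * v * (r / 2) / k = v / (2 * k) * (u * r).
Proof. by move=> k0; field. Qed.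

Lemma packing_cost_le (D n : nat) p (C c e g r : R) : 0 < c -> 0 < r -> 0 <= C ->
  n%:R * (c * r `^ p) <= e -> g <= n%:R * (C * (4 * r) ^+ D) ->
  g <= e * C * 4 ^+ D / c * r `^ (D%:R - p).
Proof.
move=> c0 r0 C0 ne gn; have rp := powR_gt0 p r0.
have nle : n%:R <= e / (c * r `^ p) by rewrite ler_pdivlMr// mulr_gt0.
apply: (le_trans gn); apply: (le_trans (ler_wpM2r _ nle)).
  by rewrite mulr_ge0// exprn_ge0// mulr_ge0// ltW.
rewrite powRB ?(gt_eqF r0) ?implybT// powR_mulrn ?(ltW r0)// exprMn.
rewrite le_eqVlt; apply/orP; left; apply/eqP; field.
by rewrite !gt_eqF.
Qed.

(** Sizes that lose a factor larger than [2 ^ p] at every dyadic scale fall below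
    the scale to the power [p]. *)
Lemma slow_scale (m r : nat -> R) (H p K : R) :
  (forall j, r j = r 0%N / 2 ^+ j) -> 0 < r 0%N -> 0 < K ->
  (forall j, m j <= H) -> (forall j, (r j / K) `^ p <= m j) ->
  exists j, m j <= 2 * 2 `^ p * m j.+1.
Proof.
move=> rE r0 K0 mH mr; apply: contrapT => /forallNP fast.
have p2 : 0 < 2 `^ p :> R by rewrite powR_gt0.
have down j : (2 * 2 `^ p) ^+ j * m j <= H.
  elim: j => [|j IH]; first by rewrite expr0 mul1r.
  apply: le_trans IH; rewrite exprSr -mulrA ler_pM2l ?exprn_gt0 ?mulr_gt0//.
  by have /negP := fast j; rewrite -ltNge => /ltW.
pose l := (r 0%N / K) `^ p; have l0 : 0 < l by rewrite powR_gt0// divr_gt0.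
have up j : 2 ^+ j * l <= H.
  apply: le_trans (down j); apply: le_trans (ler_wpM2l _ (mr j)); last first.
    by rewrite exprn_ge0// mulr_ge0// ltW.
  have scaleE : (r j / K) `^ p = l * (2 `^ p) ^- j.
    have -> : r j / K = r 0%N / K * 2 ^- j by rewrite rE; ring.
    rewrite powRM ?invr_ge0 ?exprn_ge0// ?divr_ge0 ?(ltW r0) ?(ltW K0)//.
    by congr (_ * _); rewrite -powR_invn// powRAC powR_invn ?powR_ge0.
  rewrite scaleE exprMn le_eqVlt; apply/orP; left; apply/eqP; field.
  by rewrite expf_neq0// gt_eqF.
have [j jl] : exists j : nat, H / l < j%:R.
  by exists (Num.truncn (H / l)).+1; exact: real_truncnS_gt (num_real _).
have := up j; rewrite -ler_pdivlMr//; apply/negP; rewrite -ltNge.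
by apply: (lt_trans jl); rewrite -natrX ltr_nat ltn_expl.
Qed.

End ScaleEstimates.

Section CoveringsOfPositiveMass.
Context {R : realType}.
Local Notation leb := (@completed_lebesgue_measure R).

Lemma leb_bigcup_gt0 (A : set R) (F : (set R)^nat) : (0 < leb A)%E ->
  A `<=` \bigcup_n F n -> exists n, (0 < leb (F n))%E.
Proof.
move=> A0 AF; apply: contrapT => /forallNP F0; move: A0; apply/negP; rewrite -leNgt.
apply: (le_trans (leb_le AF)); apply: (le_trans (leb_bigcup F)).
rewrite eseries0// => n _ _; apply/eqP; rewrite eq_le leb_ge0 andbT leNgt.
by apply/negP; exact: F0.
Qed.

(** Borel-Cantelli for the outer measure. *)
Lemma leb_limsup_null (A : set R) (G : (set R)^nat) (b q : R) :
  0 <= b -> 0 < q -> q < 1 -> (forall j, (leb (G j) <= (b * q ^+ j)%:E)%E) ->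
  (forall J, A `<=` \bigcup_j G (J + j)%N) -> leb A = 0%E.
Proof.
move=> b0 q0 q1 Gb AG; have q10 : 0 < 1 - q by rewrite subr_gt0.
have tail J : (leb A <= (b * q ^+ J / (1 - q))%:E)%E.
  apply: (le_trans (leb_le (AG J))); apply: (le_trans (leb_bigcup _)).
  apply: lime_le; first by apply: is_cvg_nneseries => n _ _; exact: leb_ge0.
  apply: nearW => n; apply: (@le_trans _ _ (\sum_(0 <= j < n) (b * q ^+ (J + j))%:E)%E).
    by apply: lee_sum => j _; exact: Gb.
  rewrite sumEFin lee_fin; under eq_bigr do rewrite exprD mulrA.
  rewrite -mulr_sumr; apply: ler_wpM2l; first by rewrite mulr_ge0// exprn_ge0// ltW.
  rewrite -[leRHS]mul1r ler_pdivlMr// big_mkord mulrC.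
  by rewrite -opprB mulNr -subrX1 opprB gerBl exprn_ge0// ltW.
apply/eqP; rewrite eq_le leb_ge0 andbT; apply/lee_addgt0Pr => e e0; rewrite add0e.
have nq : `|q| < 1 by rewrite gtr0_norm.
have b1 : 0 < b + 1 by rewrite ltr_wpDl.
have e1 : 0 < e * (1 - q) / (b + 1) by rewrite divr_gt0// mulr_gt0.
have [J _ HJ] : \forall J \near \oo, q ^+ J < e * (1 - q) / (b + 1).
  exact: (cvgr_lt _ (cvg_expr nq) _ e1).
apply: (le_trans (tail J)); rewrite lee_fin ler_pdivrMr//.
have := HJ J (leqnn _); rewrite /= ltr_pdivlMr// => /ltW h.
apply: le_trans h; rewrite mulrC; apply: ler_wpM2l; first by rewrite exprn_ge0// ltW.
by rewrite lerDl.
Qed.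

End CoveringsOfPositiveMass.

Section LowExponent.
Context {R : realType} {d : nat}.
Variables (mu : {finite_measure set (borelR R d) -> \bar R}).
Variables (M : R) (chi : R -> R -> 'rV[R]_d) (N : set (lebesgueR R)).
Local Notation leb := (@completed_lebesgue_measure R).
Implicit Types theta t r : R.
Local Notation X := (endpoint chi).
Local Notation exit := (exit_time chi).

Hypothesis tN : tame_plan M chi N.
Hypothesis M0 : 0 < M.
Hypothesis mult_gt0 : forall theta t, Theta0 M N theta ->
  0 <= t < stop_time chi theta -> 0 < mult M chi theta t.
Hypothesis X_supp : forall theta, Theta0 M N theta -> msupp mu (X theta).
Hypothesis X_neq0 : forall theta, Theta0 M N theta -> X theta != 0.
Hypothesis endpoint_law : forall V : set (borelR R d), measurable V ->
  mu V = leb [set theta | Theta M theta /\ V (endpoint chi theta)].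
Variables (D : nat) (C : R).
Hypothesis D_gt0 : (0 < D)%N.
Hypothesis C_gt0 : 0 < C.
Hypothesis upper_regular : forall x r, msupp mu x -> 0 <= r <= 1 ->
  (mu (eball x r) <= (C * r ^+ D)%:E)%E.

Variables (f : R -> R) (A B : R).
Hypothesis A0 : 0 <= A.
Hypothesis B0 : 0 <= B.
Hypothesis f_ge0 : forall z, 0 <= z -> 0 <= f z.
Hypothesis f_mono : forall x y, 0 <= x -> x <= y -> f x <= f y.
Hypothesis f_lin : forall z, 0 <= z -> f z <= A + B * z.
Hypothesis f_cont : {within `[0, +oo[, continuous f}.
Variable alpha : R.
Hypothesis alpha01 : 0 <= alpha <= 1.
Local Notation W := (weight M chi f).
Local Notation Z := (fiber_energy M chi f alpha).
Local Notation E := (weighted_energy M chi f alpha).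

Lemma leb_Theta0 : leb (Theta0 M N) = M%:E.
Proof. by rewrite /Theta0 -(leb_off_N tN) (leb_Theta tN). Qed.

Definition cheap_far (k : nat) : set R := [set theta | Theta0 M N theta /\
  ((Z theta <= (k.+1%:R : R)%:E)%E /\ (k.+1%:R : R)^-1 < enorm (X theta))].

(** If almost every fibre with endpoint away from the origin had infinite cost, then so
    would the plan. *)
Lemma cheap_far_gt0 : E != +oo%E -> exists k, (0 < leb (cheap_far k))%E.
Proof.
move=> Efin; apply: contrapT => /forallNP H; move/eqP: Efin; apply.
pose F := cheap_far.
have F0 : leb (\bigcup_k F k) = 0%E.
  apply/eqP; rewrite eq_le leb_ge0 andbT leNgt; apply/negP => h.
  by have [k Fk] := leb_bigcup_gt0 h (@subset_refl _ _); exact: (H k).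
have [V [mV V0 FV]] := null_cover F0.
have EZ (K : nat) : (((K%:R : R) * M)%:E <= E)%E.
  have -> : (((K%:R : R) * M)%:E = \int[leb]_(theta in Theta M) (cst (K%:R : R)%:E) theta)%E.
    have mT : measurable (Theta M : set (lebesgueR R)) by exact: measurable_Theta.
    by rewrite EFinM -(leb_Theta tN); exact/esym/(@integral_cst _ _ _ leb _ mT (K%:R : R)%:E).
  apply: ge0_le_integral_ae => [theta _|theta _|].
  - by rewrite lee_fin.
  - exact: fiber_energy_ge0.
  exists (N `|` V); split.
  - by apply: measurableU => //; exact: (tame_null tN).
  - apply/eqP; rewrite eq_le leb_ge0 andbT (le_trans (lebU _ _))//.
    by rewrite V0 (tame_null0 tN) adde0.
  move=> theta /= /not_implyP[Tt KZ]; apply: contrapT => /not_orP[nN nV].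
  have T0 : Theta0 M N theta by split.
  apply: nV; apply: FV; have X0 : 0 < enorm (X theta).
    by rewrite lt_neqAle enorm_ge0 andbT eq_sym enorm_eq0 X_neq0.
  have [k1 k1P] := exists_natSinv_lt X0.
  exists (maxn K k1) => //; split => //; split.
    apply: (@le_trans _ _ (K%:R : R)%:E); last by rewrite lee_fin ler_nat ltnW// ltnS leq_maxl.
    by rewrite leNgt; apply/negP => /ltW.
  by apply: le_lt_trans k1P; rewrite lef_pV2 ?posrE// ler_nat ltnS leq_maxr.
have [E1|E1] := eqVneq E +oo%E; first exact: E1.
have E0 : (0 <= E)%E by apply: integral_ge0 => theta _; exact: fiber_energy_ge0.
have Ef : E \is a fin_num by rewrite ge0_fin_numE// ltey.
have := EZ (Num.truncn (fine E / M)).+1.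
rewrite -(fineK Ef) lee_fin -ler_pdivlMr// leNgt.
by rewrite (real_truncnS_gt (num_real _)).
Qed.

(** The multiplicity is nonincreasing along the fibre. So the density of the cost after the
    exit is at least its value at the exit. *)
Lemma exit_mult_ge theta r (K : R) : Theta0 M N theta -> 0 < r -> r < enorm (X theta) ->
  alpha < 1 -> 0 < K -> (Z theta <= K%:E)%E ->
  (r / (2 * K)) `^ (1 - alpha)^-1 <= mult M chi theta (exit theta r).
Proof.
move=> Tt r0 rX a1 K0 ZK; have gt := tame_fiber tN Tt.1 Tt.2; have [gL _ _] := gt.
have [t0 tt ts Lt Ltt] := exit_length tN Tt r0 rX.
have m0 : 0 < mult M chi theta (exit theta r).
  by apply: mult_gt0 => //; rewrite t0 (le_lt_trans tt ts).
apply: mass_from_cost => //; rewrite -lee_fin; apply: le_trans ZK.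
have L0 : 0 < arc_length (chi theta) (exit theta r).
  by apply: lt_le_trans Lt; rewrite subr_gt0.
apply: (@le_trans _ _ (\sum_(i < 1 | xpredT i) mult M chi theta (exit theta r) `^ (alpha - 1) *
   (arc_length (chi theta) (exit theta (r / 2)) - arc_length (chi theta) (exit theta r)))%:E).
  rewrite big_ord1 lee_fin; apply: ler_wpM2l; first exact: powR_ge0.
  by rewrite lerBrDl; exact: Ltt.
apply: (fiber_energy_ge tN (P := xpredT) (a := fun=> exit theta r)
  (b := fun=> exit theta (r / 2)) (c := fun=> mult M chi theta (exit theta r) `^ (alpha - 1)) Tt).
- by move=> i _; rewrite t0 tt powR_ge0 (ltW ts).
- by move=> i j _ _ _ _ _; rewrite !ord1.
move=> i t _ /andP[t1 t2]; have t_0 := le_trans t0 t1.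
have Lt' := arc_length_homo gL t0 t1.
have L_0 : 0 < arc_length (chi theta) t by exact: lt_le_trans Lt'.
apply: (mult_density_ge tN A0 B0 f_ge0 f_mono f_lin f_cont alpha01 Tt t_0 L_0).
  by apply: mult_gt0 => //; rewrite t_0 (le_lt_trans t2 ts).
have := mass_prefix tN _ (arc_path_path_le t0 t_0 Lt').
by apply; exact: L0.
Qed.


Theorem energy_low_exponent : alpha < 1 - D%:R^-1 -> E = +oo%E.
Proof.
move=> aD; apply: contrapT => /eqP Einf.
have [a0 _] := andP alpha01.
have D0 : 0 < D%:R :> R by rewrite ltr0n.
have a1 : alpha < 1 by apply: (lt_trans aD); rewrite ltrBlDr ltrDl invr_gt0.
have a10 : 0 < 1 - alpha by rewrite subr_gt0.
pose p := (1 - alpha)^-1.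
have p0 : 0 < p by rewrite invr_gt0.
have pD : p < D%:R by rewrite -[ltRHS]invrK ltf_pV2 ?posrE ?invr_gt0// ltrBrDl -ltrBrDr.
have [k Gk] := cheap_far_gt0 Einf; set G := cheap_far k in Gk.
pose K : R := k.+1%:R; have K0 : 0 < K by rewrite ltr0n.
have E0 : (0 <= E)%E by apply: integral_ge0 => theta _; exact: fiber_energy_ge0.
have Ef : E \is a fin_num by rewrite ge0_fin_numE// ltey.
pose e := fine E; have eE : E = e%:E by rewrite fineK.
pose r0 := K^-1 / 4; pose r (j : nat) := r0 / 2 ^+ j.
have r0_gt0 : 0 < r0 by rewrite divr_gt0// invr_gt0.
have r_gt0 j : 0 < r j by rewrite divr_gt0// exprn_gt0.
have r_le j : r j <= r0.
  by rewrite ler_pdivrMr ?exprn_gt0// ler_peMr ?(ltW r0_gt0)// exprn_ege1// ler1n.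
have K1 : K^-1 <= 1 by rewrite invf_le1// ler1n.
have r4 j : 4 * r j <= 1.
  apply: le_trans K1; rewrite mulrC -ler_pdivlMr//; exact: r_le.
have rX j theta : G theta -> r j < enorm (X theta).
  move=> [_ [_ KX]]; apply: le_lt_trans KX; apply: (le_trans (r_le j)).
  by rewrite /r0 ler_pdivrMr// ler_peMr ?invr_ge0 ?(ltW K0)// ler1n.
have rS j : r j.+1 = r j / 2 by rewrite /r exprSr invfM mulrA.
pose m (theta : R) j := mult M chi theta (exit theta (r j)).
pose L j := (r j / (2 * K)) `^ p.
have L0 j : 0 < L j by rewrite powR_gt0// divr_gt0// mulr_gt0.
have mL theta j : G theta -> L j <= m theta j.
  by move=> Gt; have [Tt [ZK _]] := Gt; apply: exit_mult_ge => //; exact: rX.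
pose kappa : R := 2 * 2 `^ p.
have kappa0 : 0 < kappa by rewrite mulr_gt0// powR_gt0.
pose Gj j : set R := [set theta | G theta /\ m theta j <= kappa * m theta j.+1].
pose c := ((2 * K)^-1 `^ p) `^ alpha / (2 * kappa).
have c0 : 0 < c by rewrite divr_gt0 ?powR_gt0 ?invr_gt0 ?mulr_gt0.
have cE j : L j `^ alpha * (r j / 2) / kappa = c * r j `^ p.
  have pa : p = p * alpha + 1.
    have h : p * (1 - alpha) = 1 by rewrite mulVf// gt_eqF.
    by rewrite -[X in _ = _ + X]h; ring.
  have rj := ltW (r_gt0 j); have iK : 0 <= (2 * K)^-1 by rewrite invr_ge0 mulr_ge0// ltW.
  have -> : L j = r j `^ p * (2 * K)^-1 `^ p by exact: powRM.
  rewrite (powRM _ (powR_ge0 _ _) (powR_ge0 _ _)).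
  have rp : r j `^ p = (r j `^ p) `^ alpha * r j.
    have cond : (p * alpha + 1 == 0) ==> (r j != 0) by rewrite (gt_eqF (r_gt0 j)) implybT.
    by rewrite [in LHS]pa (powRD cond) powRrM (powRr1 rj).
  by rewrite [in RHS]rp /c; apply: branch_cost_scale; rewrite gt_eqF.
pose b := e * C * 4 ^+ D / c * r0 `^ (D%:R - p); pose q : R := 2^-1 `^ (D%:R - p).
have e0 : 0 <= e by rewrite fine_ge0.
have bc : 0 <= e * C * 4 ^+ D / c.
  apply: divr_ge0 (ltW c0); apply: mulr_ge0; last exact: exprn_ge0.
  exact: mulr_ge0 e0 (ltW C_gt0).
have b0 : 0 <= b by exact: mulr_ge0 bc (powR_ge0 _ _).
have Gb j : (leb (Gj j) <= (b * q ^+ j)%:E)%E.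
  have GT : Gj j `<=` Theta M by move=> theta [[[Tt _] _] _].
  have Gf := leb_sub_Theta_fin tN GT; rewrite -(fineK Gf) lee_fin.
  set g := fine _; have [g0|g0] := leP g 0.
    by apply: (le_trans g0); rewrite mulr_ge0 ?exprn_ge0 ?powR_ge0.
  have gG : (g%:E <= leb (Gj j))%E by rewrite fineK.
  have GS theta : Gj j theta -> Theta M theta /\ msupp mu (X theta).
    by move=> [[Tt _] _]; split; [exact: Tt.1|exact: X_supp].
  have [n [th [thG sep gn]]] :=
    separated_endpoints endpoint_law C_gt0 upper_regular GS g0 gG (r_gt0 j) (r4 j).
  have thT i : Theta0 M N (th i) by have [[]] := thG i.
  have thX i : r j < enorm (X (th i)) by apply: rX; have [] := thG i.
  have H := energy_ge_exits tN mult_gt0 A0 B0 f_ge0 f_mono f_lin f_cont alpha01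
    (r_gt0 j) thT thX sep.
  have ne : n%:R * (c * r j `^ p) <= e.
    rewrite -lee_fin -eE; apply: le_trans H; rewrite lee_fin mulr_natl.
    rewrite -[X in _ *+ X](card_ord n) -sumr_const; apply: ler_sum => i _.
    rewrite -cE; have [Gi mi] := thG i; have mj := lt_le_trans (L0 j) (mL _ j Gi).
    apply: (branch_cost_ge a0 mj (r_gt0 j) kappa0 (ltW (L0 j)) (mL _ j Gi)).
    by rewrite /m rS in mi.
  apply: le_trans (packing_cost_le c0 (r_gt0 j) (ltW C_gt0) ne gn) _.
  rewrite /b -[leRHS]mulrA. apply: (ler_wpM2l bc).
  have -> : r j = r0 * 2^-1 ^+ j by rewrite /r exprVn.
  have hj : 0 <= 2^-1 ^+ j :> R by rewrite exprn_ge0// invr_ge0.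
  have h2 : 0 <= 2^-1 :> R by rewrite invr_ge0.
  rewrite (powRM _ (ltW r0_gt0) hj) -(powR_mulrn _ h2) powRAC.
  by rewrite (powR_mulrn _ (powR_ge0 _ _)).
have q0 : 0 < q by rewrite powR_gt0// invr_gt0.
have q1 : q < 1.
  have h1 : 1 `^ (D%:R - p) = 1 :> R by rewrite powR1.
  rewrite -[ltRHS]h1; apply: gt0_ltr_powR; rewrite ?nnegrE ?invr_ge0 ?subr_gt0//.
  by rewrite invf_lt1// ltr1n.
suff GJ J : G `<=` \bigcup_j Gj (J + j)%N.
  by have := leb_limsup_null b0 q0 q1 Gb GJ => G0; rewrite G0 ltxx in Gk.
move=> theta Gt; have [Tt [ZK _]] := Gt.
have rJ j : r (J + j)%N = r (J + 0)%N / 2 ^+ j by rewrite addn0 /r exprD invfM mulrA.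
have K2 : 0 < 2 * K by rewrite mulr_gt0.
have [j jP] := @slow_scale _ (fun j => m theta (J + j)%N) (fun j => r (J + j)%N) M p (2 * K)
  rJ (r_gt0 _) K2 (fun j => mass_le tN _) (fun j => mL theta _ Gt).
exists j; first exact: I.
split; first exact: Gt.
by have := jP; rewrite addnS; apply.
Qed.

End LowExponent.

(** * Steep flux functions *)

Section Profile.
Context {R : realType}.
Implicit Types a b c y h : R.

Lemma expr_diff_le n a b : 0 <= b -> b <= a ->
  a ^+ n.+1 - b ^+ n.+1 <= n.+1%:R * (a - b) * a ^+ n.
Proof.
move=> b0 ba; have a0 := le_trans b0 ba; have ab : 0 <= a - b by rewrite subr_ge0.
elim: n => [|n IH]; first by rewrite !expr1 expr0 mul1r mulr1.
have -> : a ^+ n.+2 - b ^+ n.+2 = a * (a ^+ n.+1 - b ^+ n.+1) + (a - b) * b ^+ n.+1.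
  by rewrite !(exprS _ n.+1); ring.
have -> : n.+2%:R * (a - b) * a ^+ n.+1 =
    a * (n.+1%:R * (a - b) * a ^+ n) + (a - b) * a ^+ n.+1.
  by rewrite -natr1 (exprS a n); ring.
by apply: lerD; apply: ler_wpM2l => //; apply: lerXn2r.
Qed.

Variables (f : R -> R) (n : nat) (c y0 : R).
Hypothesis f_mono : forall x y, 0 <= x -> x <= y -> f x <= f y.
Hypothesis c_gt0 : 0 < c.
Hypothesis y0_gt0 : 0 < y0.
Hypothesis f_low : forall y, 0 < y -> y < y0 -> c * y ^+ n <= f (y ^+ n.+1).

Let kappa := c / n.+1%:R.

Definition profile (x : R) : R := (kappa * x) ^+ n.+1.

Lemma kappa_gt0 : 0 < kappa. Proof. by rewrite divr_gt0. Qed.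

Lemma profile0 : profile 0 = 0. Proof. by rewrite /profile mulr0 expr0n. Qed.

Lemma profile_mono s t : 0 <= s -> s <= t -> profile s <= profile t.
Proof.
move=> s0 st; have k0 := ltW kappa_gt0; have t0 := le_trans s0 st.
by apply: lerXn2r; rewrite ?nnegrE; [exact: mulr_ge0|exact: mulr_ge0|exact: ler_wpM2l].
Qed.

Lemma profile_continuous : continuous profile.
Proof.
move=> x; apply: (@continuous_comp _ _ _ (fun x => kappa * x) (fun u : R => u ^+ n.+1)).
  exact: mulrl_continuous.
exact: exprn_continuous.
Qed.

(** The profile grows at most at rate [f]: its derivative
    [c * (kappa * x) ^+ n] is at most [f (profile x)]. *)
Lemma profile_step eps cap : 0 < eps -> 0 < cap -> kappa * (2 * cap) < y0 ->
  exists2 d0, 0 < d0 & forall y h, 0 <= y -> y <= cap -> 0 <= h -> h <= d0 ->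
    profile (y + h) <= profile y + h * f (eps + profile y).
Proof.
move=> eps0 cap0 capy; have k0 := kappa_gt0.
have Y0 : 0 < c * y0 ^+ n by rewrite mulr_gt0// exprn_gt0.
exists (Num.min cap (eps / (c * y0 ^+ n))); first by rewrite lt_min cap0 divr_gt0.
move=> y h y_ge0 ycap h_ge0; rewrite le_min => /andP[hcap heps].
move: (h_ge0); rewrite le_eqVlt => /orP[/eqP <-|h0]; first by rewrite addr0 mul0r addr0.
pose a := kappa * (y + h); pose b := kappa * y.
have b0 : 0 <= b by rewrite mulr_ge0// ltW.
have ba : b <= a by rewrite /a /b ler_pM2l// lerDl.
have a0 : 0 < a by rewrite mulr_gt0// ltr_wpDl.
have ay : a < y0.
  apply: le_lt_trans capy; rewrite ler_pM2l// mulr_natl mulr2n; exact: lerD.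
have ab : a - b = kappa * h by rewrite /a /b; ring.
have diff : a ^+ n.+1 - b ^+ n.+1 <= h * (c * a ^+ n).
  apply: (le_trans (expr_diff_le n b0 ba)); rewrite ab.
  by rewrite /kappa mulrA (mulrCA _ c) mulfV ?pnatr_eq0// mulr1 (mulrC c) mulrA.
have an : a ^+ n <= y0 ^+ n by apply: lerXn2r; rewrite ?nnegrE ltW.
have close : a ^+ n.+1 <= eps + b ^+ n.+1.
  rewrite -lerBlDr; apply: (le_trans diff).
  apply: (@le_trans _ _ (h * (c * y0 ^+ n))); first by apply: ler_wpM2l => //; apply: ler_wpM2l => //; exact: ltW.
  by rewrite -ler_pdivlMr.
rewrite -lerBlDl; apply: (le_trans diff); apply: ler_wpM2l => //.
apply: (le_trans (f_low a0 ay)); apply: f_mono => //.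
by rewrite exprn_ge0// ltW.
Qed.

Lemma packing_profile_ge (C K g r : R) (N : nat) : 0 < C -> 0 < r ->
  g <= N%:R * (C * (4 * r) ^+ n.+2) -> r * (4 * C * K) <= g * (kappa / 8) ^+ n.+1 ->
  K <= N%:R * profile (r / 2).
Proof.
move=> C0 r0 gN rK; have k0 := kappa_gt0.
have Cr : 0 < 4 * C * r by rewrite !mulr_gt0.
rewrite -(ler_pM2l Cr).
have -> : 4 * C * r * K = r * (4 * C * K) by ring.
apply: (le_trans rK); apply: (@le_trans _ _ (N%:R * (C * (4 * r) ^+ n.+2) * (kappa / 8) ^+ n.+1)).
  by apply: ler_wpM2r gN; rewrite exprn_ge0// divr_ge0// ltW.
rewrite le_eqVlt; apply/orP; left; apply/eqP.
have -> : profile (r / 2) = (4 * r) ^+ n.+1 * (kappa / 8) ^+ n.+1.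
  by rewrite /profile -exprMn; congr (_ ^+ _); field.
by rewrite (exprS _ n.+1); ring.
Qed.

End Profile.

Section PowerLowerBound.
Context {R : realType}.

Lemma limf_einf_gt0_near (f : R -> R) (beta : R) :
  (0 < limf_einf (fun z => (z `^ (- beta) * f z)%:E) 0^'+)%E ->
  exists c y : R, [/\ 0 < c, 0 < y & forall z, 0 < z -> z < y -> c * z `^ beta <= f z].
Proof.
rewrite limf_einfE => /ereal_sup_gt[_ [U U0 <-]] /= infU.
have [c c0 cU] : exists2 c : R, 0 < c & forall z, U z -> c <= z `^ (- beta) * f z.
  have [c c0 cI] : exists2 c : R, 0 < c & (c%:E <= ereal_inf
      ((fun z => (z `^ (- beta) * f z)%:E) @` U))%E.
    move: infU; case: (ereal_inf _) => [c c0|_|//]; first by exists c; rewrite // -lte_fin.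
    by exists 1; rewrite // leey.
  exists c => // z Uz; rewrite -lee_fin; apply: (le_trans cI).
  by apply: ereal_inf_lbound; exists z.
have [y y0 yU] : exists2 y : R, 0 < y & forall z, 0 < z -> z < y -> U z.
  move: U0 => [y /= y0 yU]; exists y => // z z0 zy; apply: yU => //=.
  by rewrite sub0r normrN gtr0_norm.
exists c, y; split => // z z0 zy; have := cU z (yU z z0 zy).
by rewrite powRN mulrC ler_pdivlMr ?powR_gt0.
Qed.

(** With [z = y ^ n.+1], the power [z ^ beta] is at least [y ^ n] for [y <= 1]. *)
Lemma power_lower_bound (f : R -> R) (beta : R) (n : nat) :
  beta < 1 - n.+1%:R^-1 ->
  (0 < limf_einf (fun z => (z `^ (- beta) * f z)%:E) 0^'+)%E ->
  exists c y0 : R, [/\ 0 < c, 0 < y0 &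
    forall y, 0 < y -> y < y0 -> c * y ^+ n <= f (y ^+ n.+1)].
Proof.
move=> bn /limf_einf_gt0_near[c [y0 [c0 y00 cf]]].
exists c, (Num.min 1 y0); split => //; first by rewrite lt_min ltr01.
move=> y y_gt0; rewrite lt_min => /andP[y1 yy0].
have yn : y ^+ n.+1 <= y by rewrite exprS ger_pMr// exprn_ile1// ltW.
apply: le_trans (cf _ (exprn_gt0 _ y_gt0) (le_lt_trans yn yy0)).
apply: ler_wpM2l; first exact: ltW.
rewrite -!powR_mulrn ?(ltW y_gt0)// -powRrM; apply: ger_powR.
  by rewrite y_gt0 ltW.
have n0 : 0 < n.+1%:R :> R by rewrite ltr0n.
have h : n.+1%:R * beta <= n.+1%:R * (1 - n.+1%:R^-1) by rewrite ler_pM2l// ltW.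
apply: (le_trans h); rewrite mulrBr mulr1 mulfV ?gt_eqF//.
by rewrite -natr1 addrK.
Qed.

End PowerLowerBound.

Section Trunk.
Context {R : realType} {d : nat}.
Variables (M : R) (chi : R -> R -> 'rV[R]_d) (N : set (lebesgueR R)).
Local Notation leb := (@completed_lebesgue_measure R).
Local Notation path := (Defs.path R d).
Implicit Types (theta t rho : R) (p q : path).
Local Notation X := (endpoint chi).
Local Notation mass := (mass M chi).
Local Notation fibers0 := (fibers0 M chi N).

Hypothesis tN : tame_plan M chi N.
Hypothesis mult_gt0 : forall theta t, Theta0 M N theta ->
  0 <= t < stop_time chi theta -> 0 < mult M chi theta t.

Lemma fiber_stem theta rho : Theta0 M N theta -> 0 < rho -> rho < enorm (X theta) ->
  exists q, [/\ q.1 = rho, fibers0 q theta & 0 < mass q].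
Proof.
move=> Tt rho0 rhoX; have gt := tame_fiber tN Tt.1 Tt.2; have [gL g0 _] := gt.
have [s0 sP] := stop_timeP gt; set T := stop_time chi theta in s0.
have LT : rho < arc_length (chi theta) T.
  apply: (lt_le_trans rhoX); have := arc_length_dist gL (lexx 0) s0.
  by rewrite arc_length0 subr0 g0 subr0.
have [c0 cT cL] := crossing_spec gL (ltW rho0) s0 (ltW LT).
set t := crossing (chi theta) rho in c0 cT cL.
have t0 : 0 < t.
  rewrite lt_neqAle c0 andbT; apply/eqP => t_0; move: rho0.
  by rewrite -cL -t_0 arc_length0 ltxx.
have tT : t < T.
  rewrite lt_neqAle cT andbT; apply/eqP => tT; move: LT.
  by rewrite -tT cL ltxx.
exists (arc_path (chi theta) t); split; first exact: cL.
  by split; [split; [exact: Tt.1|exists t]|].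
by apply: (mult_gt0 Tt); rewrite c0 tT.
Qed.

(** Distinct paths of the same length are incomparable. So only countably many of them
    carry mass, and some fibres of [G] of positive measure follow the same one. *)
Lemma common_trunk (G : set R) rho : 0 < rho -> (0 < leb G)%E ->
  (forall theta, G theta -> Theta0 M N theta /\ rho < enorm (X theta)) ->
  exists q, [/\ is_arc_length_path q, q.1 = rho & (0 < leb (fibers0 q `&` G))%E].
Proof.
move=> rho0 G0 GT.
have /choice[q qP] : forall theta, exists q, G theta ->
    [/\ q.1 = rho, fibers0 q theta & 0 < mass q].
  move=> theta; have [Gt|nG] := pselect (G theta); last by exists (0, fun=> 0).
  by have [Tt rX] := GT _ Gt; have [q h] := fiber_stem Tt rho0 rX; exists q.
pose S k : set path := [set p | [/\ is_arc_length_path p, p.1 = rho & k.+1%:R^-1 <= mass p]].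
have finS k : finite_set (S k).
  apply: (@finite_antichain _ _ _ _ _ tN k.+1%:R^-1) => //.
    by move=> p [].
  move=> p p' [_ p1 _] [pa' p1' _] pp'; apply: (path_le_length_eq pa' pp').
  by rewrite p1 p1'.
have [k Gk] : exists k, (0 < leb (G `&` [set theta | S k (q theta)]))%E.
  apply: leb_bigcup_gt0 G0 _ => theta Gt; have [q1 qt q0] := qP _ Gt.
  have [k kP] := exists_natSinv_lt q0.
  exists k => //; split => //; split => //; last exact: ltW.
  exact: (fibers0_path tN qt).
pose p0 : path := (0, fun=> 0).
have /finite_seqP[s sE] := finS k.
have [j jP] : exists j, (0 < leb (if (j < size s)%N then
    fibers0 (nth p0 s j) `&` G else set0))%E.
  apply: leb_bigcup_gt0 Gk _ => theta [Gt St].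
  have qs : q theta \in s by move: St; rewrite sE.
  exists (index (q theta) s) => //; rewrite index_mem qs nth_index//.
  by split => //; have [] := qP _ Gt.
move: jP; case: ifPn => [js jP|_]; last by rewrite leb0 ltxx.
exists (nth p0 s j).
have : S k (nth p0 s j) by rewrite sE; exact: mem_nth.
by case.
Qed.

End Trunk.

Section SteepCost.
Context {R : realType} {d : nat}.
Variables (mu : {finite_measure set (borelR R d) -> \bar R}).
Variables (M : R) (chi : R -> R -> 'rV[R]_d) (N : set (lebesgueR R)).
Local Notation leb := (@completed_lebesgue_measure R).
Local Notation path := (Defs.path R d).
Implicit Types (theta t r : R) (q : path).
Local Notation X := (endpoint chi).
Local Notation exit := (exit_time chi).
Local Notation mass := (mass M chi).
Local Notation fibers0 := (fibers0 M chi N).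

Hypothesis tN : tame_plan M chi N.
Hypothesis M0 : 0 < M.
Hypothesis mult_gt0 : forall theta t, Theta0 M N theta ->
  0 <= t < stop_time chi theta -> 0 < mult M chi theta t.
Hypothesis X_supp : forall theta, Theta0 M N theta -> msupp mu (X theta).
Hypothesis X_neq0 : forall theta, Theta0 M N theta -> X theta != 0.
Hypothesis endpoint_law : forall V : set (borelR R d), measurable V ->
  mu V = leb [set theta | Theta M theta /\ V (endpoint chi theta)].
Variables (n : nat) (C : R).
Hypothesis C_gt0 : 0 < C.
Hypothesis upper_regular : forall x r, msupp mu x -> 0 <= r <= 1 ->
  (mu (eball x r) <= (C * r ^+ n.+2)%:E)%E.

Variables (f : R -> R) (A B : R).
Hypothesis A0 : 0 <= A.
Hypothesis B0 : 0 <= B.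
Hypothesis f_ge0 : forall z, 0 <= z -> 0 <= f z.
Hypothesis f_mono : forall x y, 0 <= x -> x <= y -> f x <= f y.
Hypothesis f_lin : forall z, 0 <= z -> f z <= A + B * z.
Hypothesis f_cont : {within `[0, +oo[, continuous f}.
Variable alpha : R.
Hypothesis alpha01 : 0 <= alpha <= 1.
Variables (c y0 : R).
Hypothesis c_gt0 : 0 < c.
Hypothesis y0_gt0 : 0 < y0.
Hypothesis f_low : forall y, 0 < y -> y < y0 -> c * y ^+ n <= f (y ^+ n.+1).
Local Notation W := (weight M chi f).
Local Notation E := (weighted_energy M chi f alpha).
Local Notation kappa := (c / n.+1%:R).

Section Trunk.
Variables (rho : R) (q0 : path).
Hypothesis rho0 : 0 < rho.
Hypothesis q0a : is_arc_length_path q0.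
Hypothesis q0_len : q0.1 = rho / 2.
Let G : set R := [set theta | fibers0 q0 theta /\ rho < enorm (X theta)].
Hypothesis G_gt0 : (0 < leb G)%E.

Let half0 : 0 < q0.1. Proof. by rewrite q0_len divr_gt0. Qed.

Let GT theta : G theta -> Theta0 M N theta. Proof. by case=> -[]. Qed.

Lemma trunk_mass_gt0 : 0 < mass q0.
Proof.
rewrite -lte_fin (massE tN) -(leb_fibers0 tN); apply: (lt_le_trans G_gt0).
by apply: leb_le => theta [].
Qed.

Lemma trunk_le_tip theta r : G theta -> 0 < r -> r <= rho -> path_le q0 (tip chi theta r).
Proof.
move=> Gt r0 rr; have Tt := GT Gt; have [qt rX] := Gt.
have [_ _ [t t0 tq]] := fibers0P tN qt.
have rX' : r < enorm (X theta) by apply: le_lt_trans rX.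
have [e0 ee _ _ _] := exit_length tN Tt r0 rX'.
have tl := tip_length tN Tt r0 rX'.
rewrite -tq; apply: arc_path_path_le; [exact: ltW|exact: le_trans ee|].
have -> : arc_length (chi theta) t = rho / 2 by rewrite -q0_len -tq.
apply: (le_trans _ tl); move: rX rr; move: (enorm _) => u; lra.
Qed.

(** Many separated tips grow out of the common trunk. Each of them contributes the
    profile at [r / 2] to the weight on the trunk. *)
Lemma trunk_weight_ge r (k : nat) (th : 'I_k -> R) : 0 < r -> r <= rho / 2 ->
  kappa * r < y0 -> (forall i, G (th i)) ->
  (forall i j, i != j -> 4 * r <= enorm (X (th i) - X (th j))) ->
  forall theta t, fibers0 q0 theta -> 0 <= t ->
    0 < arc_length (chi theta) t -> arc_length (chi theta) t <= q0.1 ->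
    arc_path (chi theta) t = cut q0 (arc_length (chi theta) t) ->
    ((k%:R * profile n c (r / 2))%:E <= W theta t)%E.
Proof.
move=> r0 rrho ry Gth sep theta t qt t0 L0 Lq pE.
have r20 : 0 < r / 2 by rewrite divr_gt0.
have rr : r <= rho by apply: (le_trans rrho); rewrite ler_pdivrMr// ler_peMr ?ler1n// ltW.
have Tth i := GT (Gth i).
have rX i : r < enorm (X (th i)) by have [_ h] := Gth i; exact: le_lt_trans h.
pose Q i := tip chi (th i) r.
have Qa i : is_arc_length_path (Q i) by exact: (tip_path tN (Tth i) r0 (rX i)).
have Qm i : 0 < mass (Q i) by exact: (tip_mass tN mult_gt0 (Tth i) r0 (rX i)).
have Ql i : q0.1 + r / 2 <= (Q i).1.
  apply: le_trans (tip_length tN (Tth i) r0 (rX i)); rewrite q0_len.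
  have [_ h] := Gth i; move: h rrho; move: (enorm _) => u; lra.
have Q0 i : 0 < (Q i).1 by apply: lt_le_trans (Ql i); exact: addr_gt0 half0 r20.
pose eps := \big[Num.min/mass q0]_(i < k) mass (Q i).
have eps0 : 0 < eps.
  rewrite /eps; elim/big_ind: _ => [|u v u0 v0|i _]; last exact: Qm.
    exact: trunk_mass_gt0.
  by rewrite lt_min u0.
have epsQ i : eps <= mass (Q i) by exact: bigmin_le_cond.
have epsq : eps <= mass q0 by exact: bigmin_le_id.
have capy : kappa * (2 * (r / 2)) < y0 by rewrite (mulrC 2) divfK.
have [d0 d00 zstep] := profile_step f_mono c_gt0 y0_gt0 f_low eps0 r20 capy.
pose q := arc_path (chi theta) t; have qq0 : path_le q q0 by split.
have mq : eps <= mass q by apply: (le_trans epsq); apply: (mass_prefix tN _ qq0); exact: L0.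
have [_ Tt _] := fibers0P tN qt.
have [b [w [Bb /andP[ab bb] bq bw wE]]] :=
  weight_eps_spec tN A0 B0 f_ge0 f_mono f_lin f_cont eps0 Tt t0 L0 mq.
have Qx i s : 0 <= s -> (Q i).1 - r / 2 <= s -> s <= (Q i).1 ->
    enorm ((Q i).2 s - X (th i)) <= r.
  by move=> s0 s1 s2; exact: (tip_near tN (Tth i) r0 (rX i) s0 s1 s2).
have := potential_le_excess tN A0 B0 f_ge0 f_mono f_lin eps0 Qa epsQ Q0 r20 r0 Qx sep
  (profile0 n c) (profile_mono n c_gt0) (@profile_continuous _ n c) d00 zstep bw Bb ab bb.
rewrite bq => pot.
apply: (@le_trans _ _ (w q.1)%:E); last first.
  by apply: ereal_sup_ubound; exists eps => //; rewrite wE.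
rewrite lee_fin; apply: (@le_trans _ _ (excess (bflux M chi b) w q.1)); last first.
  rewrite /excess gerBl; exact: le_trans (ltW eps0) (fl_ge tN eps0 Bb ab bb).
apply: le_trans pot; rewrite /potential mulr_natl.
rewrite -[X in _ *+ X](card_ord k) -sumr_const; apply: ler_sum => i _.
have qQ : path_le q (Q i) by exact: path_leT qq0 (trunk_le_tip (Gth i) r0 rr).
rewrite /overlap asboolT// min_r//.
rewrite lerBrDr addrC; apply: le_trans (Ql i); exact: lerD.
Qed.

(** As [r] tends to 0, the number of tips grows like [r ^ - n.+2] and the profile of each
    decays like [r ^ n.+1] only. *)
Lemma trunk_weight_large (K : R) : 0 < K -> forall theta t, fibers0 q0 theta -> 0 <= t ->
    0 < arc_length (chi theta) t -> arc_length (chi theta) t <= q0.1 ->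
    arc_path (chi theta) t = cut q0 (arc_length (chi theta) t) ->
    (K%:E <= W theta t)%E.
Proof.
move=> K0 theta t qt t0 L0 Lq pE.
have GM : G `<=` Theta M by move=> u /GT[].
have Gf := leb_sub_Theta_fin tN GM.
pose g := fine (leb G); have gE : leb G = g%:E by rewrite fineK.
have g0 : 0 < g by rewrite -lte_fin -gE.
have k0 : 0 < kappa by rewrite divr_gt0.
have s0 : 0 < g * (kappa / 8) ^+ n.+1 / (4 * C * K).
  by rewrite divr_gt0 ?mulr_gt0 ?exprn_gt0 ?divr_gt0.
pose r := Num.min (Num.min (rho / 2) 4^-1)
   (Num.min (y0 / kappa / 2) (g * (kappa / 8) ^+ n.+1 / (4 * C * K))).
have yk : 0 < y0 / kappa / 2 by apply: divr_gt0 => //; exact: divr_gt0.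
have h4 : 0 < 4^-1 :> R by rewrite invr_gt0.
have hr : 0 < rho / 2 by exact: divr_gt0.
have r0 : 0 < r by rewrite /r !lt_min hr h4 yk s0.
have rrho : r <= rho / 2 by rewrite !ge_min lexx.
have r1 : 4 * r <= 1.
  by rewrite mulrC -ler_pdivlMr// mul1r !ge_min lexx orbT.
have ry : kappa * r < y0.
  rewrite mulrC -ltr_pdivlMr//; apply: (@le_lt_trans _ _ (y0 / kappa / 2)).
    by rewrite /r !ge_min lexx !orbT.
  by rewrite ltr_pdivrMr// ltr_pMr ?ltr1n// divr_gt0.
have rK : r * (4 * C * K) <= g * (kappa / 8) ^+ n.+1.
  by rewrite -ler_pdivlMr ?mulr_gt0// /r !ge_min lexx !orbT.
have GS u : G u -> Theta M u /\ msupp mu (X u).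
  by move=> /GT Tu; split; [exact: Tu.1|exact: X_supp].
have gG : (g%:E <= leb G)%E by rewrite gE.
have [k [th [thG sep gk]]] :=
  separated_endpoints endpoint_law C_gt0 upper_regular GS g0 gG r0 r1.
apply: le_trans (trunk_weight_ge r0 rrho ry thG sep qt t0 L0 Lq pE).
by rewrite lee_fin; exact: (packing_profile_ge c_gt0 C_gt0 r0 gk rK).
Qed.

Lemma trunk_energy_ge (K : R) : 0 < K ->
  ((mass q0 * (K `^ alpha / M * (rho / 4)))%:E <= E)%E.
Proof.
move=> K0; have KM : 0 <= K `^ alpha / M by rewrite divr_ge0 ?powR_ge0// ltW.
have r40 : 0 < rho / 4 by rewrite divr_gt0.
have r4 : rho / 4 <= q0.1 by rewrite q0_len; move: rho0; lra.
have -> : mass q0 * (K `^ alpha / M * (rho / 4)) =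
    \sum_(i < 1) mass q0 * (K `^ alpha / M * (rho / 4)) by rewrite big_ord1.
apply: (energy_ge tN (Q := fun=> q0) (c := fun=> K `^ alpha / M * (rho / 4))).
- by [].
- by move=> _; rewrite mulr_ge0// ltW.
move=> theta Tt; have [/set_mem qt|nq] := boolP (theta \in fibers0 q0); last first.
  by rewrite big_pred0// fiber_energy_ge0.
have [a [b [/andP[a0 ab] bs La Lb seg]]] :=
  fiber_segment tN qt (ltW r40) r4 (lexx _).
have -> : \sum_(i < 1 | true) K `^ alpha / M * (rho / 4) =
    \sum_(i < 1 | xpredT i) K `^ alpha / M * (arc_length (chi theta) b - arc_length (chi theta) a).
  rewrite !big_ord1 La Lb q0_len; congr (_ * _); lra.
apply: (fiber_energy_ge tN (P := xpredT) (a := fun=> a) (b := fun=> b)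
  (c := fun=> K `^ alpha / M) Tt).
- by move=> i _; split; [rewrite a0|exact: bs|exact: KM].
- by move=> i j _ _ _ _ _; rewrite !ord1.
move=> i t _ tab; have [/andP[t1 t2] pE _] := seg t tab; have /andP[at_ _] := tab.
have L0 : 0 < arc_length (chi theta) t by exact: lt_le_trans t1.
have t0 := le_trans a0 at_.
have qq0 : path_le (arc_path (chi theta) t) q0 by split.
apply: (cost_density_ge alpha01 (ltW K0)).
- apply: (lt_le_trans trunk_mass_gt0).
  by have := mass_prefix tN _ qq0; apply; exact: L0.
- exact: (mass_le tN (arc_path (chi theta) t)).
- exact: (trunk_weight_large K0 qt t0 L0 t2 pE).
Qed.

End Trunk.

(** Arbitrarily large weights on the trunk, which has positive length and mass, give an
    arbitrarily large cost, since [alpha] is positive. *)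
Theorem energy_steep : 0 < alpha -> E = +oo%E.
Proof.
move=> alpha0.
have [k Gk] : exists k : nat,
    (0 < leb [set theta | Theta0 M N theta /\ (k.+1%:R^-1 < enorm (X theta))%R])%E.
  have T0 : (0 < leb (Theta0 M N))%E by rewrite (leb_Theta0 tN) lte_fin.
  apply: (leb_bigcup_gt0 T0) => theta Tt.
  have X0 : 0 < enorm (X theta) by rewrite lt_neqAle enorm_ge0 andbT eq_sym enorm_eq0 X_neq0.
  by have [k kX] := exists_natSinv_lt X0; exists k.
set rho : R := k.+1%:R^-1; have rho0 : 0 < rho by rewrite invr_gt0.
set G := [set theta | _] in Gk.
have rho20 : 0 < rho / 2 by rewrite divr_gt0.
have Gr theta : G theta -> Theta0 M N theta /\ rho / 2 < enorm (X theta).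
  move=> [Tt rX]; split => //; apply: le_lt_trans rX.
  by rewrite ler_pdivrMr// ler_peMr ?ler1n// ltW.
have [q0 [q0a q0l Gq]] := common_trunk tN mult_gt0 rho20 Gk Gr.
have Gq' : (0 < leb [set theta | fibers0 q0 theta /\ (rho < enorm (X theta))%R])%E.
  by apply: (lt_le_trans Gq); apply: leb_le => theta [qt [_ rX]].
have m0 : 0 < mass q0 by exact: (trunk_mass_gt0 Gq').
have b0 : 0 < mass q0 * (rho / 4) / M by rewrite divr_gt0// mulr_gt0// divr_gt0.
have E0 : (0 <= E)%E by apply: integral_ge0 => theta _; exact: fiber_energy_ge0.
apply: contrapT => /eqP Einf.
have Ef : E \is a fin_num by rewrite ge0_fin_numE// ltey.
have x0 : 0 < fine E / (mass q0 * (rho / 4) / M) + 1.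
  by rewrite ltr_wpDl// divr_ge0 ?fine_ge0// ltW.
set x := _ + 1 in x0.
have K0 : 0 < x `^ alpha^-1 by rewrite powR_gt0.
have := trunk_energy_ge rho0 q0a q0l Gq' K0.
rewrite -powRrM mulVf ?gt_eqF// powRr1 ?(ltW x0)// -(fineK Ef) lee_fin.
have -> : mass q0 * (x / M * (rho / 4)) = x * (mass q0 * (rho / 4) / M) by ring.
rewrite -ler_pdivlMr// leNgt => /negP; apply.
by rewrite ltrDl.
Qed.

End SteepCost.

(** * Concave flux functions *)

Section FluxFunction.
Context {R : realType}.
Variable f : R -> R.
Hypothesis f_continuous : {within `[0, +oo[, continuous f}.
Hypothesis f_derivable : forall z, 0 < z -> derivable f z 1.
Hypothesis f_deriv_gt0 : forall z, 0 < z -> 0 < f^`()%classic z.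

Let f_mvt x y : 0 <= x -> x < y -> exists2 z, x < z < y & f y - f x = f^`()%classic z * (y - x).
Proof.
move=> x0 xy; have [|| z zxy fz] := @MVT R f f^`()%classic x y xy.
- move=> z; rewrite in_itv/= => /andP[xz _]; rewrite derive1E; apply/derivableP.
  by apply: f_derivable; exact: le_lt_trans xz.
- apply: continuous_subspaceW f_continuous => z; rewrite /= !in_itv/= => /andP[xz _].
  by rewrite andbT (le_trans x0).
by exists z; rewrite // -in_itv.
Qed.

Lemma increasing_of_derivative x y : 0 <= x -> x <= y -> f x <= f y.
Proof.
move=> x0; rewrite le_eqVlt => /orP[/eqP ->//|xy].
have [z /andP[xz zy] e] := f_mvt x0 xy; rewrite -subr_ge0 e mulr_ge0//.
  by rewrite ltW// f_deriv_gt0// (le_lt_trans x0).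
by rewrite subr_ge0 ltW.
Qed.

Hypothesis f_derivable2 : forall z, 0 < z -> derivable f^`()%classic z 1.
Hypothesis f_deriv2_le0 : forall z, 0 < z -> f^`(2)%classic z <= 0.

Lemma derivative_nonincreasing x y : 0 < x -> x <= y -> f^`()%classic y <= f^`()%classic x.
Proof.
move=> x0; rewrite le_eqVlt => /orP[/eqP ->//|xy].
have [|| z zxy fz] := @MVT R f^`()%classic (f^`()%classic)^`()%classic x y xy.
- move=> z; rewrite in_itv/= => /andP[xz _]; rewrite derive1E; apply/derivableP.
  by apply: f_derivable2; exact: lt_trans xz.
- apply: derivable_within_continuous => z; rewrite in_itv/= => /andP[xz _].
  by apply: f_derivable2; exact: lt_le_trans xz.
move: zxy; rewrite in_itv/= => /andP[xz zy].
rewrite -subr_le0 fz mulr_le0_ge0 ?subr_ge0 ?(ltW xy)//.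
have := f_deriv2_le0 (lt_trans x0 xz).
by rewrite derive1nS derive1n1.
Qed.

(** A concave function lies below its tangent at 1. *)
Lemma affine_bound z : 0 <= z -> f z <= f 1 + f^`()%classic 1 * z.
Proof.
move=> z0; have d0 := ltW (f_deriv_gt0 (ltr01 : 0 < 1)).
have [z1|z1] := leP z 1.
  by apply: (le_trans (increasing_of_derivative z0 z1)); rewrite lerDl mulr_ge0.
have [c /andP[c1 cz] e] := f_mvt ler01 z1.
rewrite -lerBlDl e; apply: (@le_trans _ _ (f^`()%classic 1 * (z - 1))).
  by apply: ler_wpM2r; [rewrite subr_ge0 ltW|exact: derivative_nonincreasing (ltW c1)].
by apply: ler_wpM2l => //; rewrite gerBl.
Qed.

End FluxFunction.

(** * Infinite irrigation cost *)

Theorem theorem3p9 (R : realType) (d : nat) (hd : (2 <= d)%N)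
  (mu : {finite_measure set (borelR R d) -> \bar R})
  (mu_neq0 : mu setT != 0%E)
  (mu_regular : ahlfors_regular mu d%:R)
  (f : R -> R)
  (f_ge0 : forall z, 0 <= z -> 0 <= f z)
  (f_continuous : {within `[0, +oo[, continuous f})
  (f_C2 : forall z, 0 < z ->
     [/\ derivable f z 1, derivable f^`() z 1 & {for z, continuous f^`(2)}])
  (f_at0 : f 0 = 0)
  (f_deriv_gt0 : forall z, 0 < z -> 0 < f^`() z)
  (f_deriv2_le0 : forall z, 0 < z -> f^`(2) z <= 0)
  (alpha : R) (halpha : 0 <= alpha <= 1)
  (hyp : alpha < 1 - d%:R^-1 \/
     exists2 beta : R, beta < 1 - (d%:R - 1)^-1 &
       (0 < limf_einf (fun z => (z `^ (- beta) * f z)%:E) 0^'+)%E) :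
  weighted_irrigation_cost f alpha mu = +oo%E.
Proof.
case: d hd mu mu_neq0 mu_regular hyp => [//|[//|n]] _ mu mu_neq0 [_ [C C1 reg]] hyp.
have C0 : 0 < C by exact: lt_le_trans C1.
have upper x r : msupp mu x -> 0 <= r <= 1 -> (mu (eball x r) <= (C * r ^+ n.+2)%:E)%E.
  move=> xs r01; have /andP[r0 _] := r01.
  by rewrite -powR_mulrn//; have [] := reg x r xs r01.
have dvb z (z0 : 0 < z) : derivable f z 1 by have [] := f_C2 z z0.
have dvb2 z (z0 : 0 < z) : derivable f^`() z 1 by have [] := f_C2 z z0.
have f_mono := increasing_of_derivative f_continuous dvb f_deriv_gt0.
have f_lin := affine_bound f_continuous dvb f_deriv_gt0 dvb2 f_deriv2_le0.
have A0 : 0 <= f 1 by exact: f_ge0.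
have B0 : 0 <= f^`() 1 by apply: ltW; exact: f_deriv_gt0.
have M0 : 0 < fine (mu setT).
  by rewrite fine_gt0// lt_neqAle eq_sym mu_neq0 measure_ge0/= ltey_eq fin_num_measure.
apply/eqP; rewrite -leye_eq; apply: le_ereal_inf_tmp => _ [chi [plan A2] <-].
have [N [tN NP]] := tame_cover (ltn0Sn _) C0 (ltW M0) upper plan A2.
have mult_gt0 theta t : Theta0 (fine (mu setT)) N theta -> 0 <= t < stop_time chi theta ->
  0 < mult (fine (mu setT)) chi theta t by move=> /NP[h _ _]; exact: h.
have X_supp theta : Theta0 (fine (mu setT)) N theta -> msupp mu (endpoint chi theta).
  by move=> /NP[].
have X_neq0 theta : Theta0 (fine (mu setT)) N theta -> endpoint chi theta != 0.
  by move=> /NP[].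
have law (V : set (borelR R n.+2)) : measurable V -> mu V = completed_lebesgue_measure
    [set theta | Theta (fine (mu setT)) theta /\ V (endpoint chi theta)].
  by case: plan => _ _ _; apply.
rewrite leye_eq; apply/eqP; have [low|high] := ltP alpha (1 - n.+2%:R^-1).
  exact: (energy_low_exponent tN M0 mult_gt0 X_supp X_neq0 law (ltn0Sn _) C0 upper
    A0 B0 f_ge0 f_mono f_lin f_continuous halpha low).
case: hyp => [|[beta betan lim_gt0]]; first by rewrite ltNge high.
have alpha0 : 0 < alpha.
  by apply: lt_le_trans high; rewrite subr_gt0 invf_lt1// ltr1n.
have betan' : beta < 1 - n.+1%:R^-1 by move: betan; rewrite -natr1 addrK.
have [c [y0 [c0 y00 f_low]]] := power_lower_bound betan' lim_gt0.
exact: (energy_steep tN M0 mult_gt0 X_supp X_neq0 law C0 upper A0 B0 f_ge0 f_mono f_lin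
  f_continuous halpha c0 y00 f_low alpha0).
Qed.
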